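(* If $p=p(n)<n^{-1}$ and further $1-np\gg n^{-1/3}$ (i.e. $n^{1/3}(1-np)\to\infty$ as $n\to\infty$), then $$\chi(G(n,p))\sim\operatorname{AsN}\Bigl(\frac{1}{1-np},\ \frac{2p}{(1-np)^5}\Bigr)$$ and $$\operatorname{Var}\chi(G(n,p))\sim\frac{2p}{(1-np)^5}\qquad\text{as } n\to\infty.$$
   Context: $G(n,p)$ is the Erdős–Rényi random graph on $n$ vertices in which each possible edge is present with probability $p$, independently of all other edges. For a graph $G$ on $n$ vertices with connected components $\mathcal C_1,\dots,\mathcal C_K$, the susceptibility is $\chi(G)=\frac1n\sum_{i=1}^K|\mathcal C_i|^2$, the mean size of the component containing a uniformly random vertex. $X_n\sim\operatorname{AsN}(\mu_n,\sigma_n^2)$ means that $(X_n)$ is a sequence of random variables and $\mu_n$ and $\sigma_n>0$ are real numbers such that $(X_n-\mu_n)/\sigma_n$ converges in distribution to the standard normal distribution $N(0,1)$. For real sequences, $a_n\sim b_n$ means $a_n=(1+o(1))b_n$.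
   Formalization: The asymptotic normality is stated under the extra assumption n²p → ∞, which is necessary: for p = n⁻² the graph is empty with probability tending to e^(−1/2), so the limit has an atom, and for p = 0 the variance parameter is 0. The variance claim is unchanged. *)

(* Defs.v *)
From HB Require Import structures.
From mathcomp Require Import all_boot all_order all_algebra.
From mathcomp Require Import all_classical all_reals all_analysis.

Set Implicit Arguments.
Unset Strict Implicit.
Unset Printing Implicit Defensive.

Import Order.TTheory GRing.Theory Num.Theory.
Import numFieldNormedType.Exports.

Local Open Scope classical_set_scope.
Local Open Scope ring_scope.

Definition pedge (n : nat) : finType := {e : {set 'I_n} | #|e| == 2%N}.

(* A simple graph on 'I_n is its set of edges. *)
Definition graph (n : nat) : Type := {set pedge n}.

HB.instance Definition _ (n : nat) := Finite.on (graph n).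
HB.instance Definition _ (n : nat) := isPointed.Build (graph n) finset.set0.
HB.instance Definition _ (n : nat) := @isMeasurable.Build
  default_measure_display (graph n) discrete_measurable discrete_measurable0
  discrete_measurableC discrete_measurableU.

Section graph_theory.
Variable n : nat.
Implicit Type G : graph n.

(* No loops: [set x; x] does not have two elements. *)
Definition adj G : rel 'I_n :=
  fun x y => [exists e : pedge n,
    (e \in (G : {set pedge n})) && (val e == [set x; y]%SET)].

Definition components G : {set {set 'I_n}} :=
  equivalence_partition (connect (adj G)) [set: 'I_n]%SET.

Definition susceptibility (R : realType) G : R :=
  (\sum_(C in components G) #|C| ^ 2)%:R / n%:R.

Lemma measurable_susceptibility (R : realType) :
  measurable_fun [set: graph n] (@susceptibility R).
Proof. by []. Qed.

HB.instance Definition _ (R : realType) := @isMeasurableFun.Build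
  _ _ _ _ (@susceptibility R) (@measurable_susceptibility R).

End graph_theory.
Arguments susceptibility {n} R G.

Section gnp.
Context {R : realType} (n : nat) (p : R).

Definition gnp_pmf (G : graph n) : R :=
  \prod_(e : pedge n) bernoulli_pmf p (e \in (G : {set pedge n})).

(* As for bernoulli_prob, the value outside 0 <= p <= 1 is a dummy. *)
Definition gnp_prob (A : set (graph n)) : \bar R :=
  if 0 <= p <= 1 then (\sum_(G \in A) (gnp_pmf G)%:E)%E
  else \d_(point : graph n) A.

Lemma gnp_pmf_ge0 G : 0 <= p <= 1 -> 0 <= gnp_pmf G.
Proof. by move=> p01; apply: prodr_ge0 => e _; exact: bernoulli_pmf_ge0. Qed.

Lemma gnp_pmf1 : \sum_(G : graph n) gnp_pmf G = 1.
Proof.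
transitivity (\prod_(e : pedge n) (p + (1 - p))).
  by rewrite bigA_distr; apply: eq_bigr => G _; apply: eq_bigr => e _.
by apply: big1 => e _; rewrite addrC subrK.
Qed.

Let gnp0 : gnp_prob set0 = 0%E.
Proof. by rewrite /gnp_prob; case: ifPn => // p01; rewrite fsbig_set0. Qed.

Let gnp_ge0 A : (0 <= gnp_prob A)%E.
Proof.
rewrite /gnp_prob; case: ifPn => // p01.
rewrite fsbig_finite/=; last exact: finite_finset.
rewrite sumEFin lee_fin.
by apply: sumr_ge0 => G _; exact: gnp_pmf_ge0.
Qed.

Let gnp_sigma_additive : semi_sigma_additive gnp_prob.
Proof.
move=> F mF tF mUF; rewrite /gnp_prob; case: ifPn => p01; last first.
  exact: measure_semi_sigma_additive.
have pge0 G : (0 <= (gnp_pmf G)%:E)%E by rewrite lee_fin gnp_pmf_ge0.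
have sE A : (\sum_(G \in A) (gnp_pmf G)%:E = \esum_(G in A) (gnp_pmf G)%:E)%E.
  by rewrite esum_fset//; exact: finite_finset.
apply: cvg_toP.
  apply: ereal_nondecreasing_is_cvgn => i j ij.
  apply: lee_sum_nneg_natr => // k _ _.
  by rewrite sE; exact: esum_ge0.
rewrite sE nneseries_sum_bigcup//.
by apply: eq_eseriesr => k _; rewrite sE.
Qed.

HB.instance Definition _ := isMeasure.Build _ _ _ gnp_prob
  gnp0 gnp_ge0 gnp_sigma_additive.

Let gnp_setT : gnp_prob [set: graph n] = 1%E.
Proof.
rewrite /gnp_prob; case: ifPn => p01; last by rewrite diracT.
rewrite -gnp_pmf1 -sumEFin [RHS]fsbig_seq ?index_enum_uniq//.
by apply: eq_fsbigl; apply/seteqP; split => G //= _; exact: mem_index_enum.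
Qed.

HB.instance Definition _ :=
  @Measure_isProbability.Build _ _ R gnp_prob gnp_setT.

End gnp.
Arguments gnp_pmf {R} n p G.
Arguments gnp_prob {R} n p A.

Section standardization.
Context {d} {T : measurableType d} {R : realType}.
Variables (X : {mfun T >-> R}) (m v : R).

Definition standardized : T -> R := fun w => (X w - m) / Num.sqrt v.

Lemma measurable_standardized : measurable_fun [set: T] standardized.
Proof.
apply: measurable_realfun.measurable_funM => //.
exact: measurable_realfun.measurable_funB.
Qed.

HB.instance Definition _ := @isMeasurableFun.Build _ _ _ _
  standardized measurable_standardized.

End standardization.

Section convergence_in_distribution.
Context {R : realType} {d : nat -> measure_display}
  {T : forall n, measurableType (d n)} (P : forall n, probability (T n) R).

Definition cvg_in_distribution (X : forall n, {RV (P n) >-> R})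
    (Q : probability (measurableTypeR R) R) : Prop :=
  forall x : R, {for x, continuous (fun y : R => Q `]-oo, y]%classic)} ->
    cdf (X n) x @[n --> \oo] --> Q `]-oo, x]%classic.

(* The second parameter of normal_prob is the standard deviation.  Only the
   tails of the sequences m and v matter, so v n may be <= 0 for small n. *)
Definition AsN (X : forall n, {RV (P n) >-> R}) (m v : nat -> R) : Prop :=
  (\forall n \near \oo, 0 < v n) /\
  cvg_in_distribution (fun n => standardized (X n) (m n) (v n))
    (normal_prob (0 : R) 1).

End convergence_in_distribution.

(* Main.v *)
(** Let edges arrive independently at rate 1, so that at time [s] the edge
    probability is [1 - exp (- s)], and write [h = (1 - n s)^-1] and
    [X = n chi].  When an edge joins components of sizes [a] and [b], [X] jumps
    by [2 a b]; summing over all absent edges, the drift of [X] is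
    [X ^ 2 - sum of the |C| ^ 4], and every expectation obeys a differential
    equation in [s].

    Given the component of a vertex, the rest is again a random graph on fewer
    vertices.  This turns the equations into inequalities that are solved by
    Gronwall's lemma and induction on the number of vertices, and yields upper
    bounds of order [n h ^ (2 i - 1)] for the sum of the [|C| ^ (i + 1)],
    matching lower bounds for [i <= 3], and [Var X ~ 2 n ^ 2 s h ^ 5].

    For the limit law, [Z = h ^ -2 (chi - h)] has negligible drift and its
    quadratic variation grows at rate about [2 h ^ 2], so that
    [v = 2 s h] is its variance at time [s].  For a smoothed indicator
    [Phi ((a - z) / delta)], the solution of the backward heat equation with
    this terminal value is again of the form [Phi ((A - z) / rho s)]; Lindeberg's
    argument in continuous time then compares [Z] with a Gaussian variable by
    differentiating [E (Phi ((A - Z) / rho s))] in [s].  Finally [delta] tends to 0. *)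
Require Import Defs.
From HB Require Import structures.
From mathcomp Require Import all_boot all_order all_algebra.
From mathcomp Require Import all_classical all_reals all_analysis.
From mathcomp Require Import ring lra zify.

Set Implicit Arguments.
Unset Strict Implicit.
Unset Printing Implicit Defensive.

Import Order.TTheory GRing.Theory Num.Theory.
Import numFieldNormedType.Exports.

Local Open Scope ring_scope.

(** * Components and their moments *)

(** The equation for the mean of [X] does not close by itself: its drift contains the mean of
    [X ^ 2], which Jensen's inequality bounds only from below. The way out is an identity:
    [X ^ 2 - sum of the |C| ^ 4] is the sum over the vertices [x] of [|C(x)|] times the value of [X]
    on the graph without [C(x)]. Given [C(x)], the second factor has a mean that induction bounds by
    [n h]. Lower bounds and the variance also require how much this mean drops when [C(x)] is
    deleted: at most [h ^ 2] per vertex. Two small quantities govern the limit law: [h ^ 3 / n]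
    controls the drift of [Z] and the fluctuation of its quadratic variation, and
    [h ^ 3 / (n ^ 2 s)] controls its jumps against its standard deviation. The latter is where
    [n ^ 2 p] has to tend to infinity. *)

Section components.
Variable n : nat.
Implicit Types (U W A : {set 'I_n}) (G H : {set pedge n}) (e : pedge n).
Implicit Types (x y z : 'I_n).

(** Smaller graphs are induced subgraphs on some [U] of one graph on ['I_n], so that all of them
    live on the same edge set and probability space. Induction on the number of vertices is then on
    [#|U|]. *)
Definition induced_adj U G : rel 'I_n := fun x y => [&& x \in U, y \in U & adj G x y].

Definition cc U G x : {set 'I_n} := [set y | connect (induced_adj U G) x y]%SET.

Lemma adj_sym G : symmetric (adj G).
Proof.
move=> x y; rewrite /adj; apply: eq_existsb => e.
by rewrite (finset.setUC [set x]%SET).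
Qed.

Lemma adj_setU1 G e x y :
  adj (e |: G)%SET x y = (val e == [set x; y]%SET) || adj G x y.
Proof.
apply/existsP/orP => [[f /andP[]]|].
  rewrite finset.in_setU1 => /orP[/eqP -> ->|fG fxy]; first by left.
  by right; apply/existsP; exists f; rewrite fG.
case=> [exy|/existsP[f /andP[fG fxy]]].
  by exists e; rewrite finset.setU11.
by exists f; rewrite finset.in_setU1 fG orbT.
Qed.

Lemma induced_connect_sym U G : connect_sym (induced_adj U G).
Proof.
by apply: sym_connect_sym => x y; rewrite /induced_adj adj_sym andbCA.
Qed.

Lemma cc_refl U G x : x \in cc U G x.
Proof. by rewrite inE connect0. Qed.

Lemma cc_sym U G x y : (y \in cc U G x) = (x \in cc U G y).
Proof. by rewrite !inE induced_connect_sym. Qed.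

Lemma cc_eq U G x y : y \in cc U G x -> cc U G y = cc U G x.
Proof.
rewrite inE => xy; apply/setP => z; rewrite !inE.
by rewrite (same_connect (induced_connect_sym U G) xy).
Qed.

Lemma cc_step U G x y z : y \in cc U G x -> induced_adj U G y z -> z \in cc U G x.
Proof. by rewrite !inE => xy yz; apply: connect_trans xy (connect1 yz). Qed.

Lemma cc_min U G x A : x \in A ->
  (forall y z, y \in A -> induced_adj U G y z -> z \in A) -> cc U G x \subset A.
Proof.
move=> xA stA; apply/fintype.subsetP => y; rewrite inE => /connectP[p].
elim: p x xA => [|z p IHp] x xA /=; first by move=> _ ->.
by move=> /andP[xz zp]; apply: IHp zp; exact: stA xz.
Qed.

Lemma cc_sub U G x : x \in U -> cc U G x \subset U.
Proof. by move=> xU; apply: cc_min => // y z _ /and3P[]. Qed.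

Lemma cc_mono U W G x : U \subset W -> cc U G x \subset cc W G x.
Proof.
move=> /fintype.subsetP UW; apply: cc_min => [|y z yx /and3P[yU zU yz]].
  exact: cc_refl.
by apply: cc_step yx _; rewrite /induced_adj !UW.
Qed.

Lemma cc_setU1_mono U G e x : cc U G x \subset cc U (e |: G)%SET x.
Proof.
apply: cc_min => [|y z yx /and3P[yU zU yz]]; first exact: cc_refl.
by apply: cc_step yx _; rewrite /induced_adj yU zU adj_setU1 yz orbT.
Qed.

Lemma cc_ext U G H x :
  (forall e, val e \subset U -> (e \in G) = (e \in H)) -> cc U G x = cc U H x.
Proof.
move=> GH; apply/setP => y; rewrite !inE; apply: eq_connect => {x}y z.
rewrite /induced_adj; case: (boolP (y \in U)) => //= yU;
  case: (boolP (z \in U)) => //= zU.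
apply: eq_existsb => e; case: (eqVneq (val e) _) => [eyz|]; last by rewrite !andbF.
by rewrite GH// eyz finset.subUset !finset.sub1set yU.
Qed.

(** A path leaving the component would have to use an edge that meets it, and on those edges the
    graphs agree. Thus the event that the component of [x] is [W] is decided by the edges meeting
    [W]. *)
Lemma cc_local U G H x :
  (forall e, ~~ [disjoint val e & cc U G x] -> (e \in G) = (e \in H)) ->
  cc U H x = cc U G x.
Proof.
move=> GH.
have stepE y z : y \in cc U G x -> induced_adj U G y z = induced_adj U H y z.
  move=> yx; rewrite /induced_adj; congr [&& _, _ & _]; apply: eq_existsb => e.
  case: (eqVneq (val e) _) => [eyz|]; last by rewrite !andbF.
  rewrite GH// eyz; apply/pred0Pn; exists y.
  by rewrite !inE eqxx/=; rewrite inE in yx.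
apply/eqP; rewrite finset.eqEsubset; apply/andP; split.
  apply: cc_min => [|y z yx]; first exact: cc_refl.
  by rewrite -stepE//; exact: cc_step.
have: cc U G x \subset (cc U G x :&: cc U H x)%SET.
  apply: cc_min => [|y z]; first by rewrite finset.in_setI !cc_refl.
  rewrite !finset.in_setI => /andP[yG yH] yz; rewrite (cc_step yG yz)/=.
  by apply: cc_step yH _; rewrite -stepE.
by rewrite finset.subsetI => /andP[].
Qed.

Lemma cc_setD U G x y : y \in U -> y \notin cc U G x ->
  cc U G y = cc (U :\: cc U G x)%SET G y.
Proof.
move=> yU yx; have yUx : y \in (U :\: cc U G x)%SET by rewrite finset.in_setD yx.
apply/eqP; rewrite finset.eqEsubset; apply/andP; split; last first.
  exact/cc_mono/finset.subsetDl.
apply: cc_min => [|u v uy uv]; first exact: cc_refl.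
have uUx : u \in (U :\: cc U G x)%SET by exact: (fintype.subsetP (cc_sub G yUx)).
apply: cc_step uy _; rewrite /induced_adj uUx; case/and3P: uv => uU vU uv.
rewrite uv andbT finset.in_setD vU andbT.
move: uUx; rewrite finset.in_setD => /andP[ux _].
apply: contra ux => vx; apply: cc_step vx _.
by rewrite /induced_adj uU vU adj_sym.
Qed.

Lemma cc_setU1 U G e x y z : val e = [set x; y]%SET -> x \in U -> y \in U ->
  cc U (e |: G)%SET z =
  (if z \in (cc U G x :|: cc U G y)%SET then (cc U G x :|: cc U G y)%SET
   else cc U G z).
Proof.
move=> exy xU yU; case: ifPn => zA; apply/eqP; rewrite finset.eqEsubset; apply/andP;
  split.
- apply: cc_min => // u v uA /and3P[uU vU]; rewrite adj_setU1 exy.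
  case/orP=> [/eqP xyuv|uv].
    have : v \in [set x; y]%SET by rewrite xyuv !inE eqxx orbT.
    by rewrite !inE => /orP[]/eqP ->; rewrite connect0 ?orbT.
  have iuv : induced_adj U G u v by rewrite /induced_adj uU vU.
  move: uA; rewrite !finset.in_setU => /orP[] uA; rewrite (cc_step uA iuv) ?orbT//.
- have yx' : y \in cc U (e |: G)%SET x.
    by rewrite inE; apply: connect1; rewrite /induced_adj xU yU adj_setU1 exy eqxx.
  have zx' : z \in cc U (e |: G)%SET x.
    move: zA; rewrite finset.in_setU => /orP[] zA.
      exact: (fintype.subsetP (cc_setU1_mono _ _ _ _)) zA.
    by rewrite -(cc_eq yx'); exact: (fintype.subsetP (cc_setU1_mono _ _ _ _)) zA.
  rewrite (cc_eq zx') finset.subUset cc_setU1_mono/=.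
  by rewrite -(cc_eq yx') cc_setU1_mono.
- apply: cc_min => [|u v uz /and3P[uU vU]]; first exact: cc_refl.
  rewrite adj_setU1 exy => /orP[/eqP xyuv|uv].
    have : u \in [set x; y]%SET by rewrite xyuv !inE eqxx.
    rewrite !inE; case/orP=> /eqP ux; case/negP: zA; rewrite finset.in_setU -ux.
      by rewrite -cc_sym uz.
    by rewrite -!(cc_sym _ _ z) uz orbT.
  by apply: cc_step uz _; rewrite /induced_adj uU vU.
- exact: cc_setU1_mono.
Qed.

Lemma cc_setU1_out U G e x y z : val e = [set x; y]%SET ->
  ~~ ((x \in U) && (y \in U)) -> cc U (e |: G)%SET z = cc U G z.
Proof.
move=> exy xyU; apply: cc_ext => f fU; rewrite finset.in_setU1.
case: eqP => [fe|//]; case/negP: xyU; move: fU; rewrite fe exy.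
by rewrite finset.subUset !finset.sub1set.
Qed.

Lemma cc_set0 U x : cc U finset.set0 x = [set x]%SET.
Proof.
apply/eqP; rewrite finset.eqEsubset finset.sub1set cc_refl andbT.
apply: cc_min => [|y z _]; first by rewrite finset.set11.
by move=> /and3P[_ _ /existsP[e]]; rewrite finset.in_set0.
Qed.

Lemma pedge_pair e : exists x y, x != y /\ val e = [set x; y]%SET.
Proof.
have /cards2P[x [y [xy exy]]] := valP e.
by exists x, y; split.
Qed.

End components.

Section moments.
Variables (R : realType) (n : nat).
Implicit Types (U W : {set 'I_n}) (G : {set pedge n}) (e : pedge n).
Implicit Types (x y z : 'I_n) (i j : nat).

Definition cs U G x : R := #|cc U G x|%:R.

(* [moment U i G] is the sum of the (i+1)-st powers of the component sizes of
   the subgraph of [G] induced on [U]. *)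
Definition moment U i G : R := \sum_(x in U) cs U G x ^+ i.

Lemma cs_ge0 U G x : 0 <= cs U G x. Proof. exact: ler0n. Qed.

Lemma moment_ge0 U i G : 0 <= moment U i G.
Proof. by apply: sumr_ge0 => x _; rewrite exprn_ge0 ?cs_ge0. Qed.

Lemma moment_mono U W i G : U \subset W -> moment U i G <= moment W i G.
Proof.
move=> UW; rewrite /moment [leRHS](bigID (mem U))/= -[leLHS]addr0.
apply: lerD; last by apply: sumr_ge0 => x _; rewrite exprn_ge0 ?cs_ge0.
rewrite [leRHS](eq_bigl (mem U)) => [|x].
  apply: ler_sum => x _; apply: lerXn2r; rewrite ?nnegrE ?cs_ge0//.
  by rewrite ler_nat subset_leq_card ?cc_mono.
by rewrite /= andbC; case: (boolP (x \in U)) => //= /(fintype.subsetP UW).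
Qed.

Lemma moment_set0 U i : moment U i finset.set0 = #|U|%:R.
Proof.
rewrite /moment (eq_bigr (fun=> 1)) => [|x _]; first by rewrite sumr_const.
by rewrite /cs cc_set0 cards1 expr1n.
Qed.

Lemma sum_cc U G x (f : R) : x \in U -> \sum_(y in cc U G x) f = cs U G x * f.
Proof. by move=> xU; rewrite sumr_const -mulr_natl. Qed.

(** Split the pairs [(x, y)] in the product of the two moments by whether [y] lies in the component
    of [x]. If it does, both sizes coincide and there are [cs U G x] choices of [y], which gives the
    exponent [i + j + 1]. *)
Lemma sum_moment_setD U G i j :
  \sum_(x in U) cs U G x ^+ i * moment (U :\: cc U G x) j G =
  moment U i G * moment U j G - moment U (i + j).+1 G.
Proof.
apply/eqP; rewrite eq_sym subr_eq; apply/eqP.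
rewrite [LHS]mulr_suml -big_split/=; apply: eq_bigr => x xU.
rewrite exprSr exprD -mulrA -mulrDr; congr (_ * _).
rewrite [moment U j G](bigID (fun y => y \in cc U G x))/= addrC; congr (_ + _).
  apply: eq_big => [y|y /andP[yU yx]]; first by rewrite finset.in_setD andbC.
  by rewrite /cs [in LHS](cc_setD yU yx).
rewrite (eq_bigl (fun y => y \in cc U G x)) => [|y].
  rewrite (eq_bigr (fun=> cs U G x ^+ j)) => [|y yx].
    by rewrite sum_cc// mulrC.
  by rewrite /cs (cc_eq yx).
rewrite andbC; case: (boolP (_ \in cc _ _ _)) => //= yx.
exact: (fintype.subsetP (cc_sub G xU)).
Qed.

(** The guard removes loops and pairs inside one component, so that a sum over all ordered pairs
    sees only the edges that merge two components. *)
Definition join_sum U (phi : R -> R -> R) G x y : R :=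
  if [&& x \in U, y \in U & y \notin cc U G x]
  then phi (cs U G x) (cs U G y) else 0.

Lemma moment_jump U i G e x y : val e = [set x; y]%SET ->
  moment U i (e |: G)%SET - moment U i G =
  join_sum U (fun a b => (a + b) ^+ i.+1 - a ^+ i.+1 - b ^+ i.+1) G x y.
Proof.
move=> exy; rewrite /join_sum.
have [/andP[xU yU]|xyU] := boolP ((x \in U) && (y \in U)); last first.
  rewrite andbA (negbTE xyU)/=; apply/eqP; rewrite subr_eq0; apply/eqP.
  by apply: eq_bigr => z _; rewrite /cs (cc_setU1_out _ _ exy).
rewrite xU yU/=; have [yx|yx]/= := boolP (y \in cc U G x).
  apply/eqP; rewrite subr_eq0; apply/eqP; apply: eq_bigr => z zU.
  rewrite /cs (cc_setU1 _ _ exy)// (cc_eq yx) finset.setUid.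
  by case: ifPn => // zx; rewrite (cc_eq zx).
have dxy : [disjoint cc U G x & cc U G y].
  apply/pred0Pn => -[z /andP[/= zx zy]]; case/negP: yx.
  by rewrite cc_sym -(cc_eq zy) cc_sym.
have cxy : #|(cc U G x :|: cc U G y)%SET|%:R = cs U G x + cs U G y.
  by rewrite -natrD; congr _%:R; apply/eqP; rewrite (leq_card_setU _ _).2.
rewrite /moment -sumrB.
rewrite (bigID (fun z => z \in (cc U G x :|: cc U G y)%SET))/= [X in _ + X]big1 ?addr0;
  last first.
  by move=> z /andP[zU zA]; rewrite /cs (cc_setU1 _ _ exy)// (negbTE zA) subrr.
rewrite (eq_bigl (fun z => z \in (cc U G x :|: cc U G y)%SET)); last first.
  move=> z; rewrite andbC; case: (boolP (z \in _)) => //= zA.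
  by apply: (fintype.subsetP _ _ zA); rewrite finset.subUset !cc_sub.
rewrite (eq_bigl (mem [predU cc U G x & cc U G y])); last by move=> z;
  rewrite finset.in_setU.
rewrite (bigU _ _ _ dxy)/=.
rewrite (eq_bigr (fun=> (cs U G x + cs U G y) ^+ i - cs U G x ^+ i)); last first.
  move=> z zx; rewrite /cs (cc_setU1 _ _ exy)// finset.in_setU zx/= (cc_eq zx).
  by rewrite cxy.
rewrite [X in _ + X](eq_bigr (fun=> (cs U G x + cs U G y) ^+ i - cs U G y ^+ i));
  last first.
  move=> z zy; rewrite /cs (cc_setU1 _ _ exy)// finset.in_setU zy/= orbT (cc_eq zy).
  by rewrite cxy.
by rewrite !sum_cc// !exprS; ring.
Qed.

(** The factor 2 arises because each edge is met as two ordered pairs of vertices. *)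
Lemma sum_pedge (phi : pedge n -> R) (h : 'I_n -> 'I_n -> R) :
  (forall e x y, val e = [set x; y]%SET -> phi e = h x y) ->
  (forall x, h x x = 0) ->
  2 * \sum_e phi e = \sum_x \sum_y h x y.
Proof.
move=> phih h0.
have hE x y : h x y = \sum_(e : pedge n | val e == [set x; y]%SET) h x y.
  have [<-|xy] := eqVneq x y; first by rewrite h0 big1.
  have exy : #|[set x; y]%SET| == 2%N by rewrite cards2 xy.
  by rewrite (big_pred1 (exist _ [set x; y]%SET exy : pedge n)).
rewrite pair_bigA/= (eq_bigr _ (fun p _ => hE p.1 p.2)) (exchange_big_dep predT)//=.
rewrite mulr_sumr; apply: eq_bigr => e _.
have [u [v [uv euv]]] := pedge_pair e.
rewrite (eq_bigr (fun=> phi e)) => [|[x y] /= /eqP exy]; last by rewrite (phih _ _ _ exy).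
rewrite (bigD1 (u, v)) ?euv//= (bigD1 (v, u))/=; last first.
  by rewrite finset.setUC eqxx xpair_eqE negb_and eq_sym uv.
rewrite big1 ?addr0; first by ring.
move=> [x y] /= /andP[/andP[/eqP uvxy]]; rewrite !xpair_eqE => N1 N2.
have : x \in [set u; v]%SET by rewrite uvxy !inE eqxx.
have : y \in [set u; v]%SET by rewrite uvxy !inE eqxx orbT.
rewrite !inE => /orP[]/eqP yE /orP[]/eqP xE; move: N1 N2 uv uvxy;
  rewrite {}yE {}xE ?eqxx//= => _ _ uv E.
- have : v \in [set u; u]%SET by rewrite -E !inE eqxx orbT.
  by rewrite !inE eq_sym orbb (negbTE uv).
- have : u \in [set v; v]%SET by rewrite -E !inE eqxx.
  by rewrite !inE orbb (negbTE uv).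
Qed.

Lemma join_sumE U phi G : \sum_x \sum_y join_sum U phi G x y =
  \sum_(x in U) \sum_(y in (U :\: cc U G x)%SET) phi (cs U G x) (cs U G y).
Proof.
rewrite [RHS]big_mkcond/=; apply: eq_bigr => x _.
case: ifPn => xU; last by rewrite big1// => y _; rewrite /join_sum (negbTE xU).
rewrite [RHS]big_mkcond/=; apply: eq_bigr => y _.
by rewrite /join_sum xU/= finset.in_setD andbC.
Qed.

Lemma join_sum_pow U G i j :
  \sum_x \sum_y join_sum U (fun a b => a ^+ i * b ^+ j) G x y =
  moment U i G * moment U j G - moment U (i + j).+1 G.
Proof.
rewrite join_sumE -sum_moment_setD; apply: eq_bigr => x xU.
rewrite mulr_sumr; apply: eq_bigr => y; rewrite finset.in_setD => /andP[yx yU].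
by rewrite /cs [in LHS](cc_setD yU yx).
Qed.

Lemma eq_join_sum U G phi psi : phi =2 psi ->
  \sum_x \sum_y join_sum U phi G x y = \sum_x \sum_y join_sum U psi G x y.
Proof.
move=> eq_phi; apply: eq_bigr => x _; apply: eq_bigr => y _.
by rewrite /join_sum eq_phi.
Qed.

Lemma join_sum_refl U phi G x : join_sum U phi G x x = 0.
Proof. by rewrite /join_sum cc_refl/= !andbF. Qed.

(* The generator of the process that adds every missing edge at rate 1. *)
Definition gen (F : {set pedge n} -> R) G : R :=
  \sum_e (F (e |: G)%SET - F G).

(** The binomial expansion of the jump loses its two pure powers; each remaining monomial sums to a
    product of two moments minus the pairs within one component. *)
Lemma gen_moment U i G : 2 * gen (moment U i) G =
  \sum_(j < i) 'C(i.+1, j.+1)%:R *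
    (moment U (i - j) G * moment U j.+1 G - moment U i.+2 G).
Proof.
rewrite (sum_pedge (fun e x y => @moment_jump U i G e x y))/=; last first.
  by move=> x; rewrite join_sum_refl.
have jE (a b : R) : (a + b) ^+ i.+1 - a ^+ i.+1 - b ^+ i.+1 =
    \sum_(j < i) 'C(i.+1, j.+1)%:R * (a ^+ (i - j) * b ^+ j.+1).
  rewrite exprDn big_ord_recl big_ord_recr/= bin0 mulr1n subn0 expr0 mulr1.
  rewrite binn mulr1n subnn expr0 mul1r.
  have addBB (p q r : R) : p + (q + r) - p - r = q by ring.
  rewrite addBB.
  by apply: eq_bigr => j _; rewrite -mulr_natl /bump/= add1n subSS.
rewrite (eq_join_sum _ _ jE).
transitivity (\sum_(j < i) 'C(i.+1, j.+1)%:R *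
    \sum_x \sum_y join_sum U (fun a b => a ^+ (i - j) * b ^+ j.+1) G x y).
  under [RHS]eq_bigr do rewrite mulr_sumr.
  rewrite [RHS]exchange_big; apply: eq_bigr => x _.
  under [RHS]eq_bigr do rewrite mulr_sumr.
  rewrite [RHS]exchange_big; apply: eq_bigr => y _.
  rewrite /join_sum; case: ifP => // _.
  by rewrite big1// => j _; rewrite mulr0.
by apply: eq_bigr => j _; rewrite join_sum_pow addnS subnK// ltnW.
Qed.

(** The jump of [moment U 1] at a merging edge is [2 a b]. All other edges have jump 0, and [r] has
    to be positive because [0 ^ 0 = 1]. *)
Lemma sum_jump_pow U r G : (0 < r)%N ->
  2 * \sum_e (moment U 1 (e |: G)%SET - moment U 1 G) ^+ r =
  2 ^+ r * (moment U r G ^+ 2 - moment U (r + r).+1 G).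
Proof.
move=> r0.
rewrite (sum_pedge (h := join_sum U (fun a b => 2 ^+ r * (a ^+ r * b ^+ r)) G)).
- rewrite expr2 -join_sum_pow mulr_sumr; apply: eq_bigr => x _.
  rewrite mulr_sumr; apply: eq_bigr => y _.
  by rewrite /join_sum; case: ifP; rewrite ?mulr0.
- move=> e x y exy; rewrite (moment_jump _ _ _ exy) /join_sum; case: ifP => _.
    by rewrite -!exprMn; congr (_ ^+ _); ring.
  by rewrite expr0n gtn_eqF.
- by move=> x; rewrite join_sum_refl.
Qed.

Lemma jump_ge0 U e G : 0 <= moment U 1 (e |: G)%SET - moment U 1 G.
Proof.
rewrite subr_ge0; apply: ler_sum => x _; rewrite !expr1 ler_nat.
exact/subset_leq_card/cc_setU1_mono.
Qed.

End moments.

(** * The random graph as a process *)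

Section expectation.
Variables (R : realType) (n : nat).
Implicit Types (U W : {set 'I_n}) (G H : {set pedge n}) (e : pedge n).
Implicit Types (x y z : 'I_n) (i j : nat) (s : R) (F : {set pedge n} -> R).

(* Time [s] corresponds to the edge probability [1 - exp (- s)]: every missing
   edge then appears at rate 1. *)
Definition Ex s F : R := \sum_G gnp_pmf n (1 - expR (- s)) G * F G.

Lemma edge_prob01 s : 0 <= s -> 0 <= 1 - expR (- s) <= 1.
Proof.
move=> s0; rewrite subr_ge0 -expR0 ler_expR oppr_le0 s0/= expR0.
by rewrite gerBl expR_ge0.
Qed.

Lemma eq_Ex s F1 F2 : F1 =1 F2 -> Ex s F1 = Ex s F2.
Proof. by move=> eqF; apply: eq_bigr => G _; rewrite eqF. Qed.

Lemma ExD s F1 F2 : Ex s (fun G => F1 G + F2 G) = Ex s F1 + Ex s F2.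
Proof. by rewrite -big_split; apply: eq_bigr => G _; rewrite mulrDr. Qed.

Lemma ExZ s c F : Ex s (fun G => c * F G) = c * Ex s F.
Proof. by rewrite mulr_sumr; apply: eq_bigr => G _; rewrite mulrCA. Qed.

Lemma ExZr s c F : Ex s (fun G => F G * c) = Ex s F * c.
Proof. by rewrite mulr_suml; apply: eq_bigr => G _; rewrite mulrA. Qed.

Lemma ExB s F1 F2 : Ex s (fun G => F1 G - F2 G) = Ex s F1 - Ex s F2.
Proof. by rewrite -sumrB; apply: eq_bigr => G _; rewrite mulrBr. Qed.

Lemma Ex_sum s (I : finType) (P : pred I) (F : I -> {set pedge n} -> R) :
  Ex s (fun G => \sum_(i | P i) F i G) = \sum_(i | P i) Ex s (F i).
Proof.
by rewrite exchange_big; apply: eq_bigr => G _; rewrite mulr_sumr.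
Qed.

Lemma Ex_cst s c : Ex s (fun=> c) = c.
Proof. by rewrite /Ex -mulr_suml gnp_pmf1 mul1r. Qed.

Lemma ler_Ex s F1 F2 : 0 <= s -> (forall G, F1 G <= F2 G) -> Ex s F1 <= Ex s F2.
Proof.
move=> s0 F12; apply: ler_sum => G _; apply: ler_wpM2l => //.
by apply: gnp_pmf_ge0; exact: edge_prob01.
Qed.

Lemma Ex_ge0 s F : 0 <= s -> (forall G, 0 <= F G) -> 0 <= Ex s F.
Proof. by move=> s0 F0; rewrite -[leLHS](Ex_cst s); exact: ler_Ex. Qed.

Lemma Ex_norm s F : 0 <= s -> `|Ex s F| <= Ex s (fun G => `|F G|).
Proof.
move=> s0; apply: le_trans (ler_norm_sum _ _ _) _; apply: ler_sum => G _.
by rewrite normrM ger0_norm// gnp_pmf_ge0//; exact: edge_prob01.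
Qed.

Lemma Ex_sqr_le s F : 0 <= s -> Ex s F ^+ 2 <= Ex s (fun G => F G ^+ 2).
Proof.
move=> s0; rewrite -subr_ge0.
have -> : Ex s (fun G => F G ^+ 2) - Ex s F ^+ 2 = Ex s (fun G => (F G - Ex s F) ^+ 2).
  rewrite [RHS](@eq_Ex s _ (fun G => F G ^+ 2 + (- (2 * Ex s F) * F G + Ex s F ^+ 2))).
    by rewrite !ExD ExZ Ex_cst; ring.
  by move=> G; ring.
by apply: Ex_ge0 => // G; rewrite sqr_ge0.
Qed.

Lemma gnp_pmf_pow (p : R) G : gnp_pmf n p G = p ^+ #|G| * (1 - p) ^+ #|~: G|%SET.
Proof.
rewrite /gnp_pmf (bigID (mem G))/=; congr (_ * _).
  by rewrite (eq_bigr (fun=> p)) => [|e ->//]; rewrite prodr_const.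
rewrite (eq_bigr (fun=> 1 - p)) => [|e /negbTE ->//]; rewrite prodr_const.
by congr (_ ^+ _); apply: eq_card => e; rewrite !inE.
Qed.

Lemma Ex0 F : Ex 0 F = F finset.set0.
Proof.
rewrite /Ex (bigD1 finset.set0)//= big1 => [|G G0]; rewrite gnp_pmf_pow oppr0 expR0 subrr.
  by rewrite cards0 expr0 subr0 expr1n !mul1r addr0.
by rewrite expr0n cards_eq0 (negbTE G0) !mul0r.
Qed.

(** Take two independent copies and exchange their edges outside [B]. This preserves the joint
    weight and turns [F1 G * F2 G] into [F1 G * F2 H]. *)
Lemma Ex_indep s (B : {set pedge n}) F1 F2 :
  (forall G H, G :&: B = H :&: B -> F1 G = F1 H)%SET ->
  (forall G H, G :\: B = H :\: B -> F2 G = F2 H)%SET ->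
  Ex s (fun G => F1 G * F2 G) = Ex s F1 * Ex s F2.
Proof.
move=> F1B F2B; set w := gnp_pmf n (1 - expR (- s)).
pose sw (GH : {set pedge n} * {set pedge n}) :=
  ((GH.1 :&: B) :|: (GH.2 :\: B), (GH.2 :&: B) :|: (GH.1 :\: B))%SET.
have swK : involutive sw.
  move=> [G H]; congr pair; apply/setP => e; rewrite !inE/=;
  by case: (e \in B); rewrite ?andbT ?andbF ?orbF.
have wsw G H : w (sw (G, H)).1 * w (sw (G, H)).2 = w G * w H.
  rewrite /w /gnp_pmf -!big_split/=; apply: eq_bigr => e _.
  by rewrite !inE; case: (e \in B); rewrite ?andbT ?andbF ?orbF//= mulrC.
transitivity (\sum_G \sum_H w G * w H * (F1 G * F2 G)).
  apply: eq_bigr => G _; rewrite -/w -mulr_suml -mulr_sumr.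
  by rewrite [\sum_H w H]gnp_pmf1 mulr1.
rewrite [RHS]mulr_suml; under [RHS]eq_bigr do rewrite mulr_sumr.
rewrite !pair_bigA/= (reindex_inj (inv_inj swK))/=.
apply: eq_bigr => -[G H] _ /=; rewrite -/w wsw.
rewrite (F1B (G :&: B :|: H :\: B)%SET G); last first.
  by apply/setP => e; rewrite !inE; case: (e \in B); rewrite ?andbT ?andbF ?orbF.
rewrite (F2B (G :&: B :|: H :\: B)%SET H); last first.
  by apply/setP => e; rewrite !inE; case: (e \in B); rewrite ?andbT ?andbF ?orbF.
by rewrite mulrACA.
Qed.

(* Given that [W] is the component of [x], the graph outside [W] is still a
   random graph, as the event only concerns the edges that meet [W]. *)
Lemma Ex_component s U x (f : {set 'I_n} -> R)
    (Psi : {set 'I_n} -> {set pedge n} -> R) :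
  (forall W G H, (forall e, val e \subset W -> (e \in G) = (e \in H)) ->
     Psi W G = Psi W H) ->
  Ex s (fun G => f (cc U G x) * Psi (U :\: cc U G x)%SET G) =
  Ex s (fun G => f (cc U G x) * Ex s (Psi (U :\: cc U G x)%SET)).
Proof.
move=> PsiW.
have split_cc (g : {set 'I_n} -> R) A :
    g A = \sum_W (A == W)%:R * g W.
  rewrite (bigD1 A)//= eqxx mul1r big1 ?addr0// => W.
  by rewrite eq_sym => /negbTE ->; rewrite mul0r.
transitivity (Ex s (fun G => \sum_W (cc U G x == W)%:R * (f W * Psi (U :\: W)%SET G))).
  apply: eq_Ex => G.
  exact: (split_cc (fun W => f W * Psi (U :\: W)%SET G)).
transitivity (Ex s (fun G => \sum_W (cc U G x == W)%:R * (f W * Ex s (Psi (U :\: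
  W)%SET)))); last first.
  apply: eq_Ex => G.
  by rewrite -(split_cc (fun W => f W * Ex s (Psi (U :\: W)%SET))).
rewrite !Ex_sum; apply: eq_bigr => W _; rewrite ExZr [in RHS]mulrCA.
under eq_Ex do rewrite mulrCA.
rewrite ExZ; congr (_ * _).
apply: (Ex_indep s (B := [set e : pedge n | ~~ [disjoint val e & W]]%SET)) => G H GH.
  suff imp G1 G2 : (G1 :&: [set e : pedge n | ~~ [disjoint val e & W]] =
      G2 :&: [set e : pedge n | ~~ [disjoint val e & W]])%SET ->
      cc U G1 x == W -> cc U G2 x == W.
    by congr (_ %:R); congr nat_of_bool; apply/idP/idP; exact: imp.
  move=> G12 /eqP G1W; rewrite (@cc_local _ U G1 G2 x) ?G1W// => e eW.
  by move/setP/(_ e): G12; rewrite !inE eW !andbT.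
apply: PsiW => e eW; move/setP/(_ e): GH; rewrite !inE.
suff -> : [disjoint val e & W] by [].
apply: fintype.disjointWl eW _.
by rewrite -setI_eq0 finset.setIDAC finset.setDIl finset.setDv finset.setI0.
Qed.

Lemma moment_ext W i G H :
  (forall e, val e \subset W -> (e \in G) = (e \in H)) ->
  moment R W i G = moment R W i H.
Proof. by move=> GH; apply: eq_bigr => x _; rewrite /cs (cc_ext _ GH). Qed.

(** The forward equation: the substitution [H = e |: G] moves the generator from [F] to the weights.
    The new weight is the time derivative of [p ^ #|G| * q ^ #|~: G|] with [q = expR (- s)],
    [p' = q] and [q' = - q]. *)
Lemma ExM_gen s F : Ex s (gen F) =
  \sum_(G : {set pedge n}) (#|G|%:R * (1 - expR (- s)) ^+ #|G|.-1 * expR (- s) ^+ #|~: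
    G|%SET.+1
    - #|~: G|%SET%:R * gnp_pmf n (1 - expR (- s)) G) * F G.
Proof.
rewrite /Ex /gen; set p := 1 - expR (- s).
under [RHS]eq_bigr do rewrite mulrBl.
rewrite [RHS]sumrB.
have -> : \sum_(G : {set pedge n}) gnp_pmf n p G * (\sum_e (F (e |: G)%SET - F G)) =
  \sum_(G : {set pedge n}) \sum_(e | e \notin G) gnp_pmf n p G * F (e |: G)%SET -
  \sum_(G : {set pedge n}) \sum_(e | e \notin G) gnp_pmf n p G * F G.
  rewrite -sumrB; apply: eq_bigr => G _; rewrite mulr_sumr -sumrB.
  rewrite [LHS](bigID (mem G))/= big1 ?add0r => [|e eG].
    by apply: eq_bigr => e _; rewrite mulrBr.
  by rewrite (finset.setUidPr _) ?finset.sub1set// subrr mulr0.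
congr (_ - _); last first.
  apply: eq_bigr => G _; rewrite sumr_const -[LHS]mulr_natl [LHS]mulrA;
    congr (_%:R * _ * _).
  by apply: eq_card => e; rewrite !inE.
rewrite (exchange_big_dep predT)//=.
transitivity (\sum_e \sum_(H : {set pedge n} | e \in H)
    p ^+ #|H|.-1 * expR (- s) ^+ #|~: H|%SET.+1 * F H).
  apply: eq_bigr => e _.
  rewrite (reindex_onto (fun H => H :\ e)%SET (fun G => e |: G)%SET)/=; last first.
    by move=> G eG; apply/setP => f; rewrite !inE; case: eqVneq => // ->;
      rewrite (negbTE eG).
  apply: eq_big => [H|H /andP[_ /eqP eH]].
    rewrite !inE eqxx/=; apply/eqP/idP => [<-|eH]; first by rewrite finset.setU11.
    by rewrite finset.setD1K.
  have {}eH : e \in H by rewrite -eH finset.setU11.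
  rewrite finset.setD1K// gnp_pmf_pow /p subKr.
  have -> : #|H :\ e|%SET = #|H|.-1 by rewrite (cardsD1 e H) eH.
  congr (_ * _ ^+ _ * _); rewrite (cardsD1 e (~: (H :\ e))%SET) !inE eqxx/= add1n.
  by congr _.+1; apply: eq_card => f; rewrite !inE; case: eqVneq => // ->; rewrite eH.
rewrite (exchange_big_dep predT)//=; apply: eq_bigr => H _.
by rewrite sumr_const -[LHS]mulr_natl !mulrA.
Qed.

End expectation.

(** * Derivatives along the process and Gronwall's lemma *)

Section calculus.
Variable R : realType.
Implicit Types (f g : R -> R) (s x : R).

Lemma isd_add f g x df dg : is_derive x 1 f df -> is_derive x 1 g dg ->
  is_derive x 1 (fun u => f u + g u) (df + dg).
Proof. by move=> ? ?; exact: is_deriveD. Qed.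

Lemma isd_opp f x df : is_derive x 1 f df -> is_derive x 1 (fun u => - f u) (- df).
Proof. by move=> ?; exact: is_deriveN. Qed.

Lemma isd_mul f g x df dg : is_derive x 1 f df -> is_derive x 1 g dg ->
  is_derive x 1 (fun u => f u * g u) (df * g x + f x * dg).
Proof.
move=> fx gx; have := @is_deriveM _ _ f g x 1 df dg fx gx.
rewrite mulrfctE; congr (is_derive _ _ _ _).
by rewrite /GRing.scale/= addrC [g x * _]mulrC.
Qed.

Lemma isd_cst (c x : R) : is_derive x 1 (fun=> c) 0.
Proof. exact: is_derive_cst. Qed.

Lemma isd_id x : is_derive x 1 (fun u => u) 1.
Proof. exact: is_derive_id. Qed.

Lemma isd_exp f k x df : is_derive x 1 f df ->
  is_derive x 1 (fun u => f u ^+ k) (k%:R * f x ^+ k.-1 * df).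
Proof.
move=> fx; have := @is_deriveX _ _ f k x 1 df fx.
by congr (is_derive _ _ _ _); apply/funext => u; rewrite exprfctE.
Qed.

Lemma isd_inv f x df : f x != 0 -> is_derive x 1 f df ->
  is_derive x 1 (fun u => (f u)^-1) (- (f x)^-1 ^+ 2 * df).
Proof.
move=> fx0 fx; have := @is_deriveV _ f x df 1 fx0 fx; congr (is_derive _ _ _ _).
by rewrite /GRing.scale/= exprVn.
Qed.

Lemma isd_comp f g x df dg : is_derive (g x) 1 f df -> is_derive x 1 g dg ->
  is_derive x 1 (fun u => f (g u)) (df * dg).
Proof. by move=> ? ?; apply: is_derive1_comp. Qed.

Lemma isd_expRN x : is_derive x 1 (fun u => expR (- u)) (- expR (- x)).
Proof.
rewrite -[- expR _]mulrN1; apply: (@isd_comp expR (fun u => - u)).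
Qed.

Lemma isd_sum (I : Type) (r : seq I) (F : I -> R -> R) (dF : I -> R) x :
  (forall i, is_derive x 1 (F i) (dF i)) ->
  is_derive x 1 (fun u => \sum_(i <- r) F i u) (\sum_(i <- r) dF i).
Proof.
move=> FdF; elim: r => [|i r IHr].
  rewrite big_nil; under eq_fun do rewrite big_nil; exact: isd_cst.
by rewrite big_cons; under eq_fun do rewrite big_cons; exact: isd_add.
Qed.

Lemma isd_within f df (a b : R) : (forall x, x \in `[a, b] -> is_derive x 1 f (df x)) ->
  {within `[a, b], continuous f}%classic.
Proof.
move=> fdf; apply: derivable_within_continuous => x xab.
exact: (@ex_derive _ _ _ _ _ _ _ (fdf x xab)).
Qed.

Lemma isd_nincr f df (T : R) : 0 <= T ->
  (forall x, 0 <= x <= T -> is_derive x 1 f (df x)) ->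
  (forall x, 0 <= x <= T -> df x <= 0) -> f T <= f 0.
Proof.
move=> T0 fdf df0.
have [||c] := @MVT_segment _ f df _ _ T0.
- by move=> x; rewrite in_itv/= => /andP[x0 xT]; apply: fdf; rewrite !ltW.
- by apply: (@isd_within _ df) => x; rewrite in_itv/=; exact: fdf.
rewrite in_itv/= => cT fE; rewrite -subr_le0 fE subr0.
by rewrite mulr_le0_ge0// df0.
Qed.

Lemma isd_dist_le f df g dg (T : R) : 0 <= T ->
  (forall x, 0 <= x <= T -> is_derive x 1 f (df x)) ->
  (forall x, 0 <= x <= T -> is_derive x 1 g (dg x)) ->
  (forall x, 0 <= x <= T -> `|df x| <= dg x) -> `|f T - f 0| <= g T - g 0.
Proof.
move=> T0 fdf gdg dfdg; rewrite ler_norml; apply/andP; split.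
- have /= := @isd_nincr (fun u => - f u - g u) (fun u => - df u - dg u) T T0.
  move=> H; suff : - f T - g T <= - f 0 - g 0 by lra.
  apply: H => // x xT.
    by apply: isd_add; apply: isd_opp; [exact: fdf|exact: gdg].
  by have := dfdg _ xT; rewrite ler_norml => /andP[]; lra.
- have /= := @isd_nincr (fun u => f u - g u) (fun u => df u - dg u) T T0.
  move=> H; suff : f T - g T <= f 0 - g 0 by lra.
  apply: H => // x xT.
    by apply: isd_add; [exact: fdf|apply: isd_opp; exact: gdg].
  by have := dfdg _ xT; rewrite ler_norml => /andP[]; lra.
Qed.

(* [(1 - a s)^-1] is the mean progeny of a Galton-Watson process with mean
   offspring [a s]. *)
Definition hh (a s : R) : R := (1 - a * s)^-1.

Lemma hh_subE a s : a * s < 1 -> (1 - a * s) * hh a s = 1.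
Proof. by move=> as1; rewrite mulfV// gt_eqF// subr_gt0. Qed.

Lemma hh_ge1 a s : 0 <= a * s -> a * s < 1 -> 1 <= hh a s.
Proof. by move=> as0 as1; rewrite invf_ge1 ?subr_gt0// lerBlDr lerDl. Qed.

Lemma hh0 a : hh a 0 = 1. Proof. by rewrite /hh mulr0 subr0 invr1. Qed.

Lemma isd_lin a s : is_derive s 1 (fun u => 1 - a * u) (- a).
Proof.
have := isd_add (isd_cst 1 s) (isd_opp (isd_mul (isd_cst a s) (isd_id s))).
by congr (is_derive _ _ _ _); ring.
Qed.

Lemma isd_hh a s : a * s < 1 -> is_derive s 1 (hh a) (a * hh a s ^+ 2).
Proof.
move=> as1; have := @isd_inv (fun u => 1 - a * u) s (- a).
rewrite gt_eqF ?subr_gt0// => /(_ isT (isd_lin a s)).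
by congr (is_derive _ _ _ _); rewrite /hh; ring.
Qed.

Lemma isd_hhX a s k : a * s < 1 ->
  is_derive s 1 (fun u => hh a u ^+ k) (k%:R * a * hh a s ^+ k.+1).
Proof.
move=> as1; have := isd_exp k (isd_hh as1); congr (is_derive _ _ _ _).
by case: k => [|k]/=; rewrite ?mul0r// !exprS; ring.
Qed.

Lemma isd_shhX a s k : a * s < 1 -> is_derive s 1 (fun u => u * hh a u ^+ k)
  (hh a s ^+ k + k%:R * a * s * hh a s ^+ k.+1).
Proof.
move=> as1; by have := isd_mul (isd_id s) (isd_hhX k as1); congr (is_derive _ _ _ _);
  ring.
Qed.

(** As [hh a] has logarithmic derivative [a * hh a], the integrating factor is [(1 - a s) ^ k],
    which stays positive up to [T]. *)
Lemma gronwall f df (a T : R) k : 0 <= a -> 0 <= T -> a * T < 1 ->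
  (forall s, 0 <= s <= T -> is_derive s 1 f (df s)) ->
  (forall s, 0 <= s <= T -> df s <= k%:R * a * hh a s * f s) ->
  f 0 <= 0 -> f T <= 0.
Proof.
move=> a0 T0 aT1 fdf dfle f0.
have as1 s : 0 <= s <= T -> a * s < 1.
  by move=> /andP[_ sT]; apply: le_lt_trans aT1; exact: ler_wpM2l.
suff: f T * (1 - a * T) ^+ k <= 0.
  by rewrite pmulr_lle0// exprn_gt0// subr_gt0.
suff gle : f T * (1 - a * T) ^+ k <= f 0 * (1 - a * 0) ^+ k.
  by apply: le_trans gle _; rewrite mulr0 subr0 expr1n mulr1.
apply: (@isd_nincr (fun u => f u * (1 - a * u) ^+ k) (fun s =>
    df s * (1 - a * s) ^+ k + f s * (k%:R * (1 - a * s) ^+ k.-1 * (- a)))) => // s sT.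
  apply: isd_mul; first exact: fdf.
  exact/isd_exp/isd_lin.
have e0 : 0 < 1 - a * s by rewrite subr_gt0 as1.
suff -> : df s * (1 - a * s) ^+ k + f s * (k%:R * (1 - a * s) ^+ k.-1 * - a) =
    (df s - k%:R * a * hh a s * f s) * (1 - a * s) ^+ k.
  by rewrite mulr_le0_ge0 ?subr_le0 ?dfle// exprn_ge0// ltW.
case: k {dfle} => [|k]/=; first by rewrite !mul0r mulr0; ring.
by rewrite /hh !exprS; field; rewrite gt_eqF.
Qed.

Section generator.
Variable n : nat.

Lemma isd_gnp_pmf s (G : {set pedge n}) :
  is_derive s 1 (fun u => gnp_pmf n (1 - expR (- u)) G)
   (#|G|%:R * (1 - expR (- s)) ^+ #|G|.-1 * expR (- s) ^+ #|~: G|%SET.+1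
    - #|~: G|%SET%:R * gnp_pmf n (1 - expR (- s)) G).
Proof.
under eq_fun do rewrite gnp_pmf_pow subKr.
rewrite gnp_pmf_pow subKr.
have := isd_mul (isd_exp #|G| (isd_add (isd_cst 1 s) (isd_opp (isd_expRN s))))
  (isd_exp #|~: G|%SET (isd_expRN s)).
congr (is_derive _ _ _ _).
move: (expR (- s)) #|_|%N #|G|%N => q k m.
case: k => [|k]/=; first by rewrite !mul0r; ring.
by rewrite !exprS; ring.
Qed.

Lemma isd_Ex s (F : R -> {set pedge n} -> R) (dF : {set pedge n} -> R) :
  (forall G, is_derive s 1 (F^~ G) (dF G)) ->
  is_derive s 1 (fun u => Ex u (F u)) (Ex s dF + Ex s (gen (F s))).
Proof.
move=> FdF; have := isd_sum (index_enum _) (fun G => isd_mul (isd_gnp_pmf s G) (FdF G)).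
congr (is_derive _ _ _ _).
by rewrite ExM_gen -big_split/=; apply: eq_bigr => G _; rewrite addrC.
Qed.

Lemma isd_Ex_gen s (F : {set pedge n} -> R) :
  is_derive s 1 (fun u => Ex u F) (Ex s (gen F)).
Proof.
have := @isd_Ex s (fun=> F) (fun=> 0) (fun G => isd_cst (F G) s).
by rewrite Ex_cst add0r.
Qed.

End generator.
End calculus.

(** * Mean and variance *)

Section moment_bounds.
Variables (R : realType) (n : nat).
Implicit Types (U W : {set 'I_n}) (G H : {set pedge n}) (e : pedge n).
Implicit Types (x y z v : 'I_n).
Implicit Types (i j : nat) (s : R).

Local Notation N := (n%:R : R).
Local Notation h s := (hh N s).
Local Notation ca := (cs R).
Local Notation moment := (moment R).

Definition em U i s : R := Ex s (moment U i).

Lemma em_ge0 U i s : 0 <= s -> 0 <= em U i s.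
Proof. by move=> s0; apply: Ex_ge0 => // G; exact: moment_ge0. Qed.

Lemma em_mono U W i s : 0 <= s -> U \subset W -> em U i s <= em W i s.
Proof. by move=> s0 UW; apply: ler_Ex => // G; exact: moment_mono. Qed.

Lemma em0 U i : em U i 0 = #|U|%:R.
Proof. by rewrite /em Ex0 moment_set0. Qed.

Lemma card_leN U : #|U|%:R <= N.
Proof. by rewrite ler_nat -[leqRHS]card_ord max_card. Qed.

Lemma isd_em U i s : is_derive s 1 (em U i) (Ex s (gen (moment U i))).
Proof. exact: isd_Ex_gen. Qed.

Lemma moment_split U G x j : x \in U ->
  moment U j G = ca U G x ^+ j.+1 + moment (U :\: cc U G x)%SET j G.
Proof.
move=> xU; rewrite [LHS](bigID (fun y => y \in cc U G x))/=; congr (_ + _).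
  rewrite (eq_bigl (fun y => y \in cc U G x)) => [|y].
    rewrite (eq_bigr (fun=> ca U G x ^+ j)) => [|y yx].
      by rewrite sum_cc// exprS.
    by rewrite /cs (cc_eq yx).
  rewrite andbC; case: (boolP (_ \in cc _ _ _)) => //= yx.
  exact: (fintype.subsetP (cc_sub G xU)).
apply: eq_big => [y|y /andP[yU yx]]; first by rewrite finset.in_setD andbC.
by rewrite /cs [in LHS](cc_setD yU yx).
Qed.

Lemma card_setD_cc U G x : x \in U -> (#|U :\: cc U G x| < #|U|)%N.
Proof.
move=> xU; apply/proper_card/properP; split; first exact: finset.subsetDl.
by exists x; rewrite // finset.in_setD cc_refl.
Qed.

Lemma Ex_component_sum s U (f : {set 'I_n} -> R)
    (Psi : {set 'I_n} -> {set pedge n} -> R) :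
  (forall W G H, (forall e, val e \subset W -> (e \in G) = (e \in H)) ->
     Psi W G = Psi W H) ->
  Ex s (fun G => \sum_(x in U) f (cc U G x) * Psi (U :\: cc U G x)%SET G) =
  Ex s (fun G => \sum_(x in U) f (cc U G x) * Ex s (Psi (U :\: cc U G x)%SET)).
Proof.
by move=> PsiW; rewrite !Ex_sum; apply: eq_bigr => x _; exact: Ex_component.
Qed.

(** In expectation, the sum of [|C| ^ (i + 1) |C'| ^ (j + 1)] over ordered pairs of distinct
    components; the drift of every moment is a combination of these. *)
Definition pair_moment U i j s : R :=
  Ex s (fun G => moment U i G * moment U j G - moment U (i + j).+1 G).

Lemma pair_momentE U i j s : pair_moment U i j s =
  Ex s (fun G => \sum_(x in U) ca U G x ^+ i * em (U :\: cc U G x)%SET j s).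
Proof.
rewrite /pair_moment; under eq_Ex do rewrite -sum_moment_setD.
apply: (@Ex_component_sum s U (fun W => #|W|%:R ^+ i) (fun W => moment W j)) => W G H.
exact: moment_ext.
Qed.

Lemma pair_momentC U i j s : pair_moment U i j s = pair_moment U j i s.
Proof. by apply: eq_Ex => G; rewrite mulrC addnC. Qed.

Lemma pair_moment_le U i j s B : 0 <= s ->
  (forall x G, x \in U -> em (U :\: cc U G x)%SET j s <= B) ->
  pair_moment U i j s <= em U i s * B.
Proof.
move=> s0 emB; rewrite pair_momentE -ExZr; apply: ler_Ex => // G.
rewrite mulr_suml; apply: ler_sum => x xU.
by rewrite ler_wpM2l ?emB// exprn_ge0// cs_ge0.
Qed.

Lemma Ex_gen_moment U i s : 2 * Ex s (gen (moment U i)) =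
  \sum_(j < i) 'C(i.+1, j.+1)%:R * pair_moment U (i - j) j.+1 s.
Proof.
rewrite -ExZ; under eq_Ex do rewrite gen_moment.
rewrite Ex_sum; apply: eq_bigr => j _; rewrite ExZ; congr (_ * _).
by apply: eq_Ex => G; rewrite addnS subnK// ltnW.
Qed.

Lemma Ex_gen_moment1 U s : Ex s (gen (moment U 1)) = pair_moment U 1 1 s.
Proof.
have := Ex_gen_moment U 1 s; rewrite big_ord1 subn0.
by rewrite (_ : 'C(2, 1) = 2%N)//; lra.
Qed.

Lemma Ex_gen_moment2 U s : Ex s (gen (moment U 2)) = 3 * pair_moment U 2 1 s.
Proof.
have := Ex_gen_moment U 2 s; rewrite big_ord_recl big_ord1/= /bump/= !subn0.
rewrite (_ : 'C(3, 1) = 3%N)// (_ : 'C(3, 2) = 3%N)//.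
by rewrite (pair_momentC U 1 2); lra.
Qed.

Lemma Ex_gen_moment3 U s : Ex s (gen (moment U 3)) =
  4 * pair_moment U 3 1 s + 3 * pair_moment U 2 2 s.
Proof.
have := Ex_gen_moment U 3 s; rewrite !big_ord_recl big_ord0/= /bump/= !subn0.
rewrite (_ : 'C(4, 1) = 4%N)// (_ : 'C(4, 2) = 6%N)// (_ : 'C(4, 3) = 4%N)//.
by rewrite (pair_momentC U 1 3); lra.
Qed.

Section time.
Variable T : R.
Hypotheses (T0 : 0 <= T) (NT1 : N * T < 1).

Let Ns1 s : 0 <= s <= T -> N * s < 1.
Proof. by move=> /andP[_ sT]; apply: le_lt_trans NT1; exact: ler_wpM2l. Qed.

Lemma hT_ge1 s : 0 <= s <= T -> 1 <= h s.
Proof.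
move=> sT; apply: hh_ge1; last exact: Ns1.
by rewrite mulr_ge0//; case/andP: sT.
Qed.

Lemma hTE s : 0 <= s <= T -> (1 - N * s) * h s = 1.
Proof. by move=> sT; exact/hh_subE/Ns1. Qed.

(** Outside the component of [x] there are fewer vertices, so the induction hypothesis bounds the
    drift by [N * h] times the mean itself. The function [N * h] satisfies this relation with
    equality. *)
Lemma em1_le U s : 0 <= s <= T -> em U 1 s <= N * h s.
Proof.
move: U s; suff: forall k U s, (#|U| < k)%N -> 0 <= s <= T -> em U 1 s <= N * h s.
  by move=> H U s; apply: H (ltnSn _).
elim=> // k IHk U s Uk /andP[s0 sT].
rewrite -subr_le0; apply: (@gronwall _ (fun u => em U 1 u - N * h u)
  (fun u => Ex u (gen (moment U 1)) - N * (N * h u ^+ 2)) N s 1) => //.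
- by apply: Ns1; rewrite s0.
- move=> u /andP[u0 us]; apply: isd_add; first exact: isd_em.
  have uT : N * u < 1 by apply: Ns1; rewrite u0 (le_trans us).
  apply: isd_opp; have := isd_mul (isd_cst N u) (isd_hh uT).
  by rewrite mul0r add0r.
- move=> u /andP[u0 us]; have uT : 0 <= u <= T by rewrite u0 (le_trans us).
  rewrite Ex_gen_moment1 mul1r.
  have : pair_moment U 1 1 u <= em U 1 u * (N * h u).
    apply: pair_moment_le => // x G xU; apply: IHk => //.
    by apply: leq_trans (card_setD_cc G xU) _; rewrite -ltnS.
  by lra.
- by rewrite em0 hh0 mulr1 subr_le0 card_leN.
Qed.

Lemma em_gronwall U i s (phi dphi : R -> R) k : 0 <= s <= T ->
  (forall u, 0 <= u <= T -> is_derive u 1 phi (dphi u)) ->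
  (forall u, 0 <= u <= T ->
     Ex u (gen (moment U i)) - dphi u <= k%:R * N * h u * (em U i u - phi u)) ->
  #|U|%:R <= phi 0 -> em U i s <= phi s.
Proof.
move=> /andP[s0 sT] phiE le_gen phi0.
rewrite -subr_le0; apply: (@gronwall _ (fun u => em U i u - phi u)
  (fun u => Ex u (gen (moment U i)) - dphi u) N s k) => //.
- by apply: Ns1; rewrite s0.
- move=> u /andP[u0 us]; apply: isd_add; first exact: isd_em.
  by apply/isd_opp/phiE; rewrite u0 (le_trans us).
- by move=> u /andP[u0 us]; apply: le_gen; rewrite u0 (le_trans us).
- by rewrite em0 subr_le0.
Qed.

Lemma isd_NhX c k s : 0 <= s <= T ->
  is_derive s 1 (fun u => c * h u ^+ k) (c * (k%:R * N * h s ^+ k.+1)).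
Proof.
move=> sT; have := isd_mul (isd_cst c s) (isd_hhX k (Ns1 sT)).
by rewrite mul0r add0r.
Qed.

(** [N * h ^ 3] is the exact solution of [f' = 3 N h f] that starts at [N]. *)
Lemma em2_le U s : 0 <= s <= T -> em U 2 s <= N * h s ^+ 3.
Proof.
move=> sT; apply: (@em_gronwall U 2 s _ _ 3 sT (@isd_NhX N 3)) => [u uT|].
  rewrite Ex_gen_moment2.
  have : pair_moment U 2 1 u <= em U 2 u * (N * h u).
    by apply: pair_moment_le => [|x G _]; [case/andP: uT|exact: em1_le].
  by lra.
by rewrite hh0 expr1n mulr1 card_leN.
Qed.

End time.

Lemma hhX_ge0 T k s : N * T < 1 -> 0 <= s <= T -> 0 <= h s ^+ k.
Proof.
by move=> NT1 sT; rewrite exprn_ge0// (le_trans ler01)//; exact: hT_ge1 sT.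
Qed.

End moment_bounds.

Lemma odd_exp_add i j : (0 < i)%N -> (0 < j)%N ->
  ((2 * i).-1 + (2 * j).-1 = 2 * (i + j).-1)%N.
Proof. by case: i j => [|i] [|j]// _ _; lia. Qed.

(** In the drift of moment [i0] the two extreme terms reproduce this moment at rate [(i0 + 1) N h];
    the mixed ones are products of lower moments, of order [N ^ 2 h ^ (2 i0)]. The bound itself
    grows at rate [(2 i0 - 1) N h], and the surplus [i0 - 2 = k + 1] absorbs the mixed terms once
    the constant is large. For [i0 = 2] there is no surplus, which is why the base case contains the
    first two moments. *)
Lemma em_le (R : realType) k : exists2 C : R, 1 <= C & forall n (T : R),
  n%:R * T < 1 -> forall i U (s : R), (0 < i <= k.+2)%N -> 0 <= s <= T ->
  em (R := R) (n := n) U i s <= C * n%:R * hh n%:R s ^+ (2 * i).-1.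
Proof.
elim: k => [|k [C C1 emC]].
  exists 1 => // n T NT1 i U s /andP[i0 i2] sT; rewrite mul1r.
  case: i i0 i2 => [|[|[|i]]]// _ _.
    by rewrite expr1; exact: em1_le sT.
  exact: em2_le sT.
pose i0 := k.+3.
pose B : R := C ^+ 2 * \sum_(j < i0) 'C(i0.+1, j.+1)%:R.
have B0 : 0 <= B by rewrite mulr_ge0 ?sqr_ge0// sumr_ge0.
exists (C + B) => [|n T NT1 i U s /andP[i_gt0 ik] sT]; first by rewrite ler_wpDr.
have hX0 m u : 0 <= u <= T -> 0 <= hh n%:R u ^+ m by exact: hhX_ge0.
move: ik; rewrite leq_eqVlt => /orP[/eqP ->|ik]; last first.
  apply: (le_trans (emC _ _ NT1 _ U s _ sT)); first by rewrite i_gt0.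
  by rewrite ler_wpM2r ?hX0// ler_wpM2r// lerDl.
rewrite -/i0; have T0 : 0 <= T by case/andP: sT => /le_trans; apply.
apply: (@em_gronwall R n T NT1 U i0 s _ _ i0.+1 sT
  (@isd_NhX R n T NT1 ((C + B) * n%:R) (2 * i0).-1)) => [u uT|]; last first.
  rewrite hh0 expr1n mulr1; apply: le_trans (card_leN _ _) _.
  by rewrite ler_peMl// ler_wpDr.
have u0 : 0 <= u by case/andP: uT.
set hu := hh n%:R u; have hu0 : 0 <= hu by have := hX0 1%N u uT.
have P1 : pair_moment (R := R) U i0 1 u <= em U i0 u * (n%:R * hu).
  by apply: pair_moment_le => // x G _; exact: em1_le uT.
have Pj (j : 'I_k.+1) : pair_moment (R := R) U (i0 - j.+1) j.+2 u <=
    C ^+ 2 * n%:R ^+ 2 * hu ^+ (2 * i0).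
  have jk : (j <= k)%N by rewrite -ltnS.
  have := pair_moment_le (R := R) (U := U) (i0 - j.+1)%N u0
    (fun x G _ => emC n T NT1 j.+2 (U :\: cc U G x)%SET u jk uT).
  move=> /le_trans; apply.
  have mE : (i0 - j.+1)%N = (k.+1 - j).+1 by rewrite /i0 subSS subSn// ltnW.
  have m2 : (0 < (k.+1 - j).+1 <= k.+2)%N by rewrite /= ltnS leq_subr.
  have := emC n T NT1 (k.+1 - j).+1 U u m2 uT.
  rewrite mE => /(ler_wpM2r _)/le_trans; apply.
    by rewrite !mulr_ge0 ?hX0// (le_trans ler01).
  rewrite le_eqVlt; apply/orP; left; apply/eqP.
  rewrite mulrACA [C * _ * (C * _)]mulrACA -!expr2 -exprD; congr (_ * _ ^+ _).
  rewrite odd_exp_add// addSn addnS addnS/= subnK//; exact: leqW.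
have := Ex_gen_moment (R := R) U i0 u; rewrite {1}/i0 big_ord_recl big_ord_recr -/i0.
rewrite subn0 bin1 -pair_momentC binSn.
have -> : (i0 - lift ord0 (@ord_max k.+1))%N = 1%N by rewrite lift0 subSS subSnn.
rewrite [RHS]/=.
set S := \sum_(j < _) _ => genE.
have SB : S <= B * n%:R ^+ 2 * hu ^+ (2 * i0).
  pose b (j : 'I_k.+1) : R := 'C(i0.+1, (lift ord0 (widen_ord (leqnSn k.+1) j)).+1)%:R.
  have Sb : S <= (\sum_j b j) * (C ^+ 2 * n%:R ^+ 2 * hu ^+ (2 * i0)).
    rewrite mulr_suml; apply: ler_sum => j _; rewrite ler_wpM2l//.
  apply: (le_trans Sb).
  rewrite /B mulrA mulrA [C ^+ 2 * \sum_(j < _) _]mulrC ler_wpM2r ?exprn_ge0//.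
  rewrite ler_wpM2r ?sqr_ge0// ler_wpM2r ?sqr_ge0//.
  rewrite [leRHS]big_ord_recl [X in _ <= _ + X]big_ord_recr/=.
  by rewrite ler_wpDl// lerDl.
have C0 : 0 <= C + B by rewrite addr_ge0// (le_trans ler01).
have i0E : (2 * i0).-1 = (i0 + k.+2)%N by rewrite mul2n -addnn /i0 addSn/= !addnS.
have i0S : (i0 + k.+2).+1 = (2 * i0)%N by rewrite mul2n -addnn /i0 !addnS.
have hE : hu ^+ (2 * i0) = hu * hu ^+ (i0 + k.+2) by rewrite -i0S exprS.
have k1 : 1 <= k.+1%:R :> R by rewrite ler1n.
rewrite i0E i0S natrD -[k.+2%:R]natr1 -[i0.+1%:R]natr1 in genE *.
rewrite hE in SB *; set H := hu ^+ (i0 + k.+2) in SB *.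
have H0 : 0 <= H by rewrite /H /hu hX0.
clearbody H.
have X0 : 0 <= n%:R ^+ 2 * (hu * H) by rewrite mulr_ge0 ?sqr_ge0 ?mulr_ge0//.
have kC : (C + B) * (n%:R ^+ 2 * (hu * H)) <= k.+1%:R * ((C + B) * (n%:R ^+ 2 * (hu *
  H))).
  by rewrite ler_peMl// mulr_ge0//.
have CX0 : 0 <= C * (n%:R ^+ 2 * (hu * H)) by rewrite mulr_ge0// (le_trans ler01).
have BX0 : 0 <= B * (n%:R ^+ 2 * (hu * H)) by rewrite mulr_ge0.
have P1i : i0%:R * pair_moment (R := R) U 1 i0 u <= i0%:R * (em U i0 u * (n%:R * hu)).
  by rewrite ler_wpM2l// pair_momentC.
rewrite -pair_momentC in P1.
move: (k.+1%:R) (i0%:R) k1 kC genE P1i P1 SB => K I *.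
lra.
Qed.

(** * Deletion of vertices, lower bounds and the variance *)

Section second_order.
Variables (R : realType) (n : nat).
Implicit Types (U W : {set 'I_n}) (G H : {set pedge n}) (e : pedge n).
Implicit Types (x y z v : 'I_n).
Implicit Types (i j : nat) (s : R).

Local Notation N := (n%:R : R).
Local Notation h s := (hh N s).
Local Notation ca := (cs R).
Local Notation moment := (moment R).
Local Notation V := [set: 'I_n]%SET.

Variable T : R.
Hypotheses (T0 : 0 <= T) (NT1 : N * T < 1).

Let Ns1 s : 0 <= s <= T -> N * s < 1.
Proof. by move=> /andP[_ sT]; apply: le_lt_trans NT1; exact: ler_wpM2l. Qed.

Let hX0 k s : 0 <= s <= T -> 0 <= h s ^+ k.
Proof. exact: hhX_ge0. Qed.

(* This derivative with respect to the number of vertices obeys an evolution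
   equation of its own, which is closed by induction on the number of vertices. *)
Lemma em1_setD1_le U v s : v \in U -> 0 <= s <= T ->
  em U 1 s - em (U :\ v)%SET 1 s <= h s ^+ 2.
Proof.
move: U v s; suff: forall k U v s, (#|U| < k)%N -> v \in U -> 0 <= s <= T ->
    em U 1 s - em (U :\ v)%SET 1 s <= h s ^+ 2.
  by move=> H U v s; apply: H (ltnSn _).
elim=> // k IHk U v s Uk vU /andP[s0 sT]; set U' := (U :\ v)%SET.
have UU' : U' \subset U by exact: finset.subsetDl.
rewrite -subr_le0; apply: (@gronwall _
  (fun u => em U 1 u - em U' 1 u - h u ^+ 2)
  (fun u => Ex u (gen (moment U 1)) - Ex u (gen (moment U' 1)) - 2%:R * N * h u ^+ 3)
  N s 1) => //.
- by apply: Ns1; rewrite s0.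
- move=> u /andP[u0 us]; have uT : 0 <= u <= T by rewrite u0 (le_trans us).
  apply: isd_add; last exact/isd_opp/isd_hhX/Ns1.
  by apply: isd_add; [exact: isd_em|apply: isd_opp; exact: isd_em].
- move=> u /andP[u0 us]; have uT : 0 <= u <= T by rewrite u0 (le_trans us).
  set m := em U 1 u; set m' := em U' 1 u; set D := m - m'.
  have D0 : 0 <= D by rewrite subr_ge0 em_mono.
  have m'0 : 0 <= m' by exact: em_ge0.
  have mle : m <= N * h u by exact: (em1_le NT1 _ uT).
  have h0 : 0 <= h u by have := hX0 1 uT.
  (* [r W] is the drop of the mean when [W] is deleted; the drift of the mean is [m ^ 2] minus the
     weighted drops. *)
  pose r W := m - em (U :\: W)%SET 1 u.
  have genU : Ex u (gen (moment U 1)) = m ^+ 2 - Ex u (fun G => \sum_(x in U) ca U G x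
    * r (cc U G x)).
    rewrite Ex_gen_moment1 pair_momentE expr2 -[X in _ = X * _ - _]/(Ex u (moment U 1)).
    rewrite -ExZr -ExB; apply: eq_Ex => G.
    rewrite mulr_suml -sumrB; apply: eq_bigr => x xU; rewrite expr1 /r; ring.
  have genU' : Ex u (gen (moment U' 1)) = m' ^+ 2 -
      Ex u (fun G => \sum_(x in U') ca U' G x * (m' - em (U' :\: cc U' G x)%SET 1 u)).
    rewrite Ex_gen_moment1 pair_momentE expr2 -[X in _ = X * _ - _]/(Ex u (moment U' 1)).
    rewrite -ExZr -ExB; apply: eq_Ex => G.
    rewrite mulr_suml -sumrB; apply: eq_bigr => x xU; rewrite expr1; ring.
  (* Without [v] the drop for [W] is smaller by [D] minus the difference made by [v] on [U :\: W],
     which is at most [h ^ 2] by induction; larger components only increase the drop. Consequently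
     [D' <= m D + m' h ^ 2], to be compared with [(h ^ 2)' = 2 N h ^ 3]. *)
  have key : Ex u (fun G => \sum_(x in U') ca U' G x * (m' - em (U' :\: cc U' G x)%SET
    1 u)) +
      m' * (D - h u ^+ 2) <= Ex u (fun G => \sum_(x in U) ca U G x * r (cc U G x)).
    rewrite -[X in _ + X * _]/(Ex u (moment U' 1)) -ExZr -ExD; apply: ler_Ex => // G.
    rewrite mulr_suml -big_split/=.
    have r_ge0 W : 0 <= r W by rewrite subr_ge0 em_mono// finset.subsetDl.
    apply: (@le_trans _ _ (\sum_(x in U') ca U G x * r (cc U G x))); last first.
      rewrite [leRHS](bigID (mem U'))/=.
      rewrite [X in _ <= X + _](eq_bigl (mem U')) => [|x].
        by rewrite lerDl sumr_ge0// => x _; rewrite mulr_ge0// cs_ge0.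
      by rewrite /= andbC; case: (boolP (x \in U')) => //= /(fintype.subsetP UU').
    apply: ler_sum => x xU'; rewrite expr1 -mulrDr.
    have ccx : cc U' G x \subset cc U G x by exact: cc_mono.
    apply: (@le_trans _ _ (ca U' G x * r (cc U' G x))); last first.
      apply: ler_pM; [exact: cs_ge0|exact: r_ge0| |].
        by rewrite ler_nat subset_leq_card.
      by rewrite /r lerD2l lerN2 em_mono// finset.setDS.
    rewrite ler_wpM2l ?cs_ge0//.
    have xU : x \in U by exact: (fintype.subsetP UU').
    have vW : v \in (U :\: cc U' G x)%SET.
      rewrite finset.in_setD vU andbT; apply/negP => /(fintype.subsetP (cc_sub _ xU')).
      by rewrite !inE eqxx.
    have := IHk (U :\: cc U' G x)%SET v u _ vW uT.
    have -> : ((U :\: cc U' G x) :\ v)%SET = (U' :\: cc U' G x)%SET.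
      by rewrite !finset.setDDl finset.setUC.
    have Wk : (#|U :\: cc U' G x| < k)%N.
      apply: leq_trans (_ : #|U| <= _)%N; last by rewrite -ltnS.
      apply/proper_card/properP; split; first exact: finset.subsetDl.
      by exists x; rewrite // finset.in_setD cc_refl.
    by move=> /(_ Wk); rewrite /r /D; lra.
  have mD : m * D <= N * h u * D by rewrite ler_wpM2r.
  have m'h : m' * h u ^+ 2 <= N * h u * h u ^+ 2.
    by rewrite ler_wpM2r ?hX0//; exact: (em1_le NT1 _ uT).
  rewrite genU genU' mul1r; move: key mD m'h; rewrite -/m -/m'.
  have -> : m = m' + D by rewrite /D; ring.
  move: (Ex _ _) (Ex _ _) => E1 E2.
  by lra.
- rewrite !em0 hh0 expr1n subr_le0 (cardsD1 v U) vU natrD lerBlDr.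
  by rewrite addrC.
Qed.

Lemma em1_setD_le U W s : W \subset U -> 0 <= s <= T ->
  em U 1 s - em (U :\: W)%SET 1 s <= #|W|%:R * h s ^+ 2.
Proof.
move=> WU sT; move kW : #|W| => k; elim: k W WU kW => [|k IHk] W WU kW.
  by move/eqP: kW; rewrite cards_eq0 => /eqP ->; rewrite finset.setD0 subrr mul0r.
have [v vW] : exists v, v \in W by apply/set0Pn; rewrite -card_gt0 kW.
have kWv : #|W :\ v|%SET = k by move: kW; rewrite (cardsD1 v W) vW => -[].
have WvU : (W :\ v)%SET \subset U := fintype.subset_trans (finset.subsetDl _ _) WU.
have vUW : v \in (U :\: (W :\ v))%SET.
  by rewrite !inE eqxx/= (fintype.subsetP WU).
have := em1_setD1_le vUW sT.
rewrite finset.setDDl finset.setUC finset.setD1K//.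
by have := IHk _ WvU kWv; rewrite -natr1; lra.
Qed.

Lemma em1_setD_cc U G x s : x \in U -> 0 <= s <= T ->
  em U 1 s - ca U G x * h s ^+ 2 <= em (U :\: cc U G x)%SET 1 s.
Proof. by move=> xU sT; have := em1_setD_le (cc_sub G xU) sT; rewrite -/(ca U G x);
  lra. Qed.

(** Deleting the component of [x] lowers the mean of [moment U 1] by at most [h ^ 2] per vertex,
    which costs one more power of the component size. *)
Lemma pair_moment_ge U i s : 0 <= s <= T ->
  em U i s * em U 1 s - h s ^+ 2 * em U i.+1 s <= pair_moment U i 1 s.
Proof.
move=> sT; have s0 : 0 <= s by case/andP: sT.
rewrite pair_momentE -[em U i s]/(Ex _ _) -ExZr -[em U i.+1 s]/(Ex _ _) -ExZ -ExB.
apply: ler_Ex => // G; rewrite mulr_suml mulr_sumr -sumrB; apply: ler_sum => x xU.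
rewrite (_ : _ - _ = ca U G x ^+ i * (em U 1 s - ca U G x * h s ^+ 2)); last first.
  by rewrite (exprS (ca U G x) i); ring.
by rewrite ler_wpM2l ?em1_setD_cc// exprn_ge0// cs_ge0.
Qed.

Lemma pair_moment22_ge U s : 0 <= s <= T ->
  em U 2 s ^+ 2 - em U 5 s <= pair_moment U 2 2 s.
Proof.
move=> sT; rewrite [pair_moment _ _ _ _]ExB lerD2r.
under eq_Ex do rewrite -expr2.
by apply: Ex_sqr_le; case/andP: sT.
Qed.

Lemma pair_moment22_le U s : 0 <= s <= T -> pair_moment U 2 2 s <= N ^+ 2 * h s ^+ 6.
Proof.
move=> sT; have s0 : 0 <= s by case/andP: sT.
apply: (@le_trans _ _ (em U 2 s * (N * h s ^+ 3))).
  by apply: pair_moment_le => // x G _; exact: (em2_le NT1 _ sT).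
rewrite (_ : N ^+ 2 * _ = N * h s ^+ 3 * (N * h s ^+ 3)); last by ring.
apply: ler_wpM2r; last exact: (em2_le NT1 _ sT).
by rewrite mulr_ge0// hX0.
Qed.

Lemma em_gronwall_ge i s (phi dphi : R -> R) k : 0 <= s <= T ->
  (forall u, 0 <= u <= T -> is_derive u 1 phi (dphi u)) ->
  (forall u, 0 <= u <= T ->
     dphi u - Ex u (gen (moment V i)) <= k%:R * N * h u * (phi u - em V i u)) ->
  phi 0 <= N -> phi s <= em V i s.
Proof.
move=> /andP[s0 sT] phiE le_gen phi0.
rewrite -subr_le0; apply: (@gronwall _ (fun u => phi u - em V i u)
  (fun u => dphi u - Ex u (gen (moment V i))) N s k) => //.
- by apply: Ns1; rewrite s0.
- move=> u /andP[u0 us]; apply: isd_add; first by apply: phiE; rewrite u0 (le_trans us).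
  by apply: isd_opp; exact: isd_em.
- by move=> u /andP[u0 us]; apply: le_gen; rewrite u0 (le_trans us).
- by rewrite em0 cardsT card_ord subr_le0.
Qed.

Lemma isd_NshX c k s : 0 <= s <= T -> is_derive s 1 (fun u => c * (u * h u ^+ k))
  (c * (h s ^+ k + k%:R * N * s * h s ^+ k.+1)).
Proof.
move=> sT; have := isd_mul (isd_cst c s) (isd_shhX k (Ns1 sT)).
by rewrite mul0r add0r.
Qed.

Let NuX0 c k s : 0 <= c -> 0 <= s <= T -> 0 <= c * (s * h s ^+ k).
Proof.
move=> c0 sT; apply: mulr_ge0 => //; apply: mulr_ge0; last exact: hX0.
by case/andP: sT.
Qed.

Let NX0' c k s : 0 <= c -> 0 <= s <= T -> 0 <= c * h s ^+ k.
Proof. by move=> c0 sT; apply: mulr_ge0 => //; exact: hX0. Qed.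

(** Read as [h ^ k = h ^ k.+1 - N s h ^ k.+1], the last identity lets linear arithmetic compare
    neighbouring powers of [h]. *)
Let le_h k s : 0 <= s <= T -> 0 <= N * s /\ N * s <= 1 /\
  h s ^+ k * (1 - N * s) * h s = h s ^+ k.
Proof.
move=> sT; split; first by rewrite mulr_ge0//; case/andP: sT.
by split; [exact/ltW/Ns1|rewrite -mulrA (hTE NT1 sT) mulr1].
Qed.

(** The errors in these lower bounds carry a factor [s], so that they finally have relative order
    [h ^ 3 / N] against the variance [2 N ^ 2 s h ^ 5], which vanishes with [s] as well. *)
Lemma em1_ge s : 0 <= s <= T ->
  N * h s ^+ 1 - N * (s * h s ^+ 4) <= em V 1 s.
Proof.
move=> sT; have phiE u (uT : 0 <= u <= T) :=
  isd_add (isd_NhX NT1 N 1 uT) (isd_opp (isd_NshX N 4 uT)).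
apply: (em_gronwall_ge (k := 2) sT phiE) => [u uT|].
   rewrite Ex_gen_moment1.
  have := pair_moment_ge V 1 uT; rewrite -expr2.
  have m2 : h u ^+ 2 * em V 2 u <= h u ^+ 2 * (N * h u ^+ 3).
    by rewrite ler_wpM2l ?hX0//; exact: (em2_le NT1 _ uT).
  (* The tangent of the square at [N * h] makes the quadratic drift linear, with rate [2 N h]; hence
     [k := 2] above. *)
  have sq := sqr_ge0 (N * h u - em V 1 u).
  have [Nu0 [Nu1 hE]] := le_h 4 uT.
  have NX : 0 <= N * (N * u) * h u ^+ 5 by apply: NX0' => //; apply: mulr_ge0.
  move: hE NX m2 sq; move: (em V 1 u) (em V 2 u) (h u) => m m2 hu hE NX.
  have : N * hu ^+ 4 = N * hu ^+ 5 - N * (N * u) * hu ^+ 5.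
    by rewrite -hE; ring.
  lra.
by rewrite hh0 expr1n; lra.
Qed.

Section constants.
Variable C : R.
Hypotheses (C1 : 1 <= C) (emC : forall i U s, (0 < i <= 7)%N -> 0 <= s <= T ->
  em U i s <= C * N * h s ^+ (2 * i).-1).

Lemma em2_ge s : 0 <= s <= T ->
  N * h s ^+ 3 - 6 * C * N * (s * h s ^+ 6) <= em V 2 s.
Proof.
move=> sT.
have phiE u (uT : 0 <= u <= T) :=
  isd_add (isd_NhX NT1 N 3 uT) (isd_opp (isd_NshX (6 * C * N) 6 uT)).
apply: (em_gronwall_ge (k := 3) sT phiE) => [u uT|].
   rewrite Ex_gen_moment2.
  have u0 : 0 <= u by case/andP: uT.
  have := pair_moment_ge V 2 uT.
  have e3 : h u ^+ 2 * em V 3 u <= h u ^+ 2 * (C * N * h u ^+ 5).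
    by rewrite ler_wpM2l ?hX0//; exact: (emC V _ uT).
  have e2 : em V 2 u * (N * h u - em V 1 u) <= N * h u ^+ 3 * (N * (u * h u ^+ 4)).
    apply: (@le_trans _ _ (em V 2 u * (N * (u * h u ^+ 4)))).
      by rewrite ler_wpM2l ?em_ge0//; have := em1_ge uT; lra.
    by apply: ler_wpM2r; [exact: NuX0|exact: (em2_le NT1 _ uT)].
  have [Nu0 [Nu1 hE]] := le_h 6 uT.
  have NX0 : 0 <= N * h u ^+ 7 by apply: NX0'.
  have NX : 0 <= N * (N * u) * h u ^+ 7 by apply: NX0' => //; apply: mulr_ge0.
  have CX : N * h u ^+ 7 <= C * (N * h u ^+ 7) by rewrite ler_peMl.
  have CX' : N * (N * u) * h u ^+ 7 <= C * (N * (N * u) * h u ^+ 7) by rewrite ler_peMl.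
  move: hE NX0 NX CX CX' e2 e3.
  move: (em V 1 u) (em V 2 u) (em V 3 u) (h u) => m e2 e3 hu hE *.
  have : C * N * hu ^+ 6 = C * N * hu ^+ 7 - C * N * (N * u) * hu ^+ 7.
    by rewrite -hE; ring.
  lra.
by rewrite hh0 expr1n; lra.
Qed.

(** The main part [3 N h ^ 5 - 2 N h ^ 4] solves [f' = 4 N h f + 3 N ^ 2 h ^ 6] with [f 0 = N]. The
    inhomogeneous term is three times the square of the second moment [N h ^ 3]. *)
Lemma em3_ge s : 0 <= s <= T ->
  3 * N * h s ^+ 5 - 2 * N * h s ^+ 4 - 14 * C * N * (s * h s ^+ 8) <= em V 3 s.
Proof.
move=> sT.
have phiE u (uT : 0 <= u <= T) := isd_add
  (isd_add (isd_NhX NT1 (3 * N) 5 uT) (isd_opp (isd_NhX NT1 (2 * N) 4 uT)))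
  (isd_opp (isd_NshX (14 * C * N) 8 uT)).
apply: (em_gronwall_ge (k := 4) sT phiE) => [u uT|].
  rewrite Ex_gen_moment3.
  have u0 : 0 <= u by case/andP: uT.
  have P1 := pair_moment_ge V 3 uT.
  have P2 := pair_moment22_ge V uT.
  have e4 : h u ^+ 2 * em V 4 u <= h u ^+ 2 * (C * N * h u ^+ 7).
    by rewrite ler_wpM2l ?hX0//; exact: (emC V _ uT).
  have e5 : em V 5 u <= C * N * h u ^+ 9 by exact: (emC V _ uT).
  have e3 : em V 3 u * (N * h u - em V 1 u) <= C * N * h u ^+ 5 * (N * (u * h u ^+ 4)).
    apply: (@le_trans _ _ (em V 3 u * (N * (u * h u ^+ 4)))).
      by rewrite ler_wpM2l ?em_ge0//; have := em1_ge uT; lra.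
    by apply: ler_wpM2r; [exact: NuX0|exact: (emC V _ uT)].
  have e2 : (N * h u ^+ 3 - em V 2 u) * (N * h u ^+ 3 + em V 2 u) <=
      6 * C * N * (u * h u ^+ 6) * (2 * (N * h u ^+ 3)).
    have em2 := em2_le NT1 V uT.
    apply: ler_pM; first by rewrite subr_ge0.
    - by apply: addr_ge0; [exact: NX0'|exact: em_ge0].
    - by have := em2_ge uT; lra.
    - by lra.
  have [Nu0 [Nu1 hE]] := le_h 8 uT.
  have NX0 : 0 <= N * h u ^+ 9 by apply: NX0'.
  have NX : 0 <= N * (N * u) * h u ^+ 9 by apply: NX0' => //; apply: mulr_ge0.
  have CX : 0 <= C * (N * h u ^+ 9) by rewrite mulr_ge0// (le_trans ler01).
  have CX' : 0 <= C * (N * (N * u) * h u ^+ 9) by rewrite mulr_ge0// (le_trans ler01).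
  move: hE NX0 NX CX CX' e2 e3 e4 e5 P1 P2.
  move: (em V 1 u) (em V 2 u) (em V 3 u) (em V 4 u) (em V 5 u) (h u) => m e2 e3 e4 e5
    hu hE *.
  have : C * N * hu ^+ 8 = C * N * hu ^+ 9 - C * N * (N * u) * hu ^+ 9.
    by rewrite -hE; ring.
  lra.
by rewrite hh0 !expr1n; lra.
Qed.

Definition varm U s : R := Ex s (fun G => moment U 1 G ^+ 2) - em U 1 s ^+ 2.

Lemma varm_ge0 U s : 0 <= s -> 0 <= varm U s.
Proof. by move=> s0; rewrite subr_ge0; exact: Ex_sqr_le. Qed.

Lemma gen_moment1 U G : gen (moment U 1) G = moment U 1 G ^+ 2 - moment U 3 G.
Proof.
have := gen_moment R U 1 G; rewrite big_ord1 subn0 (_ : 'C(2, 1) = 2%N)//.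
by rewrite expr2; lra.
Qed.

Lemma gen_moment1_sqr U G : gen (fun G => moment U 1 G ^+ 2) G =
  2 * moment U 1 G * (moment U 1 G ^+ 2 - moment U 3 G) +
  2 * (moment U 2 G ^+ 2 - moment U 5 G).
Proof.
have := @sum_jump_pow R n U 2 G isT; rewrite -gen_moment1 /gen => jE.
rewrite (eq_bigr (fun e => 2 * moment U 1 G * (moment U 1 (e |: G)%SET - moment U 1 G)
    + (moment U 1 (e |: G)%SET - moment U 1 G) ^+ 2)); last by move=> e _; ring.
by rewrite big_split/= -mulr_sumr; congr (_ + _); lra.
Qed.

(** Write [moment U 1] as the squared size of the component of [x] plus the moment outside it,
    square this, and sum over [x] with the component size as weight. *)
Lemma moment1_cube U G : moment U 1 G ^+ 3 = moment U 5 G +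
  2 * (moment U 3 G * moment U 1 G - moment U 5 G) +
  \sum_(x in U) ca U G x * moment (U :\: cc U G x)%SET 1 G ^+ 2.
Proof.
have -> : moment U 1 G ^+ 3 = \sum_(x in U) ca U G x * moment U 1 G ^+ 2.
  rewrite exprS -mulr_suml; suff -> : moment U 1 G = \sum_(x in U) ca U G x by [].
  by apply: eq_bigr => x _; rewrite expr1.
have -> : moment U 5 G = \sum_(x in U) ca U G x ^+ 5 by [].
rewrite -(@sum_moment_setD _ _ U G 3 1) mulr_sumr -!big_split/=.
apply: eq_bigr => x xU; rewrite (moment_split R G 1 xU); ring.
Qed.

(* The bound is a supersolution of [v' = 4 n h v + 2 n ^ 2 h ^ 6 + 2 C n h ^ 9],
   and controls at the same time the variances on all smaller vertex sets. *)
Lemma varm_le U s : 0 <= s <= T ->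
  varm U s <= 2 * N ^+ 2 * (s * h s ^+ 5) + 2 * C * N * (s * h s ^+ 8).
Proof.
pose B s := 2 * N ^+ 2 * (s * h s ^+ 5) + 2 * C * N * (s * h s ^+ 8).
rewrite -/(B s); move: U s; suff: forall k U s, (#|U| < k)%N -> 0 <= s <= T ->
    varm U s <= B s.
  by move=> H U s; apply: H (ltnSn _).
elim=> // k IHk U s Uk /andP[s0 sT].
rewrite -subr_le0; apply: (@gronwall _ (fun u => varm U u - B u)
  (fun u => Ex u (gen (fun G => moment U 1 G ^+ 2)) -
      2%:R * em U 1 u ^+ 1 * Ex u (gen (moment U 1)) -
      (2 * N ^+ 2 * (h u ^+ 5 + 5%:R * N * u * h u ^+ 6) +
       2 * C * N * (h u ^+ 8 + 8%:R * N * u * h u ^+ 9)))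
  N s 2) => //.
- by apply: Ns1; rewrite s0.
- move=> u /andP[u0 us]; have uT : 0 <= u <= T by rewrite u0 (le_trans us).
  exact: (isd_add (isd_add (isd_Ex_gen u (fun G => moment U 1 G ^+ 2))
    (isd_opp (isd_exp 2 (isd_em U 1 u))))
    (isd_opp (isd_add (isd_NshX (2 * N ^+ 2) 5 uT) (isd_NshX (2 * C * N) 8 uT)))).
- move=> u /andP[u0 us]; have uT : 0 <= u <= T by rewrite u0 (le_trans us).
  set m := em U 1 u.
  have mle : m <= N * h u by exact: (em1_le NT1 _ uT).
  have m0 : 0 <= m by exact: em_ge0.
  have h0 : 0 <= h u by have := hX0 1 uT.
  (* The factor has to be [m] and not its bound [N * h u]: after collecting terms this expectation
     enters as twice its difference to [m * em U 3 u], which would otherwise be of the order of the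
     main term. *)
  have P31 : Ex u (fun G => moment U 3 G * moment U 1 G - moment U 5 G) <= m * em U 3 u.
    rewrite [leRHS]mulrC; apply: (@pair_moment_le _ _ U 3 1 u m u0) => x G xU.
    by apply: em_mono => //; exact: finset.subsetDl.
  have P22 := pair_moment22_le U uT; rewrite /pair_moment in P22.
  have Q0 : Ex u (fun G => moment U 1 G ^+ 2) = varm U u + m ^+ 2.
    by rewrite /varm -/m subrK.
  (* The second moment of the rest is its variance, at most [B u] by induction, plus [mW ^ 2].
     Expanding [mW] about [m] leaves [(m - mW) ^ 2], which is controlled by the deletion bound. *)
  have cube : Ex u (fun G => \sum_(x in U) ca U G x * moment (U :\: cc U G x)%SET 1 G
    ^+ 2)
      <= m * B u - m ^+ 3 + 2 * m * (varm U u + m ^+ 2 - em U 3 u) + h u ^+ 4 * em U 3 u.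
    rewrite (@Ex_component_sum _ _ u U (fun W => #|W|%:R) (fun W G => moment W 1 G ^+
      2)); last first.
      by move=> W G H GH; rewrite (moment_ext _ _ GH).
    have -> : m * B u - m ^+ 3 + 2 * m * (varm U u + m ^+ 2 - em U 3 u) + h u ^+ 4 * em
      U 3 u =
        Ex u (fun G => \sum_(x in U) (ca U G x * (B u - m ^+ 2) +
          2 * m * (ca U G x * em (U :\: cc U G x)%SET 1 u) + h u ^+ 4 * ca U G x ^+ 3)).
      have -> : varm U u + m ^+ 2 - em U 3 u = Ex u (fun G => \sum_(x in U)
          ca U G x * em (U :\: cc U G x)%SET 1 u).
        rewrite -Q0 -[em U 3 u]/(Ex _ _) -ExB; have := pair_momentE U 1 1 u.
        by rewrite /pair_moment; under eq_Ex do rewrite -expr2.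
      rewrite -ExZ -[em U 3 u]/(Ex _ _) -ExZ (_ : m * B u - m ^+ 3 = m * (B u - m ^+
        2)); last by ring.
      rewrite -[X in X * (B u - _)]/(Ex u (moment U 1)) -ExZr -!ExD; apply: eq_Ex => G.
      by rewrite mulr_suml !mulr_sumr -!big_split.
    apply: ler_Ex => // G; apply: ler_sum => x xU.
    set a := ca U G x; set mW := em _ 1 u.
    have a0 : 0 <= a by exact: cs_ge0.
    have -> : Ex u (fun G0 => moment (U :\: cc U G x)%SET 1 G0 ^+ 2) =
        varm (U :\: cc U G x)%SET u + mW ^+ 2 by rewrite /varm subrK.
    have Vle : varm (U :\: cc U G x)%SET u <= B u.
      by apply: IHk => //; apply: leq_trans (card_setD_cc G xU) _; rewrite -ltnS.
    have r0 : 0 <= m - mW by rewrite subr_ge0 em_mono// finset.subsetDl.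
    have r1 : m - mW <= a * h u ^+ 2 by have := em1_setD_cc G xU uT;
      rewrite -/m -/mW -/a; lra.
    have r2 : (m - mW) * (m - mW) <= a * h u ^+ 2 * (a * h u ^+ 2) by rewrite ler_pM.
    rewrite -subr_ge0 (_ : _ - _ = a * (B u - varm (U :\: cc U G x)%SET u +
        (a * h u ^+ 2 * (a * h u ^+ 2) - (m - mW) * (m - mW))));
          last by rewrite /a /cs; ring.
    by rewrite mulr_ge0// addr_ge0// subr_ge0.
  have gsq : Ex u (gen (fun G => moment U 1 G ^+ 2)) =
      2 * Ex u (fun G => moment U 1 G ^+ 3)
      - 2 * Ex u (fun G => moment U 3 G * moment U 1 G)
      + 2 * Ex u (fun G => moment U 2 G * moment U 2 G - moment U 5 G).
    rewrite -!ExZ -ExB -ExD; apply: eq_Ex => G; rewrite gen_moment1_sqr; ring.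
  have g1 : Ex u (gen (moment U 1)) = varm U u + m ^+ 2 - em U 3 u.
    by rewrite -Q0 -ExB; apply: eq_Ex => G; rewrite gen_moment1.
  have c3 : Ex u (fun G => moment U 1 G ^+ 3) = em U 5 u +
      2 * Ex u (fun G => moment U 3 G * moment U 1 G - moment U 5 G) +
      Ex u (fun G => \sum_(x in U) ca U G x * moment (U :\: cc U G x)%SET 1 G ^+ 2).
    by rewrite -ExZ -!ExD; apply: eq_Ex => G; exact: moment1_cube.
  have e31 : Ex u (fun G => moment U 3 G * moment U 1 G) =
    Ex u (fun G => moment U 3 G * moment U 1 G - moment U 5 G) + em U 5 u.
    by rewrite ExB subrK.
  have e3 : h u ^+ 4 * em U 3 u <= h u ^+ 4 * (C * N * h u ^+ 5).
    by rewrite ler_wpM2l ?hX0//; exact: (emC U _ uT).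
  have V0 := varm_ge0 U u0.
  have B0 : 0 <= B u.
    have C0 : 0 <= C by exact: le_trans ler01 C1.
    by apply: addr_ge0; apply: NuX0 => //; rewrite mulr_ge0// ?sqr_ge0// mulr_ge0.
  have mV : m * (varm U u + B u) <= N * h u * (varm U u + B u).
    by rewrite ler_wpM2r// addr_ge0.
  have [_ [_ hE5]] := le_h 5 uT.
  have [Nu0 [_ hE8]] := le_h 8 uT.
  have CX' : 0 <= C * (N * (N * u) * h u ^+ 9).
    apply: mulr_ge0; first exact: le_trans ler01 C1.
    by apply: NX0' => //; apply: mulr_ge0.
  have CX : 0 <= C * (N * h u ^+ 9).
    apply: mulr_ge0; first exact: le_trans ler01 C1.
    exact: NX0'.
  have {}hE5 : N ^+ 2 * h u ^+ 5 = N ^+ 2 * h u ^+ 6 - N ^+ 3 * u * h u ^+ 6.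
    by rewrite -[in LHS]hE5; ring.
  have {}hE8 : C * N * h u ^+ 8 = C * N * h u ^+ 9 - C * N * (N * u) * h u ^+ 9.
    by rewrite -[in LHS]hE8; ring.
  rewrite gsq g1 c3 e31 -/m expr1.
  have BE : N * h u * B u = 2 * (N ^+ 3 * u * h u ^+ 6) + 2 * (C * N * (N * u) * h u ^+
    9).
    by rewrite /B; ring.
  move: P31 P22 cube mV e3 V0 CX CX' BE hE5 hE8 {gsq g1 c3 e31 Q0 B0}.
  move: (Ex _ _) (Ex _ _) (Ex _ _) (em U 5 u) (em U 3 u) (varm U u) (B u) (h u)
    => E1 E2 E3 e5 e3 v b hu *.
  lra.
by rewrite /B /varm em0 Ex0 moment_set0 !mul0r !mulr0 addr0 subr0 subrr.
Qed.

(** The variance can be read off the drift of the mean: [pair_moment_ge] bounds it below by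
    [em V 3 s - h ^ 2 * em V 2 s], and the leading terms combine to
    [2 N (h ^ 5 - h ^ 4) = 2 N ^ 2 s h ^ 5]. *)
Lemma varm_ge s : 0 <= s <= T ->
  2 * N ^+ 2 * (s * h s ^+ 5) - 14 * C * N * (s * h s ^+ 8) <= varm V s.
Proof.
move=> sT; have e3 := em3_ge sT.
have := pair_moment_ge V 1 sT; rewrite -expr2 /pair_moment ExB.
under eq_Ex do rewrite -expr2.
have e2 : h s ^+ 2 * em V 2 s <= h s ^+ 2 * (N * h s ^+ 3).
  by rewrite ler_wpM2l ?hX0//; exact: (em2_le NT1 V sT).
have [_ [_ hE]] := le_h 4 sT.
rewrite -[Ex _ (moment V _)]/(em V 3 s) /varm.
move: hE e3 e2; move: (em V 1 s) (em V 2 s) (em V 3 s) (Ex _ _) (h s) => m e2 e3 E1 hu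
  hE *.
have : N * hu ^+ 4 = N * hu ^+ 5 - N * (N * s) * hu ^+ 5 by rewrite -hE; ring.
lra.
Qed.

End constants.
End second_order.

(** * Normal approximation *)

Section lindeberg.
Variables (R : realType) (n : nat).
Implicit Types (G : {set pedge n}) (e : pedge n).
Implicit Types (i j k : nat) (s : R).

Local Notation N := (n%:R : R).
Local Notation h s := (hh N s).
Local Notation V := [set: 'I_n]%SET.
Local Notation moment := (moment R V).

Variables (T C th : R).
Hypotheses (n0 : (0 < n)%N) (T0 : 0 <= T) (NT1 : N * T < 1).
Hypotheses (th0 : 0 < th) (th1 : th <= 1) (hth : h T ^+ 3 <= th ^+ 2 * N).
Hypotheses (C1 : 1 <= C) (emC : forall i (U : {set 'I_n}) s, (0 < i <= 7)%N ->
  0 <= s <= T -> em U i s <= C * N * h s ^+ (2 * i).-1).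

Let N0 : 0 < N. Proof. by rewrite ltr0n. Qed.
Let C0 : 0 <= C. Proof. exact: le_trans ler01 C1. Qed.

Let Ns1 s : 0 <= s <= T -> N * s < 1.
Proof. by move=> /andP[_ sT]; apply: le_lt_trans NT1; exact: ler_wpM2l. Qed.

Let h_ge1 s : 0 <= s <= T -> 1 <= h s.
Proof. by move=> sT; exact: hT_ge1 NT1 _ sT. Qed.

Let hX0 k s : 0 <= s <= T -> 0 <= h s ^+ k.
Proof. exact: hhX_ge0. Qed.

Let Ns0 s : 0 <= s <= T -> 0 <= N * s.
Proof. by move=> /andP[s0 _]; rewrite mulr_ge0. Qed.

Lemma hh_mono s : 0 <= s <= T -> h s <= h T.
Proof.
move=> /andP[s0 sT]; rewrite lef_pV2 ?posrE ?subr_gt0//; last 1 first.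
  by apply: Ns1; rewrite s0.
by rewrite lerD2l lerN2 ler_wpM2l.
Qed.

(** [th] stands for the size of the square root of [h T ^ 3 / N]; every surplus factor [h ^ 3] is
    traded for [th ^ 2 * N]. *)
Lemma hth_s k s : 0 <= s <= T -> h s ^+ (k + 3) <= th ^+ 2 * N * h s ^+ k.
Proof.
move=> sT; rewrite exprD mulrC; apply: ler_wpM2r; first exact: hX0.
apply: le_trans hth; apply: lerXn2r; rewrite ?nnegrE ?hh_mono//.
  exact: le_trans (h_ge1 sT).
by apply: le_trans (h_ge1 _) => //; rewrite T0 lexx.
Qed.

Let th2 : th ^+ 2 <= 1. Proof. by rewrite exprn_ile1// ltW. Qed.

Lemma hN_s k s : 0 <= s <= T -> h s ^+ (k + 3) <= N * h s ^+ k.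
Proof.
move=> sT; apply: le_trans (hth_s k sT) _; apply: ler_wpM2r; first exact: hX0.
by rewrite ler_piMl// ltW.
Qed.

(** This is what remains of the drift of [linearized_chi] once its linear part cancels: variance,
    squared bias and the third moment. *)
Lemma Ex_drift s : 0 <= s <= T ->
  Ex s (fun G => (moment 1 G - N * h s) ^+ 2 + moment 3 G) <= (3 + 3 * C) * (N * h s ^+
    5).
Proof.
move=> sT; have s0 : 0 <= s by case/andP: sT.
rewrite ExD -[X in _ + X <= _]/(em V 3 s).
have -> : Ex s (fun G => (moment 1 G - N * h s) ^+ 2) =
    varm V s + (N * h s - em V 1 s) ^+ 2.
  rewrite /varm; transitivity (Ex s (fun G => moment 1 G ^+ 2 +
      ((- (2 * (N * h s))) * moment 1 G + (N * h s) ^+ 2))).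
    by apply: eq_Ex => G; ring.
  by rewrite !ExD ExZ Ex_cst -/(em V 1 s); ring.
have v := varm_le NT1 C1 emC V sT.
have e3 : em V 3 s <= C * N * h s ^+ 5 by exact: (emC V _ sT).
have m1 := em1_ge NT1 sT; have m2 := em1_le NT1 V sT; rewrite expr1 in m1.
have d : (N * h s - em V 1 s) ^+ 2 <= (N * s * h s ^+ 4) ^+ 2.
  by apply: lerXn2r; rewrite ?nnegrE ?subr_ge0//; [apply: mulr_ge0;
    [exact: Ns0|exact: hX0]|lra].
have h8 := hN_s 5 sT; rewrite /= in h8.
have Ns_le1 : N * s <= 1 by exact/ltW/Ns1.
have d2 : (N * s * h s ^+ 4) ^+ 2 <= N * h s ^+ 5.
  apply: le_trans h8; rewrite exprMn -exprM; apply: ler_piMl; first exact: hX0.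
  by rewrite exprn_ile1// Ns0.
have t1 : N * s * (N * h s ^+ 5) <= N * h s ^+ 5.
  by apply: ler_piMl => //; apply: mulr_ge0 => //; exact: hX0.
have t2 : C * (N * s * h s ^+ 8) <= C * (N * h s ^+ 5).
  apply: ler_wpM2l => //; apply: le_trans h8; apply: ler_piMl => //; exact: hX0.
move: v e3 d d2 t1 t2; move: (varm V s) (em V 3 s) ((N * h s - em V 1 s) ^+ 2)
  ((N * s * h s ^+ 4) ^+ 2) (h s ^+ 5) (h s ^+ 8) => *.
lra.
Qed.

(** Concentration of the quadratic variation. The upper bound on the mean of [moment 2 ^ 2] and the
    lower bound on that of [moment 2] leave a mean square deviation of relative order [th ^ 2]. *)
Lemma Ex_qvar s : 0 <= s <= T ->
  Ex s (fun G => `|moment 2 G ^+ 2 - N ^+ 2 * h s ^+ 6|) <=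
  (3 + 9 * C) * th * (N ^+ 2 * h s ^+ 6).
Proof.
move=> sT; have s0 : 0 <= s by case/andP: sT.
have e22 : Ex s (fun G => moment 2 G ^+ 2) <= N ^+ 2 * h s ^+ 6 + C * N * h s ^+ 9.
  have := pair_moment22_le NT1 V sT.
  have : em V 5 s <= C * N * h s ^+ 9 by exact: (emC V _ sT).
  rewrite [pair_moment _ _ _ _]ExB.
  under [X in _ -> X - _ <= _ -> _]eq_Ex do rewrite -expr2.
  by rewrite -[X in _ - X <= _]/(em V 5 s); lra.
have e2 := em2_ge NT1 C1 emC sT.
have h9 := hth_s 6 sT; rewrite /= in h9.
have Ns_le1 : N * s <= 1 by exact/ltW/Ns1.
have t1 : C * N * (N * s * h s ^+ 9) <= C * N * h s ^+ 9.
  apply: ler_wpM2l; first by rewrite mulr_ge0.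
  by apply: ler_piMl => //; exact: hX0.
have N2h6 : 0 <= N ^+ 2 * h s ^+ 6 by apply: mulr_ge0; [exact: sqr_ge0|exact: hX0].
have c9 : C * N * h s ^+ 9 <= C * (th ^+ 2 * (N ^+ 2 * h s ^+ 6)).
  have -> : th ^+ 2 * (N ^+ 2 * h s ^+ 6) = N * (th ^+ 2 * N * h s ^+ 6) by ring.
  by rewrite -mulrA; apply: ler_wpM2l => //; apply: ler_wpM2l.
have th2N : C * (th ^+ 2 * (N ^+ 2 * h s ^+ 6)) <= C * (N ^+ 2 * h s ^+ 6).
  by apply: ler_wpM2l => //; apply: ler_piMl.
(* AM-GM: [2 |A B| <= A^2 / th + th B^2] *)
have AM (a b : R) : `|a ^+ 2 - b ^+ 2| <= th^-1 / 2 * (a - b) ^+ 2 + th / 2 * (a + b)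
  ^+ 2.
  have -> : a ^+ 2 - b ^+ 2 = (a - b) * (a + b) by ring.
  rewrite normrM -(real_normK (num_real (a - b))) -(real_normK (num_real (a + b))).
  move: `|a - b| `|a + b| => p q; rewrite -subr_ge0.
  have -> : th^-1 / 2 * p ^+ 2 + th / 2 * q ^+ 2 - p * q = th^-1 / 2 * (p - th * q) ^+ 2.
    by field; rewrite gt_eqF.
  by rewrite mulr_ge0 ?sqr_ge0// divr_ge0// invr_ge0 ltW.
apply: (@le_trans _ _ (Ex s (fun G => th^-1 / 2 * (moment 2 G - N * h s ^+ 3) ^+ 2 +
    th / 2 * (moment 2 G + N * h s ^+ 3) ^+ 2))).
  apply: ler_Ex => // G; have := AM (moment 2 G) (N * h s ^+ 3).
  by rewrite (_ : (N * h s ^+ 3) ^+ 2 = N ^+ 2 * h s ^+ 6)//; ring.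
rewrite ExD !ExZ.
have -> : Ex s (fun G => (moment 2 G - N * h s ^+ 3) ^+ 2) =
    Ex s (fun G => moment 2 G ^+ 2) - 2 * N * h s ^+ 3 * em V 2 s + N ^+ 2 * h s ^+ 6.
  transitivity (Ex s (fun G => moment 2 G ^+ 2 +
      ((- (2 * N * h s ^+ 3)) * moment 2 G + N ^+ 2 * h s ^+ 6))).
    by apply: eq_Ex => G; ring.
  by rewrite !ExD (ExZ s (- (2 * N * h s ^+ 3))) Ex_cst -/(em V 2 s); ring.
have -> : Ex s (fun G => (moment 2 G + N * h s ^+ 3) ^+ 2) =
    Ex s (fun G => moment 2 G ^+ 2) + 2 * N * h s ^+ 3 * em V 2 s + N ^+ 2 * h s ^+ 6.
  transitivity (Ex s (fun G => moment 2 G ^+ 2 +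
      ((2 * N * h s ^+ 3) * moment 2 G + N ^+ 2 * h s ^+ 6))).
    by apply: eq_Ex => G; ring.
  by rewrite !ExD (ExZ s (2 * N * h s ^+ 3)) Ex_cst -/(em V 2 s); ring.
have e2' := em2_le NT1 V sT.
have m1 : 2 * N * h s ^+ 3 * (N * h s ^+ 3 - 6 * C * N * (s * h s ^+ 6)) <=
    2 * N * h s ^+ 3 * em V 2 s.
  by apply: ler_wpM2l => //; apply: mulr_ge0; [rewrite mulr_ge0|exact: hX0].
have m2 : 2 * N * h s ^+ 3 * em V 2 s <= 2 * N * h s ^+ 3 * (N * h s ^+ 3).
  by apply: ler_wpM2l => //; apply: mulr_ge0; [rewrite mulr_ge0|exact: hX0].
have q1 : Ex s (fun G => moment 2 G ^+ 2) - 2 * N * h s ^+ 3 * em V 2 s + N ^+ 2 * h s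
  ^+ 6
    <= 13 * C * (th ^+ 2 * (N ^+ 2 * h s ^+ 6)) by lra.
have q2 : Ex s (fun G => moment 2 G ^+ 2) + 2 * N * h s ^+ 3 * em V 2 s + N ^+ 2 * h s
  ^+ 6
    <= (4 + C) * (N ^+ 2 * h s ^+ 6) by lra.
have r1 : th^-1 / 2 * (Ex s (fun G => moment 2 G ^+ 2) - 2 * N * h s ^+ 3 * em V 2 s +
  N ^+ 2 * h s ^+ 6)
    <= th^-1 / 2 * (13 * C * (th ^+ 2 * (N ^+ 2 * h s ^+ 6))).
  by apply: ler_wpM2l => //; rewrite divr_ge0// invr_ge0 ltW.
have r2 : th / 2 * (Ex s (fun G => moment 2 G ^+ 2) + 2 * N * h s ^+ 3 * em V 2 s + N
  ^+ 2 * h s ^+ 6)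
    <= th / 2 * ((4 + C) * (N ^+ 2 * h s ^+ 6)).
  by apply: ler_wpM2l => //; rewrite divr_ge0// ltW.
apply: le_trans (lerD r1 r2) _.
have -> : th^-1 / 2 * (13 * C * (th ^+ 2 * (N ^+ 2 * h s ^+ 6))) +
    th / 2 * ((4 + C) * (N ^+ 2 * h s ^+ 6)) = (2 + 7 * C) * (th * (N ^+ 2 * h s ^+ 6)).
  by field; rewrite gt_eqF.
have : 0 <= th * (N ^+ 2 * h s ^+ 6) by rewrite mulr_ge0// ltW.
rewrite -(mulrA (3 + 9 * C)); move: (th * _) => X X0.
have : 0 <= C * X by rewrite mulr_ge0.
lra.
Qed.

(** Up to a constant, this bounds the sum of the cubed jumps and thereby the Taylor remainder. The
    seventh moment comes from pairs in a common component. *)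
Lemma Ex_third s : 0 <= s <= T ->
  Ex s (fun G => moment 3 G ^+ 2) <= 2 * C ^+ 2 * (N ^+ 2 * h s ^+ 10).
Proof.
move=> sT; have s0 : 0 <= s by case/andP: sT.
have P : pair_moment V 3 3 s <= em V 3 s * (C * N * h s ^+ 5).
  by apply: pair_moment_le => // x G _; exact: (emC _ _ sT).
have e3 : em V 3 s * (C * N * h s ^+ 5) <= C * N * h s ^+ 5 * (C * N * h s ^+ 5).
  apply: ler_wpM2r; last exact: (emC _ _ sT).
  by apply: mulr_ge0; [rewrite mulr_ge0|exact: hX0].
have e7 : em V 7 s <= C * N * h s ^+ 13 by exact: (emC _ _ sT).
have h13 := hN_s 10 sT; rewrite /= in h13.
have c7 : C * N * h s ^+ 13 <= C ^+ 2 * (N ^+ 2 * h s ^+ 10).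
  have -> : C ^+ 2 * (N ^+ 2 * h s ^+ 10) = C * (C * N * (N * h s ^+ 10)) by ring.
  apply: (@le_trans _ _ (C * N * (N * h s ^+ 10))).
    by apply: ler_wpM2l h13; rewrite mulr_ge0.
  apply: ler_peMl => //; apply: mulr_ge0; first by rewrite mulr_ge0.
  by apply: mulr_ge0 => //; exact: hX0.
move: P; rewrite [pair_moment _ _ _ _]ExB.
under [X in X - _ <= _ -> _]eq_Ex do rewrite -expr2.
by rewrite -[X in _ - X <= _]/(em V 7 s); lra.
Qed.

(** Equal to [h ^ -2 (chi - h)], as a polynomial in [s]. The mean-field equation [chi' = N chi ^ 2]
    is solved by [h]; deviations from it obey [d' = 2 N h d] to first order and grow like [h ^ 2],
    which the scaling cancels. *)
Definition linearized_chi s G : R := (1 - N * s) ^+ 2 * (moment 1 G / N) - (1 - N * s).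

Let e_h s : 0 <= s <= T -> (1 - N * s) * h s = 1.
Proof. by move=> sT; exact: hTE NT1 _ sT. Qed.

Let e_hX i j s : 0 <= s <= T -> (1 - N * s) ^+ i * h s ^+ (i + j) = h s ^+ j.
Proof. by move=> sT; rewrite exprD mulrA -exprMn e_h// expr1n mul1r. Qed.

Lemma linearized_chi_setU1 s G e : linearized_chi s (e |: G)%SET =
  linearized_chi s G + (1 - N * s) ^+ 2 / N * (moment 1 (e |: G)%SET - moment 1 G).
Proof. by rewrite /linearized_chi; ring. Qed.

Lemma isd_linearized_chi s G : is_derive s 1 (fun u => linearized_chi u G)
  (- (2 * (1 - N * s) * moment 1 G) + N).
Proof.
have := isd_add (isd_mul (isd_exp 2 (isd_lin N s)) (isd_cst (moment 1 G / N) s))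
  (isd_opp (isd_lin N s)).
congr (is_derive _ _ _ _); rewrite expr1; field; rewrite gt_eqF//.
Qed.

(** This replaces integration: for positive [k] the last factor is at least 1, so the integral of
    [h ^ k.+1] over [[0, T]] is at most [T * h T ^ k]. *)
Lemma isd_majorant c k s : 0 <= s <= T ->
  is_derive s 1 (fun u => c * (u * h u ^+ k))
    (c * (h s ^+ k.+1 * (1 - N * s + k%:R * (N * s)))).
Proof.
move=> sT; have := isd_mul (isd_cst c s) (isd_shhX k (Ns1 sT)).
congr (is_derive _ _ _ _); rewrite mul0r add0r; congr (_ * _).
rewrite mulrDr exprS [X in _ = X + _](_ : _ = h s ^+ k * ((1 - N * s) * h s));
  last by ring.
by rewrite e_h// mulr1; ring.
Qed.

Section test_function.
Variables (g gz gzz : R -> R -> R) (M1 M2 M3 : R).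
Hypotheses (M1_ge0 : 0 <= M1) (M2_ge0 : 0 <= M2) (M3_ge0 : 0 <= M3).
(* [g] solves the backward heat equation [g_s = - h ^ 2 * g_zz]. *)
Hypothesis isd_g : forall s, 0 <= s <= T -> forall (z : R -> R) dz,
  is_derive s 1 z dz ->
  is_derive s 1 (fun u => g u (z u)) (gz s (z s) * dz - h s ^+ 2 * gzz s (z s)).
Hypothesis gz_le : forall s z, 0 <= s <= T -> `|gz s z| <= M1.
Hypothesis gzz_le : forall s z, 0 <= s <= T -> `|gzz s z| <= M2.
Hypothesis g_taylor : forall s z d, 0 <= s <= T -> 0 <= d ->
  `|g s (z + d) - g s z - gz s z * d - gzz s z / 2 * d ^+ 2| <= M3 * d ^+ 3.

(** Expand [g] over each jump. The first-order terms complete the square [(moment 1 G - N h) ^ 2],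
    the second-order ones cancel against the heat equation up to the fluctuation of
    [moment 2 G ^ 2], and the cubed jumps bound the rest. *)
Lemma gen_test_le s G : 0 <= s <= T ->
  `|gz s (linearized_chi s G) * (- (2 * (1 - N * s) * moment 1 G) + N)
     - h s ^+ 2 * gzz s (linearized_chi s G) + gen (fun G => g s (linearized_chi s G))
       G| <=
  M1 * ((1 - N * s) ^+ 2 / N * ((moment 1 G - N * h s) ^+ 2 + moment 3 G)) +
  (M2 * ((1 - N * s) ^+ 4 / N ^+ 2 * `|moment 2 G ^+ 2 - N ^+ 2 * h s ^+ 6|) +
   M2 * ((1 - N * s) ^+ 4 / N ^+ 2 * moment 5 G)) +
  M3 * ((1 - N * s) ^+ 6 / N ^+ 3 * (4 * moment 3 G ^+ 2)).
Proof.
move=> sT; set Z := linearized_chi s G; set ep := 1 - N * s.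
have ep0 : 0 <= ep by rewrite subr_ge0 ltW// Ns1.
have eph : ep * h s = 1 by exact: e_h.
pose d e := moment 1 (e |: G)%SET - moment 1 G.
have d0 e : 0 <= d e by exact: jump_ge0.
have s1 : \sum_e d e = moment 1 G ^+ 2 - moment 3 G by rewrite -gen_moment1.
have s2 : \sum_e d e ^+ 2 = 2 * (moment 2 G ^+ 2 - moment 5 G).
  by have := @sum_jump_pow R n V 2 G isT; rewrite /d; lra.
have s3 : \sum_e d e ^+ 3 = 4 * (moment 3 G ^+ 2 - moment 7 G).
  by have := @sum_jump_pow R n V 3 G isT; rewrite /d; lra.
have c0 : 0 <= ep ^+ 2 / N by rewrite divr_ge0// sqr_ge0.
have gen_taylor : `|gen (fun G => g s (linearized_chi s G)) G - gz s Z * (ep ^+ 2 / N *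
  \sum_e d e)
    - gzz s Z / 2 * ((ep ^+ 2 / N) ^+ 2 * \sum_e d e ^+ 2)| <=
    M3 * ((ep ^+ 2 / N) ^+ 3 * \sum_e d e ^+ 3).
  rewrite /gen !mulr_sumr -!sumrB; apply: le_trans (ler_norm_sum _ _ _) _.
  apply: ler_sum => e _; rewrite linearized_chi_setU1 -/Z -/(d e) -/ep -!exprMn.
  by apply: g_taylor => //; rewrite mulr_ge0.
have m7 := moment_ge0 R V 7 G; have m5 := moment_ge0 R V 5 G;
  have m3 := moment_ge0 R V 3 G.
set D := gen _ _ in gen_taylor *.
have -> : gz s Z * (- (2 * ep * moment 1 G) + N) - h s ^+ 2 * gzz s Z + D =
    gz s Z * (ep ^+ 2 / N * ((moment 1 G - N * h s) ^+ 2 - moment 3 G)) +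
    gzz s Z * (ep ^+ 4 / N ^+ 2 * (moment 2 G ^+ 2 - N ^+ 2 * h s ^+ 6) -
       ep ^+ 4 / N ^+ 2 * moment 5 G) +
    (D - gz s Z * (ep ^+ 2 / N * \sum_e d e)
    - gzz s Z / 2 * ((ep ^+ 2 / N) ^+ 2 * \sum_e d e ^+ 2)).
  have hE : h s = ep^-1 by [].
  rewrite s1 s2 hE; field.
  by rewrite gt_eqF//=; apply/eqP => e0; move: eph; rewrite e0 mul0r => /eqP;
    rewrite eq_sym oner_eq0.
apply: le_trans (ler_normD _ _) _; apply: lerD.
  apply: le_trans (ler_normD _ _) _; apply: lerD.
    rewrite normrM; apply: ler_pM => //; first exact: gz_le.
    rewrite normrM (ger0_norm c0); apply: ler_wpM2l => //.
    apply: le_trans (ler_normB _ _) _.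
    by rewrite (ger0_norm (sqr_ge0 _)) (ger0_norm m3).
  rewrite -mulrDr normrM; apply: ler_pM => //; first exact: gzz_le.
  have c4 : 0 <= ep ^+ 4 / N ^+ 2 by rewrite divr_ge0// exprn_ge0.
  apply: le_trans (ler_normB _ _) _.
  by rewrite !(normrM (ep ^+ 4 / N ^+ 2)) (ger0_norm c4) (ger0_norm m5).
apply: (le_trans gen_taylor); apply: ler_wpM2l => //.
rewrite (_ : (ep ^+ 2 / N) ^+ 3 = ep ^+ 6 / N ^+ 3); last by field; rewrite gt_eqF.
apply: ler_wpM2l; first by rewrite divr_ge0// exprn_ge0.
by rewrite s3; lra.
Qed.

(** As [linearized_chi] starts at 0, the left side is the accumulated generator defect. Its drift,
    quadratic variation and jump parts have rates of order [h ^ 3], [th h ^ 2] and [h ^ 4 / N]. *)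
Lemma lindeberg_bound : `|Ex T (fun G => g T (linearized_chi T G)) - g 0 0| <=
  (3 + 3 * C) * M1 * (T * h T ^+ 2) + (3 + 10 * C) * th * M2 * (T * h T ^+ 1) +
  8 * C ^+ 2 / N * M3 * (T * h T ^+ 3).
Proof.
have Ex0E : Ex 0 (fun G => g 0 (linearized_chi 0 G)) = g 0 0.
  rewrite Ex0 /linearized_chi moment_set0 cardsT card_ord mulr0 subr0 expr1n divff
    ?gt_eqF//.
  by rewrite mul1r subrr.
rewrite -[X in _ - X]Ex0E.
pose b (k1 k2 k3 u : R) := k1 * (u * h u ^+ 2) + k2 * (u * h u ^+ 1) + k3 * (u * h u ^+
  3).
have -> : (3 + 3 * C) * M1 * (T * h T ^+ 2) + (3 + 10 * C) * th * M2 * (T * h T ^+ 1) +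
  8 * C ^+ 2 / N * M3 * (T * h T ^+ 3) =
    b ((3 + 3 * C) * M1) ((3 + 10 * C) * th * M2) (8 * C ^+ 2 / N * M3) T -
    b ((3 + 3 * C) * M1) ((3 + 10 * C) * th * M2) (8 * C ^+ 2 / N * M3) 0.
  by rewrite /b !mul0r !mulr0 !addr0 subr0.
set K1 := (3 + 3 * C) * M1; set K2 := (3 + 10 * C) * th * M2.
set K3 := 8 * C ^+ 2 / N * M3.
pose db s : R := K1 * (h s ^+ 3 * (1 - N * s + 2%:R * (N * s))) +
  K2 * (h s ^+ 2 * (1 - N * s + 1%:R * (N * s))) +
  K3 * (h s ^+ 4 * (1 - N * s + 3%:R * (N * s))).
pose du s : R := Ex s (fun G =>
    gz s (linearized_chi s G) * (- (2 * (1 - N * s) * moment 1 G) + N) - h s ^+ 2 * gzz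
      s (linearized_chi s G)) +
  Ex s (gen (fun G => g s (linearized_chi s G))).
have isd_u s : 0 <= s <= T -> is_derive s 1 (fun u => Ex u (fun G => g u
  (linearized_chi u G))) (du s).
  move=> sT; apply: (@isd_Ex R n s (fun u G => g u (linearized_chi u G))) => G.
  exact: (isd_g sT (isd_linearized_chi s G)).
have isd_b s : 0 <= s <= T -> is_derive s 1 (b K1 K2 K3) (db s).
  move=> sT; exact: (isd_add (isd_add (isd_majorant K1 2 sT) (isd_majorant K2 1 sT))
    (isd_majorant K3 3 sT)).
have := isd_dist_le T0 isd_u isd_b; apply; rewrite /du /db /K1 /K2 /K3 {isd_u isd_b du
  db K1 K2 K3 b Ex0E}.
move=> s sT; have s0 : 0 <= s by case/andP: sT.
rewrite -ExD; apply: le_trans (Ex_norm _ s0) _.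
apply: (le_trans (ler_Ex s0 (fun G => gen_test_le G sT))).
rewrite !ExD !ExZ -[Ex s (moment 5)]/(em V 5 s).
set ep := 1 - N * s; have ep0 : 0 <= ep by rewrite subr_ge0 ltW// Ns1.
have epX k : 0 <= ep ^+ k by rewrite exprn_ge0.
have E1 := Ex_drift sT; have E2 := Ex_qvar sT; have E3 := Ex_third sT.
have e5 : em V 5 s <= th * C * (N ^+ 2 * h s ^+ 6).
  apply: le_trans (emC _ _ sT) _ => //.
  have h9 := hth_s 6 sT; rewrite /= in h9.
  have hN6 : 0 <= th * C * N * (N * h s ^+ 6).
    by apply: mulr_ge0; [rewrite !mulr_ge0// ltW|apply: mulr_ge0 => //; exact: hX0].
  apply: (@le_trans _ _ (C * N * (th ^+ 2 * N * h s ^+ 6))).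
    by apply: ler_wpM2l => //; rewrite mulr_ge0.
  rewrite -subr_ge0 (_ : _ - _ = (1 - th) * (th * C * N * (N * h s ^+ 6))); last by ring.
  by rewrite mulr_ge0// subr_ge0.
have f1 : M1 * (ep ^+ 2 / N * Ex s (fun G => (moment 1 G - N * h s) ^+ 2 + moment 3 G))
    <= (3 + 3 * C) * M1 * h s ^+ 3.
  have -> : (3 + 3 * C) * M1 * h s ^+ 3 = M1 * (ep ^+ 2 / N * ((3 + 3 * C) * (N * h s
    ^+ 5))).
    by rewrite -(e_hX 2 3 sT) -/ep; field; rewrite gt_eqF.
  by apply: ler_wpM2l => //; apply: ler_wpM2l => //; rewrite divr_ge0.
have f2 : M2 * (ep ^+ 4 / N ^+ 2 * Ex s (fun G => `|moment 2 G ^+ 2 - N ^+ 2 * h s ^+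
  6|)) +
    M2 * (ep ^+ 4 / N ^+ 2 * em V 5 s) <= (3 + 10 * C) * th * M2 * h s ^+ 2.
  have -> : (3 + 10 * C) * th * M2 * h s ^+ 2 =
      M2 * (ep ^+ 4 / N ^+ 2 * ((3 + 9 * C) * th * (N ^+ 2 * h s ^+ 6))) +
      M2 * (ep ^+ 4 / N ^+ 2 * (th * C * (N ^+ 2 * h s ^+ 6))).
    by rewrite -(e_hX 4 2 sT) -/ep; field; rewrite gt_eqF.
  have c4 : 0 <= ep ^+ 4 / N ^+ 2 by rewrite divr_ge0// sqr_ge0.
  by apply: lerD; apply: ler_wpM2l => //; apply: ler_wpM2l.
have f3 : M3 * (ep ^+ 6 / N ^+ 3 * (4 * Ex s (fun G => moment 3 G ^+ 2))) <=
    8 * C ^+ 2 / N * M3 * h s ^+ 4.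
  have -> : 8 * C ^+ 2 / N * M3 * h s ^+ 4 =
      M3 * (ep ^+ 6 / N ^+ 3 * (4 * (2 * C ^+ 2 * (N ^+ 2 * h s ^+ 10)))).
    by rewrite -(e_hX 6 4 sT) -/ep; field; rewrite gt_eqF.
  apply: ler_wpM2l => //; apply: ler_wpM2l; first by rewrite divr_ge0// exprn_ge0.
  by apply: ler_wpM2l.
have up c k : 0 <= c -> (0 < k)%N ->
    c * h s ^+ k.+1 <= c * (h s ^+ k.+1 * (ep + k%:R * (N * s))).
  move=> c0 k0; apply: ler_wpM2l => //; apply: ler_peMr; first exact: hX0.
  rewrite /ep -addrA lerDl addrC subr_ge0 ler_peMl ?Ns0//.
  by rewrite ler1n.
apply: (@le_trans _ _ ((3 + 3 * C) * M1 * h s ^+ 3 + (3 + 10 * C) * th * M2 * h s ^+ 2 +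
    8 * C ^+ 2 / N * M3 * h s ^+ 4)).
  by apply: lerD => //; apply: lerD.
by apply: lerD; [apply: lerD|]; apply: up => //;
  rewrite !mulr_ge0 ?addr_ge0 ?mulr_ge0 ?sqr_ge0 ?invr_ge0// ltW.
Qed.

End test_function.
End lindeberg.

(** * The standard normal distribution function *)

Section gaussian.
Variable R : realType.
Implicit Types x y z d t K M : R.

Local Notation phi := (normal_pdf (0 : R) 1).

Definition Phi x : R := fine (normal_prob (0 : R) 1 `]-oo, x]%classic).

Lemma PhiE x : normal_prob (0 : R) 1 `]-oo, x]%classic = (Phi x)%:E.
Proof. by rewrite /Phi fineK// fin_num_measure. Qed.

Lemma Phi_ge0 x : 0 <= Phi x.
Proof. by rewrite fine_ge0. Qed.

Lemma Phi_le1 x : Phi x <= 1.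
Proof. by rewrite -lee_fin -PhiE; exact: probability_le1. Qed.

Lemma isd_derive1 (f : R -> R) x l :
  derivable f x 1 -> (f^`())%classic x = l -> is_derive x 1 f l.
Proof. by move=> df fl; apply: DeriveDef => //; rewrite -derive1E. Qed.

Lemma isd_Phi x : is_derive x 1 Phi (phi x).
Proof.
have xx1 : x < x + 1 by rewrite ltrDl.
have cphi : {for x, continuous phi}.
  by apply: continuous_normal_pdf; rewrite oner_eq0.
have iphi : lebesgue_measure.-integrable [set` Interval -oo%O (BRight (x + 1))]
    (EFin \o phi).
  by apply: (integrableS _ _ (@subsetT _ _)) => //; exact: integrable_normal_pdf.
have [dPhi PhiE'] := continuous_FTC1 xx1 iphi (ltNyr x) cphi.
by have := isd_derive1 dPhi PhiE'; congr (is_derive _ _ _ _).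
Qed.

Lemma phiE x : phi x = normal_peak 1 * expR (- (x ^+ 2 / 2)).
Proof.
rewrite normal_pdfE ?oner_eq0// /normal_fun subr0 expr1n.
by rewrite mulNr.
Qed.

Lemma isd_phi x : is_derive x 1 phi (- (x * phi x)).
Proof.
rewrite (_ : normal_pdf 0 1 = fun u => normal_peak 1 * expR (- (u ^+ 2 * 2^-1)));
  last first.
  by apply/funext => u; exact: phiE.
have dq := isd_opp (isd_mul (isd_exp 2 (isd_id x)) (isd_cst (2^-1 : R) x)).
have := isd_mul (isd_cst (normal_peak (1 : R)) x) (isd_comp (is_derive_expR _) dq).
by congr (is_derive _ _ _ _); rewrite expr1; field.
Qed.

Lemma isd_dphi x : is_derive x 1 (fun u => - (u * phi u)) ((x ^+ 2 - 1) * phi x).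
Proof.
have := isd_opp (isd_mul (isd_id x) (isd_phi x)).
by congr (is_derive _ _ _ _); ring.
Qed.

(** The inequality [t <= exp t] bounds [x ^ 2 * exp (- x ^ 2 / 2)] by 2, and
    [|x| <= (x ^ 2 + 1) / 2] handles the first power. *)
Lemma phi_bounds : exists2 K : R, 0 <= K & forall x,
  [/\ `|phi x| <= K, `|x * phi x| <= K & `|(x ^+ 2 - 1) * phi x| <= K].
Proof.
set c : R := normal_peak 1; have c0 : 0 <= c by exact: normal_peak_ge0.
exists (3 * c); first by rewrite mulr_ge0.
move=> x; rewrite phiE -/c; set E := expR _.
have E0 : 0 <= E by exact: expR_ge0.
have E1 : E <= 1 by rewrite -expR0 ler_expR oppr_le0 divr_ge0// sqr_ge0.
have x2E : x ^+ 2 * E <= 2.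
  have : x ^+ 2 / 2 <= expR (x ^+ 2 / 2).
    by apply: le_trans (expR_ge1Dx _); rewrite lerDr.
  move=> /(ler_wpM2r E0); rewrite -expRD subrr expR0; lra.
have cE : 0 <= c * E by rewrite mulr_ge0.
have cE1 : c * E <= c by rewrite ler_piMr.
have cx2 : c * (x ^+ 2 * E) <= c * 2 by rewrite ler_wpM2l.
have cx20 : 0 <= c * (x ^+ 2 * E).
  by apply: mulr_ge0 => //; apply: mulr_ge0 => //; exact: sqr_ge0.
have p1 : 0 <= c * E * (x - 1) ^+ 2 by apply: mulr_ge0 => //; exact: sqr_ge0.
have p2 : 0 <= c * E * (x + 1) ^+ 2 by apply: mulr_ge0 => //; exact: sqr_ge0.
by split; rewrite ler_norml; apply/andP; split; lra.
Qed.

(** One integration of a power bound; the gain [1 / k.+1] is given up to keep one constant. *)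
Lemma taylor_step (f df : R -> R) M k :
  (forall t, 0 <= t <= 1 -> is_derive t 1 f (df t)) -> f 0 = 0 ->
  (forall t, 0 <= t <= 1 -> `|df t| <= M * t ^+ k) ->
  forall t, 0 <= t <= 1 -> `|f t| <= M * t ^+ k.+1.
Proof.
move=> fdf f0 dfM t t01; have /andP[t0 t1] := t01.
have M0 : 0 <= M.
  by have := dfM 1; rewrite lexx ler01 expr1n mulr1 => /(_ isT); exact: le_trans.
have st (s : R) : 0 <= s <= t -> 0 <= s <= 1.
  by move=> /andP[-> /le_trans ->].
have gM (s : R) : 0 <= s <= t -> is_derive s 1 (fun u => M * u ^+ k.+1) (M * (k.+1%:R *
  s ^+ k)).
  move=> _; have := isd_mul (isd_cst M s) (isd_exp k.+1 (isd_id s)).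
  by congr (is_derive _ _ _ _); rewrite mul0r add0r mulr1.
have := isd_dist_le t0 (fun s sT => fdf s (st s sT)) gM.
rewrite f0 subr0 expr0n mulr0 subr0; apply => s sT.
apply: (le_trans (dfM _ (st _ sT))); apply: ler_wpM2l => //.
by rewrite ler_peMl ?exprn_ge0 ?ler1n//; case/andP: sT.
Qed.

Lemma Phi_taylor K : (forall x, `|(x ^+ 2 - 1) * phi x| <= K) -> forall y d,
  `|Phi (y + d) - Phi y - phi y * d + y * phi y / 2 * d ^+ 2| <= K * `|d| ^+ 3.
Proof.
move=> phi2 y d.
have lin t : is_derive t 1 (fun u => y + u * d) d.
  have := isd_add (isd_cst y t) (isd_mul (isd_id t) (isd_cst d t)).
  by congr (is_derive _ _ _ _); ring.
(* Remainders of [phi'], [phi] and [Phi] along the segment, each the derivative of the next. *)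
pose f1 t := - ((y + t * d) * phi (y + t * d)) * d ^+ 2 - - (y * phi y) * d ^+ 2.
pose f2 t := phi (y + t * d) * d - (phi y * d - (y * phi y) * d ^+ 2 * t).
pose f3 t := Phi (y + t * d) - (Phi y + phi y * d * t - y * phi y / 2 * d ^+ 2 * t ^+ 2).
have b1 t : 0 <= t <= 1 -> `|f1 t| <= K * `|d| ^+ 3 * t ^+ 1.
  apply: (@taylor_step f1 (fun t => ((y + t * d) ^+ 2 - 1) * phi (y + t * d) * d ^+ 3)
    _ 0).
  - move=> u _.
    have := isd_add (isd_mul (isd_comp (isd_dphi _) (lin u)) (isd_cst (d ^+ 2) u))
      (isd_opp (isd_cst (- (y * phi y) * d ^+ 2) u)).
    by congr (is_derive _ _ _ _); ring.
  - by rewrite /f1 mul0r addr0 subrr.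
  - by move=> u _; rewrite expr0 mulr1 normrM normrX; exact: ler_wpM2r.
have b2 t : 0 <= t <= 1 -> `|f2 t| <= K * `|d| ^+ 3 * t ^+ 2.
  apply: (@taylor_step f2 f1 _ 1) => // [u _|].
    have := isd_add (isd_mul (isd_comp (isd_phi _) (lin u)) (isd_cst d u))
      (isd_opp (isd_add (isd_cst (phi y * d) u) (isd_opp (isd_mul (isd_cst (y * phi y *
        d ^+ 2) u) (isd_id u))))).
    by congr (is_derive _ _ _ _); rewrite /f1; ring.
  by rewrite /f2 mul0r addr0; ring.
have b3 t : 0 <= t <= 1 -> `|f3 t| <= K * `|d| ^+ 3 * t ^+ 3.
  apply: (@taylor_step f3 f2 _ 2) => // [u _|].
    have := isd_add (isd_comp (isd_Phi _) (lin u))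
      (isd_opp (isd_add (isd_add (isd_cst (Phi y) u) (isd_mul (isd_cst (phi y * d) u)
        (isd_id u)))
        (isd_opp (isd_mul (isd_cst (y * phi y / 2 * d ^+ 2) u) (isd_exp 2 (isd_id u)))))).
    by congr (is_derive _ _ _ _); rewrite /f2 expr1; field.
  by rewrite /f3 mul0r addr0; ring.
have := b3 1; rewrite lexx ler01 expr1n mulr1 => /(_ isT).
by rewrite /f3 mul1r !mulr1 expr1n mulr1 (_ : Phi (y + d) - (_ + _ - _) =
  Phi (y + d) - Phi y - phi y * d + y * phi y / 2 * d ^+ 2)//; ring.
Qed.

Lemma Phi_lipschitz K : (forall x, `|phi x| <= K) -> forall x y,
  `|Phi y - Phi x| <= K * `|y - x|.
Proof.
move=> phiK x y; pose d := y - x.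
have lin t : is_derive t 1 (fun u => x + u * d) d.
  have := isd_add (isd_cst x t) (isd_mul (isd_id t) (isd_cst d t)).
  by congr (is_derive _ _ _ _); ring.
pose f t := Phi (x + t * d) - Phi x.
have fE t : is_derive t 1 f (phi (x + t * d) * d).
  have := isd_add (isd_comp (isd_Phi _) (lin t)) (isd_opp (isd_cst (Phi x) t)).
  by congr (is_derive _ _ _ _); rewrite oppr0 addr0.
have f0 : f 0 = 0 by rewrite /f mul0r addr0 subrr.
have fK t : 0 <= t <= 1 -> `|phi (x + t * d) * d| <= K * `|d| * t ^+ 0.
  by move=> _; rewrite expr0 mulr1 normrM ler_wpM2r.
have := taylor_step (fun t _ => fE t) f0 fK; move=> /(_ 1).
by rewrite lexx ler01 expr1n mulr1 /f mul1r /d subrKC; apply.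
Qed.

End gaussian.

(** * The Gaussian test function *)

Section normal_approximation.
Variables (R : realType) (n : nat).
Implicit Types (s z d : R).

Local Notation N := (n%:R : R).
Local Notation h s := (hh N s).
Local Notation phi := (normal_pdf (0 : R) 1).

Variables (T C th th' K delta a : R).
Hypotheses (n0 : (0 < n)%N) (T0 : 0 < T) (NT1 : N * T < 1).
Hypotheses (th0 : 0 < th) (th1 : th <= 1) (hth : h T ^+ 3 <= th ^+ 2 * N).
Hypotheses (th'0 : 0 <= th') (hth' : h T ^+ 3 <= th' ^+ 2 * (N ^+ 2 * T)).
Hypotheses (C1 : 1 <= C) (emC : forall i (U : {set 'I_n}) s, (0 < i <= 7)%N ->
  0 <= s <= T -> em U i s <= C * N * h s ^+ (2 * i).-1).
Hypotheses (K0 : 0 <= K) (d0 : 0 < delta).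
Hypothesis phiK : forall x,
  [/\ `|phi x| <= K, `|x * phi x| <= K & `|(x ^+ 2 - 1) * phi x| <= K].

Let T0' : 0 <= T. Proof. exact: ltW. Qed.

Let N0 : 0 < N. Proof. by rewrite ltr0n. Qed.

Let Ns1 s : 0 <= s <= T -> N * s < 1.
Proof. by move=> /andP[_ sT]; apply: le_lt_trans NT1; exact: ler_wpM2l. Qed.

Let h_gt0 s : 0 <= s <= T -> 0 < h s.
Proof. by move=> sT; apply: lt_le_trans (hT_ge1 NT1 sT). Qed.

Let hT0 : 0 < h T. Proof. by apply: h_gt0; rewrite T0' lexx. Qed.

Let W : R := 2 * (T * h T).
Let W0 : 0 < W. Proof. by rewrite !mulr_gt0. Qed.
Let r : R := Num.sqrt W.
Let r0 : 0 < r. Proof. by rewrite sqrtr_gt0. Qed.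
Let r2 : r ^+ 2 = W. Proof. by rewrite sqr_sqrtr// ltW. Qed.

(* [rho s ^ 2] is the variance still to be accumulated after time [s], plus that
   of the smoothing. *)
Let rho s : R := Num.sqrt (W * (1 + delta ^+ 2) - 2 * (s * h s ^+ 1)).

Let sh_le s : 0 <= s <= T -> 2 * (s * h s ^+ 1) <= W.
Proof.
move=> sT; have /andP[s0 s1] := sT; rewrite /W expr1 ler_wpM2l//.
by apply: ler_pM => //; [exact/ltW/h_gt0|exact: (hh_mono NT1 sT)].
Qed.

Let dr0 : 0 < delta * r. Proof. by rewrite mulr_gt0. Qed.

Let rho2_ge s : 0 <= s <= T ->
  (delta * r) ^+ 2 <= W * (1 + delta ^+ 2) - 2 * (s * h s ^+ 1).
Proof. by move=> sT; rewrite exprMn r2; have := sh_le sT; lra. Qed.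

Let rho2_gt0 s : 0 <= s <= T -> 0 < W * (1 + delta ^+ 2) - 2 * (s * h s ^+ 1).
Proof. by move=> sT; apply: lt_le_trans (rho2_ge sT); rewrite exprn_gt0. Qed.

Let rho_ge s : 0 <= s <= T -> delta * r <= rho s.
Proof.
move=> sT; rewrite /rho -[leLHS](ger0_norm (ltW dr0)) -sqrtr_sqr ler_sqrt;
  last exact: ltW (rho2_gt0 sT).
exact: rho2_ge.
Qed.

Let rho_gt0 s : 0 <= s <= T -> 0 < rho s.
Proof. by move=> sT; apply: lt_le_trans (rho_ge sT). Qed.

Let isd_rho s : 0 <= s <= T -> is_derive s 1 rho (- h s ^+ 2 / rho s).
Proof.
move=> sT.
have i2 := isd_add (isd_cst (W * (1 + delta ^+ 2)) s)
  (isd_opp (isd_mul (isd_cst 2 s) (isd_shhX 1 (Ns1 sT)))).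
have := @isd_comp R Num.sqrt (fun u => W * (1 + delta ^+ 2) - 2 * (u * h u ^+ 1)) s _ _
  (is_derive1_sqrt (rho2_gt0 sT)) i2.
rewrite -/rho; congr (is_derive _ _ _ _).
have e : h s ^+ 1 + 1%:R * N * s * h s ^+ 2 = h s ^+ 2.
  by rewrite expr1 -[X in X + _ = _]mul1r -{1}(hTE NT1 sT); ring.
rewrite e -/(rho s); field.
by rewrite gt_eqF// rho_gt0.
Qed.

Let g s z : R := Phi ((a * r - z) / rho s).
Let gz s z : R := - (phi ((a * r - z) / rho s) / rho s).
Let gzz s z : R :=
  - ((a * r - z) / rho s * phi ((a * r - z) / rho s)) / rho s ^+ 2.

Let isd_g s : 0 <= s <= T -> forall (z : R -> R) dz, is_derive s 1 z dz ->
  is_derive s 1 (fun u => g u (z u)) (gz s (z s) * dz - h s ^+ 2 * gzz s (z s)).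
Proof.
move=> sT z dz zdz; have rs0 : rho s != 0 by rewrite gt_eqF// rho_gt0.
have := isd_comp (isd_Phi _) (isd_mul (isd_add (isd_cst (a * r) s) (isd_opp zdz))
  (isd_inv rs0 (isd_rho sT))).
by congr (is_derive _ _ _ _); rewrite /gz /gzz; field.
Qed.

Let inv_rho_le s k : 0 <= s <= T -> (rho s ^+ k)^-1 <= ((delta * r) ^+ k)^-1.
Proof.
move=> sT; rewrite lef_pV2 ?posrE ?exprn_gt0 ?rho_gt0//.
by apply: lerXn2r; rewrite ?nnegrE ?rho_ge// ltW// rho_gt0.
Qed.

Let inv_rho_ge0 s k : 0 <= s <= T -> 0 <= (rho s ^+ k)^-1.
Proof. by move=> sT; rewrite invr_ge0 exprn_ge0// ltW// rho_gt0. Qed.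

Let gz_le s z : 0 <= s <= T -> `|gz s z| <= K * ((delta * r) ^+ 1)^-1.
Proof.
move=> sT; rewrite /gz -{2}(expr1 (rho s)) normrN normrM [X in _ * X]ger0_norm
  ?inv_rho_ge0//.
by apply: ler_pM; rewrite ?inv_rho_ge0 ?inv_rho_le//; case: (phiK ((a * r - z) / rho s)).
Qed.

Let gzz_le s z : 0 <= s <= T -> `|gzz s z| <= K * ((delta * r) ^+ 2)^-1.
Proof.
move=> sT; rewrite /gzz normrM normrN [X in _ * X]ger0_norm ?inv_rho_ge0//.
by apply: ler_pM; rewrite ?inv_rho_ge0 ?inv_rho_le//; case: (phiK ((a * r - z) / rho s)).
Qed.

Let g_taylor s z d : 0 <= s <= T -> 0 <= d ->
  `|g s (z + d) - g s z - gz s z * d - gzz s z / 2 * d ^+ 2| <=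
  K * ((delta * r) ^+ 3)^-1 * d ^+ 3.
Proof.
move=> sT d_ge0; have rs0 : rho s != 0 by rewrite gt_eqF// rho_gt0.
have phi2 x : `|(x ^+ 2 - 1) * phi x| <= K by case: (phiK x).
have := Phi_taylor phi2 ((a * r - z) / rho s) (- (d / rho s)).
rewrite (_ : (a * r - z) / rho s + - (d / rho s) = (a * r - (z + d)) / rho s);
  last by ring.
have dr : 0 <= d / rho s by rewrite divr_ge0// ltW// rho_gt0.
rewrite -/(g s (z + d)) -/(g s z) normrN (ger0_norm dr).
have -> : g s (z + d) - g s z - phi ((a * r - z) / rho s) * - (d / rho s) +
    (a * r - z) / rho s * phi ((a * r - z) / rho s) / 2 * (- (d / rho s)) ^+ 2 =
    g s (z + d) - g s z - gz s z * d - gzz s z / 2 * d ^+ 2.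
  by rewrite /gz /gzz; field.
move=> /le_trans; apply; rewrite exprMn exprVn -[leRHS]mulrA ler_wpM2l// [leLHS]mulrC.
by apply: ler_wpM2r; [rewrite exprn_ge0|exact: inv_rho_le].
Qed.

(** [rho T = delta * r] makes the terminal value the smoothed indicator, and
    [rho 0 = r * Num.sqrt (1 + delta ^ 2)] makes [g 0 0] the average of the same smoothed indicator
    over a standard Gaussian variable. *)
Lemma normal_approx :
  `|Ex T (fun G : {set pedge n} => Phi ((a - linearized_chi T G / Num.sqrt (2 * (T * h
    T))) / delta)) -
    Phi (a / Num.sqrt (1 + delta ^+ 2))| <=
  K * ((3 + 3 * C) / delta + (3 + 10 * C) / delta ^+ 2 + 8 * C ^+ 2 / delta ^+ 3) *
    (th + th').
Proof.
have M0 k : 0 <= K * ((delta * r) ^+ k)^-1.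
  by rewrite mulr_ge0// invr_ge0 exprn_ge0// ltW.
have := lindeberg_bound n0 T0' NT1 th0 th1 hth C1 emC (M0 1%N) (M0 2%N) (M0 3%N)
  isd_g gz_le gzz_le g_taylor.
have rhoT : rho T = delta * r.
  rewrite /rho expr1 -/W (_ : W * (1 + delta ^+ 2) - W = (delta * r) ^+ 2).
    by rewrite sqrtr_sqr ger0_norm// ltW.
  by rewrite exprMn r2; ring.
have rho0 : rho 0 = r * Num.sqrt (1 + delta ^+ 2).
  by rewrite /rho mul0r mulr0 subr0 sqrtrM// ltW.
have dq : 0 < Num.sqrt (1 + delta ^+ 2) by rewrite sqrtr_gt0 ltr_pwDl// sqr_ge0.
rewrite (_ : g 0 0 = Phi (a / Num.sqrt (1 + delta ^+ 2))); last first.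
  by rewrite /g rho0 subr0; congr Phi; field; rewrite !gt_eqF.
rewrite (@eq_Ex _ n T _ (fun G => Phi ((a - linearized_chi T G / r) / delta)));
  last first.
  by move=> G; rewrite /g rhoT; congr Phi; field; rewrite !gt_eqF.
move=> /le_trans; apply.
have T1 : 0 <= T <= T by rewrite T0' lexx.
have NT : N * T <= 1 by exact: ltW.
(* The square of the left side is [2 T h ^ 3], and [N * T <= 1]. *)
have rh : r * h T <= 2 * th.
  rewrite -(ger0_norm (ltW (mulr_gt0 r0 hT0))) -[leRHS]ger0_norm;
    last by rewrite mulr_ge0// ltW.
  rewrite -!sqrtr_sqr ler_sqrt ?sqr_ge0// exprMn r2 /W.
  have -> : 2 * (T * h T) * h T ^+ 2 = 2 * (T * h T ^+ 3) by ring.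
  apply: (@le_trans _ _ (2 * (T * (th ^+ 2 * N)))).
    by rewrite ler_wpM2l// ler_wpM2l.
  rewrite (_ : 2 * (T * _) = 2 * th ^+ 2 * (N * T)); last by ring.
  apply: (@le_trans _ _ (2 * th ^+ 2)); last by have := sqr_ge0 th; lra.
  by rewrite ler_piMr// mulr_ge0// sqr_ge0.
(* The square of the left side is [h ^ 3 / (2 N ^ 2 T)]: the jump error measured against the
   standard deviation [r]. *)
have hr : h T ^+ 2 / (N * r) <= th'.
  rewrite -[leLHS]ger0_norm; last by rewrite divr_ge0 ?sqr_ge0// mulr_ge0 ?ltW.
  rewrite -[leRHS]ger0_norm// -!sqrtr_sqr ler_sqrt ?sqr_ge0//.
  have -> : (h T ^+ 2 / (N * r)) ^+ 2 = h T ^+ 3 / 2 / (N ^+ 2 * T).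
    have -> : (h T ^+ 2 / (N * r)) ^+ 2 = h T ^+ 4 / (N ^+ 2 * r ^+ 2).
      by field; rewrite !gt_eqF.
    by rewrite r2 /W; field; rewrite !gt_eqF.
  rewrite ler_pdivrMr; last by rewrite mulr_gt0// exprn_gt0.
  have h3 : 0 <= h T ^+ 3 by rewrite exprn_ge0// ltW.
  by apply: le_trans hth'; rewrite ler_pdivrMr//; lra.
have dd k : 0 <= (delta ^+ k)^-1 by rewrite invr_ge0 exprn_ge0// ltW.
have C0 : 0 <= C by exact: le_trans ler01 C1.
have t1 : (3 + 3 * C) * (K * ((delta * r) ^+ 1)^-1) * (T * h T ^+ 2) <=
    K * ((3 + 3 * C) / delta) * th.
  rewrite (_ : _ * (T * h T ^+ 2) = K * ((3 + 3 * C) / delta) / 2 * (r * h T));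
    last first.
    have -> : T * h T ^+ 2 = r ^+ 2 / 2 * h T by rewrite r2 /W; field.
    by rewrite expr1; field; rewrite !gt_eqF.
  rewrite -subr_ge0 (_ : _ - _ = K * ((3 + 3 * C) / delta) / 2 * (2 * th - r * h T));
    last by field; rewrite gt_eqF.
  apply: mulr_ge0; last by rewrite subr_ge0.
  apply: divr_ge0 => //; apply: mulr_ge0 => //; apply: divr_ge0; last exact: ltW.
  by rewrite addr_ge0// mulr_ge0.
have t2 : (3 + 10 * C) * th * (K * ((delta * r) ^+ 2)^-1) * (T * h T ^+ 1) <=
    K * ((3 + 10 * C) / delta ^+ 2) * th.
  rewrite (_ : _ * (T * h T ^+ 1) = K * ((3 + 10 * C) / delta ^+ 2) * th / 2); last first.
    have -> : T * h T ^+ 1 = r ^+ 2 / 2 by rewrite r2 /W; field.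
    by field; rewrite !gt_eqF.
  rewrite ler_pdivrMr// ler_peMr ?ler1n//.
  apply: mulr_ge0; last exact: ltW.
  by rewrite mulr_ge0// mulr_ge0// addr_ge0// mulr_ge0.
have t3 : 8 * C ^+ 2 / N * (K * ((delta * r) ^+ 3)^-1) * (T * h T ^+ 3) <=
    K * (8 * C ^+ 2 / delta ^+ 3) * th'.
  rewrite (_ : _ * (T * h T ^+ 3) = K * (8 * C ^+ 2 / delta ^+ 3) * (h T ^+ 2 / (N *
    r)) / 2); last first.
    have -> : T * h T ^+ 3 = r ^+ 2 / 2 * h T ^+ 2 by rewrite r2 /W; field.
    by field; rewrite !gt_eqF.
  have c0 : 0 <= K * (8 * C ^+ 2 / delta ^+ 3).
    by rewrite mulr_ge0// mulr_ge0// mulr_ge0// sqr_ge0.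
  have c1 := ler_wpM2l c0 hr; have c2 := mulr_ge0 c0 th'0.
  by rewrite ler_pdivrMr//; lra.
apply: le_trans (lerD (lerD t1 t2) t3) _.
have u1 : 0 <= K * ((3 + 3 * C) / delta) * th'.
  apply: mulr_ge0 => //; apply: mulr_ge0 => //; apply: divr_ge0; last exact: ltW.
  by rewrite addr_ge0// mulr_ge0.
have u2 : 0 <= K * ((3 + 10 * C) / delta ^+ 2) * th'.
  by rewrite mulr_ge0// mulr_ge0// mulr_ge0// addr_ge0// mulr_ge0.
have u3 : 0 <= K * (8 * C ^+ 2 / delta ^+ 3) * th.
  apply: mulr_ge0; last exact: ltW.
  by rewrite mulr_ge0// mulr_ge0// mulr_ge0// sqr_ge0.
move: u1 u2 u3; move: (_ / delta) (_ / delta ^+ 2) (_ / delta ^+ 3) => *; lra.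
Qed.

End normal_approximation.

(** * Asymptotics *)

Section time_change.
Variables (R : realType) (n : nat) (p : R).
Local Notation N := (n%:R : R).
Local Notation k := ((1 - N * p)^-1).
Local Notation u := (k ^+ 3 / N).
Hypotheses (n0 : (0 < n)%N) (p0 : 0 <= p) (pN : p < N^-1) (u8 : u <= 8^-1).

Let N0 : 0 < N. Proof. by rewrite ltr0n. Qed.

Let Np1 : N * p < 1. Proof. by rewrite mulrC -ltr_pdivlMr// div1r. Qed.

Let e0 : 0 < 1 - N * p. Proof. by rewrite subr_gt0. Qed.

Lemma k_ge1 : 1 <= k. Proof. exact: (hh_ge1 (mulr_ge0 (ltW N0) p0) Np1). Qed.

Let kX i : 1 <= k ^+ i. Proof. by rewrite exprn_ege1// k_ge1. Qed.

Lemma u_ge0 : 0 <= u.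
Proof. by rewrite divr_ge0// ?(ltW N0)// (le_trans ler01). Qed.

Lemma invN_le_u : N^-1 <= u.
Proof. by rewrite ler_peMl ?invr_ge0// ltW. Qed.

Lemma kN_le_u : k / N <= u.
Proof.
rewrite ler_wpM2r ?invr_ge0 ?(ltW N0)// exprS ler_peMr//.
exact: le_trans k_ge1.
Qed.

Let p8 : p <= 8^-1.
Proof. exact: le_trans (ltW pN) (le_trans invN_le_u u8). Qed.

Definition edge_time : R := - ln (1 - p).

Let q0 : 0 < 1 - p. Proof. by have := p8; lra. Qed.

Lemma edge_timeE : 1 - expR (- edge_time) = p.
Proof. by rewrite opprK lnK ?posrE// subKr. Qed.

Lemma edge_time_ge : p <= edge_time.
Proof.
rewrite /edge_time lerNr; have := @le_ln1Dx R (- p).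
by apply; rewrite ltrN2; have := p8; lra.
Qed.

Lemma edge_time_le2p : edge_time <= p + 2 * p ^+ 2.
Proof.
rewrite /edge_time -lnV ?posrE//.
have -> : (1 - p)^-1 = 1 + p / (1 - p) by field; rewrite gt_eqF.
apply: le_trans (le_ln1Dx _) _.
  by rewrite (lt_le_trans (ltrN10 _))// divr_ge0// ltW.
rewrite ler_pdivrMr//.
have : 0 <= p ^+ 2 * (1 - 2 * p) by rewrite mulr_ge0 ?sqr_ge0//; have := p8; lra.
by lra.
Qed.

Lemma edge_time_le : edge_time <= p * (1 + 2 * u).
Proof.
apply: le_trans edge_time_le2p _.
have : p * p <= p * u.
  by apply: ler_wpM2l => //; apply: le_trans invN_le_u; exact: ltW.
by lra.
Qed.

(** Passing from [p] to [edge_time] costs at most [2 p ^ 2]. Multiplied by [N] this is at most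
    [2 / N], a fraction [2 k / N] of the gap [1 - N p]. *)
Lemma edge_time_gap : (1 - N * p) * (1 - 2 * u) <= 1 - N * edge_time.
Proof.
have h1 : N * edge_time <= N * (p + 2 * p ^+ 2).
  by apply: ler_wpM2l; [exact: ltW|exact: edge_time_le2p].
have h2 : N * p * (2 * p) <= 2 * p.
  by apply: ler_piMl; [rewrite mulr_ge0|exact: ltW].
have h3 : (1 - N * p) * (2 * (k / N)) <= (1 - N * p) * (2 * u).
  by apply: ler_wpM2l; [exact: ltW|apply: ler_wpM2l => //; exact: kN_le_u].
have h4 : (1 - N * p) * (2 * (k / N)) = 2 * N^-1 by field; rewrite !gt_eqF.
have h5 := ltW pN.
by lra.
Qed.

Lemma edge_time_lt1 : N * edge_time < 1.
Proof.
rewrite -subr_gt0; apply: lt_le_trans edge_time_gap; apply: mulr_gt0 => //.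
by have := u8; lra.
Qed.

Lemma hh_edge_time_ge : k <= hh N edge_time.
Proof.
rewrite lef_pV2 ?posrE ?subr_gt0 ?edge_time_lt1//.
by rewrite lerD2l lerN2 ler_wpM2l ?(ltW N0)// edge_time_ge.
Qed.

Lemma hh_edge_time_le : hh N edge_time <= k * (1 + 4 * u).
Proof.
have u0 := u_ge0; have k1 : 0 <= k by exact: le_trans k_ge1.
have d0 : 0 < (1 - N * p) * (1 - 2 * u) by apply: mulr_gt0 => //; have := u8; lra.
apply: (@le_trans _ _ ((1 - N * p) * (1 - 2 * u))^-1).
  rewrite lef_pV2 ?posrE//; first exact: edge_time_gap.
  by rewrite subr_gt0 edge_time_lt1.
rewrite invfM ler_wpM2l// -[leLHS]div1r ler_pdivrMr; last by have := u8; lra.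
have : 0 <= u * (1 - 4 * u) by rewrite mulr_ge0//; have := u8; lra.
by lra.
Qed.

Lemma hh_edge_time_le2 : hh N edge_time <= 2 * k.
Proof.
apply: le_trans hh_edge_time_le _; rewrite mulrC ler_wpM2r//.
  exact: le_trans k_ge1.
by have := u8; lra.
Qed.

Lemma variance_ratio : edge_time * hh N edge_time ^+ 5 <= p * k ^+ 5 * (1 + 252 * u).
Proof.
have u0 := u_ge0; have k0 : 0 <= k by exact: le_trans k_ge1.
have h0 : 0 <= hh N edge_time by apply: le_trans k0 hh_edge_time_ge.
apply: (@le_trans _ _ (p * (1 + 2 * u) * (k * (1 + 4 * u)) ^+ 5)).
  apply: ler_pM; rewrite ?exprn_ge0 ?edge_time_le//; first exact: le_trans edge_time_ge.
  by apply: lerXn2r; rewrite ?nnegrE ?hh_edge_time_le// mulr_ge0// addr_ge0// mulr_ge0.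
rewrite exprMn mulrACA; apply: ler_wpM2l; first by rewrite mulr_ge0// exprn_ge0.
apply: (@le_trans _ _ ((1 + 4 * u) ^+ 6)).
  rewrite [leRHS]exprS; apply: ler_wpM2r; first by rewrite exprn_ge0// addr_ge0//
    mulr_ge0.
  by lra.
(* The constant is [63 = 2 ^ 6 - 1]: for [0 <= y <= 1] every positive power in [(1 + y) ^ 6] is at
   most [y]. *)
rewrite (_ : 252 * u = 63 * (4 * u)); last by lra.
have : 4 * u <= 1 by have := u8; lra.
have : 0 <= 4 * u by rewrite mulr_ge0.
move: (4 * u) => y y0 y1.
have y2 i : y ^+ i.+1 <= y by rewrite exprS ler_piMr// exprn_ile1.
have := (y2 1%N, y2 2, y2 3, y2 4, y2 5).
by move=> -[[[[]]]]; lra.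
Qed.

Lemma variance_ratio_ge : p * k ^+ 5 <= edge_time * hh N edge_time ^+ 5.
Proof.
have k0 : 0 <= k by exact: le_trans k_ge1.
apply: ler_pM => //; [by rewrite exprn_ge0|exact: edge_time_ge|].
by apply: lerXn2r; rewrite ?nnegrE ?hh_edge_time_ge// (le_trans k0 hh_edge_time_ge).
Qed.

(** The shift of the centre is [h k N (edge_time - p) <= 2 p h ^ 2]; its square gains a factor of
    order [p <= u] over the variance. *)
Lemma center_gap : 0 < p ->
  (hh N edge_time - k) ^+ 2 <= 4 * u * (2 * (edge_time * hh N edge_time ^+ 5)).
Proof.
move=> pp; have u0 := u_ge0; have k1 := k_ge1; have k0 : 0 <= k by exact: le_trans k1.
have hk := hh_edge_time_ge; have h1 : 1 <= hh N edge_time by exact: le_trans hk.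
have h0 : 0 <= hh N edge_time by exact: le_trans h1.
set h := hh N edge_time in hk h1 h0 *.
have eE : h - k = h * k * (N * (edge_time - p)).
  have e1 : h * (1 - N * edge_time) = 1 by rewrite mulrC hh_subE// edge_time_lt1.
  have e2 : k * (1 - N * p) = 1 by rewrite mulVf// gt_eqF.
  transitivity (h * (k * (1 - N * p)) - k * (h * (1 - N * edge_time))).
    by rewrite e1 e2 !mulr1.
  by ring.
have gap : N * (edge_time - p) <= 2 * p.
  apply: (@le_trans _ _ (N * (2 * p ^+ 2))).
    by apply: ler_wpM2l; [exact: ltW|have := edge_time_le2p; lra].
  rewrite (_ : N * _ = N * p * (2 * p)); last by ring.
  by apply: ler_piMl; [rewrite mulr_ge0|exact: ltW].
have gap0 : 0 <= N * (edge_time - p).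
  by apply: mulr_ge0; [exact: ltW|rewrite subr_ge0 edge_time_ge].
rewrite eE exprMn.
apply: (@le_trans _ _ ((h * h) ^+ 2 * (2 * p) ^+ 2)).
  apply: ler_pM; [exact: sqr_ge0|exact: sqr_ge0| |].
    apply: lerXn2r; rewrite ?nnegrE; [exact: mulr_ge0|exact: mulr_ge0|].
    exact: ler_wpM2l.
  apply: lerXn2r; rewrite ?nnegrE => //; exact: mulr_ge0.
have pu : p <= u by apply: le_trans invN_le_u; exact: ltW.
have h45 : h ^+ 4 <= h ^+ 5 by rewrite [leRHS]exprS ler_peMl// exprn_ge0.
have t1 : p * h ^+ 4 <= edge_time * h ^+ 5.
  by apply: ler_pM; rewrite ?exprn_ge0 ?edge_time_ge.
rewrite (_ : _ * _ = 4 * p * (p * h ^+ 4)); last by ring.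
have t0 : 0 <= edge_time * h ^+ 5.
  by rewrite mulr_ge0 ?exprn_ge0//; exact: le_trans edge_time_ge.
have : 4 * p * (p * h ^+ 4) <= 4 * u * (edge_time * h ^+ 5).
  apply: ler_pM => //; [by rewrite mulr_ge0|by rewrite mulr_ge0// exprn_ge0|lra].
move/le_trans; apply; apply: ler_wpM2l; [by rewrite mulr_ge0|lra].
Qed.

End time_change.

(** * From smoothed indicators back to distribution functions *)

Section smoothing.
Variables (R : realType) (n : nat) (s : R) (Y : {set pedge n} -> R).
Hypothesis s0 : 0 <= s.

Lemma Phi_mono : {homo @Phi R : x y / x <= y}.
Proof.
move=> x y xy; rewrite -lee_fin -!PhiE le_measure ?inE//.
by move=> z /=; rewrite !in_itv/= => /le_trans; apply.
Qed.

Lemma smoothing_le (a L delta : R) : 0 < delta ->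
  Ex s (fun G => (Y G <= a)%R%:R) <=
  Ex s (fun G => Phi ((a + L * delta - Y G) / delta)) + (1 - Phi L).
Proof.
move=> d0; rewrite -(Ex_cst n s (1 - Phi L)) -ExD; apply: ler_Ex => // G.
have [Ya|_] := boolP (Y G <= a); last by rewrite addr_ge0 ?Phi_ge0// subr_ge0 Phi_le1.
have : Phi L <= Phi ((a + L * delta - Y G) / delta).
  by apply: Phi_mono; rewrite ler_pdivlMr//; lra.
by rewrite /=; lra.
Qed.

Lemma smoothing_ge (a L delta : R) : 0 < delta ->
  Ex s (fun G => Phi ((a - L * delta - Y G) / delta)) - Phi (- L) <=
  Ex s (fun G => (Y G <= a)%R%:R).
Proof.
move=> d0; rewrite -(Ex_cst n s (Phi (- L))) -ExB; apply: ler_Ex => // G.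
have [Ya|Ya] := boolP (Y G <= a).
  have := Phi_le1 ((a - L * delta - Y G) / delta); have := Phi_ge0 (- L).
  by rewrite /=; lra.
have : Phi ((a - L * delta - Y G) / delta) <= Phi (- L).
  by apply: Phi_mono; rewrite ler_pdivrMr//; rewrite -ltNge in Ya; lra.
by rewrite /=; lra.
Qed.

(** The error collects the Gaussian tails beyond [L], the approximation error [B], the threshold
    shifts [a - x] and [L * delta], and the extra variance [delta ^ 2] of the smoothing. *)
Lemma smoothing (K B x a L delta : R) : 0 < delta -> 0 <= L -> 0 <= K ->
  (forall y, `|normal_pdf (0 : R) 1 y| <= K) ->
  (forall b, `|Ex s (fun G => Phi ((b - Y G) / delta)) -
               Phi (b / Num.sqrt (1 + delta ^+ 2))| <= B) ->
  `|Ex s (fun G => (Y G <= a)%R%:R) - Phi x| <=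
  Phi (- L) + (1 - Phi L) + B + K * (`|a - x| + L * delta + `|x| * delta ^+ 2).
Proof.
move=> d0 L0 K0 phiK EB; set q := Num.sqrt _ in EB *.
have q1 : 1 <= q.
  by rewrite -[leLHS]sqrtr1 ler_wsqrtr// lerDl sqr_ge0.
have q2 : q <= 1 + delta ^+ 2.
  rewrite -[leRHS]ger0_norm ?addr_ge0 ?sqr_ge0// -sqrtr_sqr ler_wsqrtr//.
  by rewrite expr2 ler_peMl ?addr_ge0 ?sqr_ge0// lerDl sqr_ge0.
have q0 : 0 < q by exact: lt_le_trans q1.
have close b : `|b - a| <= L * delta ->
    `|Phi (b / q) - Phi x| <= K * (`|a - x| + L * delta + `|x| * delta ^+ 2).
  move=> ba; apply: le_trans (Phi_lipschitz phiK _ _) _; apply: ler_wpM2l => //.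
  have -> : b / q - x = (b - x * q) / q by field; rewrite gt_eqF.
  rewrite normrM normfV (gtr0_norm q0) ler_pdivrMr//.
  apply: (@le_trans _ _ (`|a - x| + L * delta + `|x| * delta ^+ 2)).
    have -> : b - x * q = (a - x) + (b - a) + x * (1 - q) by ring.
    apply: le_trans (ler_normD _ _) _; apply: lerD.
      by apply: le_trans (ler_normD _ _) _; rewrite lerD2l.
    rewrite normrM ler_wpM2l//.
    by rewrite ler0_norm; lra.
  by rewrite ler_peMr// !addr_ge0 ?mulr_ge0 ?sqr_ge0// ltW.
have Ld : 0 <= L * delta by rewrite mulr_ge0// ltW.
have c1 := close (a + L * delta); rewrite addrC addKr ger0_norm// in c1.
have c2 := close (a - L * delta); rewrite addrC addKr normrN ger0_norm// in c2.
have {c1} := c1 (lexx _); have {c2} := c2 (lexx _).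
have := EB (a + L * delta); have := EB (a - L * delta).
have := smoothing_le a L d0; have := smoothing_ge a L d0.
have := Phi_ge0 (- L); have := Phi_le1 L.
move: (K * _) => X.
rewrite !ler_norml => ? ? ? ? /andP[? ?] /andP[? ?] /andP[? ?] /andP[? ?].
by apply/andP; split; lra.
Qed.

End smoothing.

(** * From the probability measure to finite sums *)

Section gnp_expectation.
Variables (R : realType) (n : nat).
Local Notation V := [set: 'I_n]%SET.

Lemma connect_adj (G : {set pedge n}) x y : connect (adj G) x y = (y \in cc V G x).
Proof.
by rewrite inE; apply: eq_connect => {x}x {y}y; rewrite /induced_adj !finset.in_setT.
Qed.

Lemma susceptibility_moment (G : {set pedge n}) :
  susceptibility R G = moment R V 1 G / n%:R.
Proof.
rewrite /susceptibility; congr (_ / _).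
have eqvR : {in V & &, equivalence_rel (connect (adj G))}.
  move=> x y z _ _ _; rewrite !connect_adj cc_refl; split=> // xy.
  by rewrite (cc_eq xy).
have /and3P[/eqP coverP trivP _] := equivalence_partitionP eqvR.
have -> : moment R V 1 G = \sum_(x in finset.cover (components G)) cs R V G x ^+ 1.
  by rewrite coverP.
rewrite finset.big_trivIset//= natr_sum; apply: eq_bigr => A.
rewrite /components => /imsetP[x _ ->].
have -> : [set y in V | connect (adj G) x y]%SET = cc V G x.
  by apply/setP => y; rewrite !inE connect_adj inE.
rewrite (eq_bigr (fun=> #|cc V G x|%:R)) => [|y yx].
  by rewrite sumr_const natrX expr2 -[RHS]mulr_natr.
by rewrite expr1 /cs (cc_eq yx).
Qed.

Variable p : R.
Hypothesis p01 : 0 <= p <= 1.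

Lemma gnp_probE (A : set (graph n)) :
  gnp_prob n p A = (\sum_(G : {set pedge n}) gnp_pmf n p G * (G \in A)%:R)%:E.
Proof.
rewrite /gnp_prob p01 fsbig_mkcond -sumEFin [RHS]fsbig_seq ?index_enum_uniq//.
transitivity (\sum_(G \in [set` index_enum (graph n)])
    patch (fun=> 0%E) A (fun G => (gnp_pmf n p G)%:E) G)%E.
  by apply: eq_fsbigl; apply/seteqP; split => G //= _; exact: mem_index_enum.
apply: eq_fsbigr => G _; rewrite /patch.
by case: (boolP (G \in A)); rewrite ?mulr1 ?mulr0.
Qed.

Lemma gnp_integral (f : graph n -> R) :
  (\int[gnp_prob n p]_w (f w)%:E)%E = (\sum_(G : {set pedge n}) gnp_pmf n p G * f G)%:E.
Proof.
pose g (G w : graph n) : \bar R := ((f G)%:E * (\1_[set G]%classic w)%:E)%E.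
have fE w : (f w)%:E = (\sum_(G <- index_enum (graph n)) g G w)%E.
  rewrite (bigD1_seq w) ?mem_index_enum ?index_enum_uniq//= big1 => [|G Gw].
    by rewrite /g indicE mem_set// mule1 adde0.
  by rewrite /g indicE memNset ?mule0//= => wG; rewrite wG eqxx in Gw.
under eq_integral do rewrite fE.
have mT (A : set (graph n)) : measurable A by [].
have intI (G : graph n) : (gnp_prob n p).-integrable setT (EFin \o (\1_[set G]%classic
  : graph n -> R)).
  exact: integrable_indic.
rewrite integral_sum//; last by move=> G; apply: integrableZl => //; exact: intI.
rewrite -sumEFin; apply: eq_bigr => G _; rewrite /g integralZl//; last exact: intI.
have -> : (\int[gnp_prob n p]_x (\1_[set G]%classic x)%:E = gnp_prob n p [set
  G]%classic)%E.
  by rewrite integral_indic// setIT.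
rewrite gnp_probE -EFinM; congr EFin.
have inG (H : {set pedge n}) : ((H : graph n) \in [set G]%classic) = (H == G :> {set
  pedge n}).
  by apply/idP/eqP => [/set_mem//|->]; apply/mem_set.
have -> : \sum_(H : {set pedge n}) gnp_pmf n p H * ((H : graph n) \in [set
  G]%classic)%:R =
    gnp_pmf n p G.
  transitivity (\sum_(H : {set pedge n} | H == G :> {set pedge n}) gnp_pmf n p H).
    rewrite [RHS]big_mkcond; apply: eq_bigr => H _.
    by rewrite inG; case: eqP => _; rewrite ?mulr1 ?mulr0.
  exact: big_pred1_eq.
by rewrite mulrC.
Qed.

End gnp_expectation.

Lemma ler_norm_of_sqr (R : rcfType) (x y : R) : 0 <= y -> x ^+ 2 <= y ^+ 2 -> `|x| <= y.
Proof.
move=> y0 xy; rewrite -(sqrtr_sqr x) -(ger0_norm y0) -(sqrtr_sqr y).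
exact: ler_wsqrtr.
Qed.

(** * Quantitative estimates for fixed [n] *)

Section finite_estimates.
Variables (R : realType) (n : nat) (p C K : R).
Local Notation N := (n%:R : R).
Local Notation V := [set: 'I_n]%SET.
Local Notation k := ((1 - N * p)^-1).
Local Notation u := (k ^+ 3 / N).
Local Notation T := (edge_time p).
Local Notation h := (hh N T).
Local Notation chi := (@susceptibility n R).
Hypotheses (n0 : (0 < n)%N) (p0 : 0 <= p) (pN : p < N^-1) (u8 : u <= 8^-1).
Hypotheses (C1 : 1 <= C) (emC : forall m (S : R), m%:R * S < 1 ->
  forall i U (s : R), (0 < i <= 7)%N -> 0 <= s <= S ->
  em (R := R) (n := m) U i s <= C * m%:R * hh m%:R s ^+ (2 * i).-1).
Hypotheses (K0 : 0 <= K) (phiK : forall x : R, [/\ `|normal_pdf (0 : R) 1 x| <= K,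
  `|x * normal_pdf (0 : R) 1 x| <= K & `|(x ^+ 2 - 1) * normal_pdf (0 : R) 1 x| <= K]).

Let N0 : 0 < N. Proof. by rewrite ltr0n. Qed.

Let p01 : 0 <= p <= 1.
Proof.
rewrite p0 (le_trans (ltW pN))// invf_le1// ler1n//.
Qed.

Let NT1 : N * T < 1. Proof. exact: edge_time_lt1. Qed.

Let T0 : 0 <= T. Proof. exact: le_trans p0 (edge_time_ge n0 p0 pN u8). Qed.

Let TT : 0 <= T <= T. Proof. by rewrite T0 lexx. Qed.

Let h0 : 0 < h. Proof. by apply: lt_le_trans (hT_ge1 NT1 TT). Qed.

Let k0 : 0 < k. Proof. by apply: lt_le_trans (k_ge1 n0 p0 pN). Qed.

Let uN : u * N = k ^+ 3. Proof. by rewrite divfK// gt_eqF. Qed.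

Lemma gnp_variance : fine 'V_(gnp_prob n p)[chi]%E = varm V T / N ^+ 2.
Proof.
have ExE f : \sum_(G : {set pedge n}) gnp_pmf n p G * f G = Ex T f.
  by rewrite /Ex (edge_timeE n0 p0 pN u8).
have EchiE : fine ('E_(gnp_prob n p)[chi])%E = em V 1 T / N.
  rewrite unlock gnp_integral//= ExE -/(em V 1 T) /em -ExZr.
  by apply: eq_Ex => G; rewrite susceptibility_moment.
rewrite /variance unlock EchiE unlock gnp_integral//= ExE.
rewrite (@eq_Ex _ _ T _ (fun G => (N ^+ 2)^-1 * (moment R V 1 G ^+ 2 +
    (- (2 * em V 1 T) * moment R V 1 G + em V 1 T ^+ 2)))).
  by rewrite ExZ !ExD ExZ Ex_cst -/(em V 1 T) /varm; field; rewrite gt_eqF.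
move=> G; transitivity ((chi G - em V 1 T / N) * (chi G - em V 1 T / N)); first by [].
by rewrite susceptibility_moment; field; rewrite gt_eqF.
Qed.

Lemma gnp_variance_estimate :
  `|fine 'V_(gnp_prob n p)[chi]%E - 2 * p * k ^+ 5| <=
  (504 + 4000 * C) * u * (2 * p * k ^+ 5).
Proof.
rewrite gnp_variance.
have v1 := varm_le NT1 C1 (@emC n T NT1) V TT.
have v2 := varm_ge NT1 C1 (@emC n T NT1) TT.
have r1 := variance_ratio n0 p0 pN u8.
have r2 := variance_ratio_ge n0 p0 pN u8.
have h2k := hh_edge_time_le2 n0 p0 pN u8.
have u0 := u_ge0 n0 p0 pN.
have C0 : 0 <= C by exact: le_trans ler01 C1.
have Nh3 : h ^+ 3 <= 8 * (u * N).
  have -> : 8 * (u * N) = (2 * k) ^+ 3 by rewrite uN; ring.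
  by apply: lerXn2r; rewrite ?nnegrE// ltW// mulr_gt0.
have Th5 : 0 <= T * h ^+ 5 by rewrite mulr_ge0// exprn_ge0// ltW.
have pk5 : 0 <= p * k ^+ 5 by rewrite mulr_ge0// exprn_ge0// ltW.
have t8 : C * N * (T * h ^+ 8) <= 8 * (u * N) * (C * N * (T * h ^+ 5)).
  have -> : C * N * (T * h ^+ 8) = h ^+ 3 * (C * N * (T * h ^+ 5)) by ring.
  by apply: ler_wpM2r => //; rewrite !mulr_ge0// ?ltW// exprn_ge0// ltW.
(* 33 bounds [1 + 252 * u] for [u <= 8^-1]. *)
have u1 : u * (T * h ^+ 5) <= u * (33 * (p * k ^+ 5)).
  apply: ler_wpM2l => //; apply: (le_trans r1); rewrite mulrC.
  by apply: ler_wpM2r => //; have := u8; lra.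
have Cu1 : C * (u * (T * h ^+ 5)) <= C * (u * (33 * (p * k ^+ 5))) by exact: ler_wpM2l.
have up : 0 <= C * (u * (p * k ^+ 5)) by rewrite mulr_ge0// mulr_ge0.
have N2 : 0 < N ^+ 2 by rewrite exprn_gt0.
have w1 : varm V T / N ^+ 2 <= 2 * (T * h ^+ 5) + 16 * (C * (u * (T * h ^+ 5))).
  by rewrite ler_pdivrMr//; lra.
have w2 : 2 * (T * h ^+ 5) - 112 * (C * (u * (T * h ^+ 5))) <= varm V T / N ^+ 2.
  by rewrite ler_pdivlMr//; lra.
have up' : 0 <= u * (p * k ^+ 5) by exact: mulr_ge0.
rewrite ler_norml; apply/andP; split; move: r1 r2 Cu1 up up' w1 w2;
  move: (varm _ _ / _) (T * _) (k ^+ 5) u => ? ? ? ? *; lra.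
Qed.

Section clt.
Variables (eta L delta x : R).
Hypotheses (p_gt0 : 0 < p) (eta0 : 0 < eta) (eta4 : eta <= 4^-1).
Hypotheses (ueta : u <= eta ^+ 2) (weta : (N ^+ 2 * p)^-1 <= eta ^+ 2).
Hypotheses (L0 : 0 <= L) (d0 : 0 < delta).

Let B : R := K * ((3 + 3 * C) / delta + (3 + 10 * C) / delta ^+ 2 + 8 * C ^+ 2 / delta
  ^+ 3).

Lemma gnp_clt_estimate :
  `|Ex T (fun G => ((chi G - k) / Num.sqrt (2 * p * k ^+ 5) <= x)%R%:R) - Phi x| <=
  Phi (- L) + (1 - Phi L) + 12 * B * eta +
  K * ((2 + 252 * `|x|) * eta + L * delta + `|x| * delta ^+ 2).
Proof.
have T_gt0 : 0 < T by exact: lt_le_trans p_gt0 (edge_time_ge n0 p0 pN u8).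
pose v := 2 * (T * h ^+ 5); pose w := 2 * p * k ^+ 5.
have v0 : 0 < v by rewrite !mulr_gt0// exprn_gt0.
have w0 : 0 < w by rewrite !mulr_gt0// exprn_gt0.
pose Y (G : {set pedge n}) := linearized_chi T G / Num.sqrt (2 * (T * h)).
(* [Y] is centred at [h] and scaled by [v], the event uses [k] and [w]; [a] is the threshold of the
   event in terms of [Y]. *)
pose a := (k - h + x * Num.sqrt w) / Num.sqrt v.
have sv0 : 0 < Num.sqrt v by rewrite sqrtr_gt0.
have sw0 : 0 < Num.sqrt w by rewrite sqrtr_gt0.
have YE G : Y G = (chi G - h) / Num.sqrt v.
  have -> : Num.sqrt v = h ^+ 2 * Num.sqrt (2 * (T * h)).
    have -> : v = (h ^+ 2) ^+ 2 * (2 * (T * h)) by rewrite /v; ring.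
    by rewrite sqrtrM ?sqr_ge0// sqrtr_sqr ger0_norm// sqr_ge0.
  rewrite /Y /linearized_chi -susceptibility_moment.
  have sh0 : 0 < Num.sqrt (2 * (T * h)) by rewrite sqrtr_gt0 !mulr_gt0.
  have e1 : 1 - N * T = h^-1 by rewrite invrK.
  by rewrite e1; field; rewrite !gt_eqF.
have eventE G : ((chi G - k) / Num.sqrt (2 * p * k ^+ 5) <= x) = (Y G <= a).
  rewrite YE /a ler_pdivrMr// ler_pM2r ?invr_gt0// -/w.
  by apply/idP/idP; lra.
under eq_Ex do rewrite eventE.
have u0 := u_ge0 n0 p0 pN.
have h2k := hh_edge_time_le2 n0 p0 pN u8.
have h38k : h ^+ 3 <= 8 * k ^+ 3.
  by rewrite (_ : 8 * _ = (2 * k) ^+ 3); [apply: lerXn2r;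
    rewrite ?nnegrE// ltW// mulr_gt0|ring].
have th0 : 0 < 3 * eta by rewrite mulr_gt0.
have th1 : 3 * eta <= 1 by have := eta4; lra.
(* [h ^ 3 <= 8 k ^ 3 = 8 u N] and [8 <= 3 ^ 2]. *)
have hth : h ^+ 3 <= (3 * eta) ^+ 2 * N.
  apply: le_trans h38k _; rewrite -uN mulrA; apply: ler_wpM2r; first exact: ltW.
  by have := ueta; have := sqr_ge0 eta; lra.
have th'0 : 0 <= 9 * eta by rewrite mulr_ge0// ltW.
have hth' : h ^+ 3 <= (9 * eta) ^+ 2 * (N ^+ 2 * T).
  have pT := edge_time_ge n0 p0 pN u8.
  (* If [N p] is at most one half, then [h] is bounded and [N ^ 2 p] is large by [weta]; otherwise
     [N ^ 2 T] is at least [N / 2] and the bound on [u] suffices. *)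
  have [Np|Np] := leP (N * p) 2^-1.
    have e0 : 0 < 1 - N * p by rewrite -invr_gt0.
    have k2 : k <= 2.
      rewrite -[leRHS]invrK lef_pV2 ?posrE ?invr_gt0//.
      by move: Np; move: (N * p) => y *; lra.
    have k38 : k ^+ 3 <= 8.
      rewrite (_ : 8 = 2 ^+ 3); last by rewrite -natrX.
      by apply: lerXn2r; rewrite ?nnegrE// ltW.
    have N2p : 0 < N ^+ 2 * p by rewrite mulr_gt0// exprn_gt0.
    have w1 : 1 <= eta ^+ 2 * (N ^+ 2 * p).
      by rewrite -ler_pdivrMr// div1r.
    have w2 : eta ^+ 2 * (N ^+ 2 * p) <= eta ^+ 2 * (N ^+ 2 * T).
      by apply: ler_wpM2l; [exact: sqr_ge0|apply: ler_wpM2l => //; exact: sqr_ge0].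
    by lra.
  have NT : 2^-1 <= N * T by apply: le_trans (ltW Np) _; rewrite ler_wpM2l// ltW.
  have w1 : eta ^+ 2 * N * 2^-1 <= eta ^+ 2 * N * (N * T).
    by apply: ler_wpM2l => //; rewrite mulr_ge0 ?sqr_ge0// ltW.
  have w2 : u * N <= eta ^+ 2 * N by apply: ler_wpM2r => //; exact: ltW.
  have w3 : 0 <= eta ^+ 2 * N by rewrite mulr_ge0 ?sqr_ge0// ltW.
  by rewrite uN in w2; lra.
have EB b := @normal_approx R n T C (3 * eta) (9 * eta) K delta b n0 T_gt0 NT1 th0 th1 hth
  th'0 hth' C1 (@emC n T NT1) K0 d0 phiK.
have phiK1 y : `|normal_pdf (0 : R) 1 y| <= K by case: (phiK y).
have := smoothing T0 x a d0 L0 K0 phiK1 EB.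
move=> /le_trans; apply; rewrite -/B (_ : B * (3 * eta + 9 * eta) = 12 * B * eta);
  last by ring.
rewrite lerD2l; apply: ler_wpM2l => //; rewrite lerD2r lerD2r.
have -> : a - x = (k - h) / Num.sqrt v + x * (Num.sqrt w / Num.sqrt v - 1).
  by rewrite /a; ring.
apply: le_trans (ler_normD _ _) _; rewrite [leRHS]mulrDl; apply: lerD.
  have g := center_gap n0 p0 pN u8 p_gt0; rewrite -/v in g.
  rewrite normrM normfV (gtr0_norm sv0) ler_pdivrMr//.
  have r0 : 0 <= 2 * eta * Num.sqrt v by rewrite !mulr_ge0// ltW.
  apply: ler_norm_of_sqr; first exact: r0.
  rewrite -sqrrN opprB.
  apply: (le_trans g); rewrite !exprMn sqr_sqrtr; last exact: ltW.
  rewrite -natrX; apply: ler_wpM2r; first exact: ltW.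
  by apply: ler_wpM2l.
rewrite normrM mulrAC [leRHS]mulrC; apply: ler_wpM2l => //.
have wv : w <= v by rewrite /w /v -mulrA ler_wpM2l//; exact: variance_ratio_ge.
have vw : v <= w * (1 + 252 * u).
  by rewrite /w /v -(mulrA 2) -(mulrA 2) ler_wpM2l//; exact: variance_ratio.
have swv : Num.sqrt w <= Num.sqrt v by rewrite ler_wsqrtr.
have u252 : 0 <= 252 * u := mulr_ge0 (ler0n _ _) u0.
have u1 : 0 <= 1 + 252 * u := addr_ge0 ler01 u252.
have svw : Num.sqrt v <= Num.sqrt w * (1 + 252 * u).
  rewrite -[leLHS](gtr0_norm sv0); apply: ler_norm_of_sqr.
    by rewrite mulr_ge0// ltW.
  rewrite exprMn !sqr_sqrtr ?(ltW v0) ?(ltW w0)//; apply: (le_trans vw).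
  apply: ler_wpM2l; first exact: ltW.
  by rewrite expr2; apply: ler_peMl => //; rewrite lerDl.
rewrite ler0_norm; last by rewrite subr_le0 ler_pdivrMr// mul1r.
rewrite opprB lerBlDr -lerBlDl ler_pdivlMr//.
have ue : u <= eta.
  by apply: (le_trans ueta); rewrite expr2 ler_piMl// ?(ltW eta0)//; have := eta4; lra.
have : u * Num.sqrt w <= eta * Num.sqrt v.
  by apply: ler_pM => //; exact: ltW.
move: svw; move: (Num.sqrt v) (Num.sqrt w) u => *; lra.
Qed.

End clt.
End finite_estimates.

Lemma gnp_cdf (R : realType) (n : nat) (p m v x : R) : 0 <= p <= 1 ->
  @cdf _ _ R (gnp_prob n p) (standardized (susceptibility R : {RV (gnp_prob n p) >->
    R}) m v) x =
  (\sum_(G : {set pedge n}) gnp_pmf n p G *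
     ((susceptibility R G - m) / Num.sqrt v <= x)%R%:R)%:E.
Proof.
move=> p01.
transitivity (gnp_prob n p (standardized (susceptibility R) m v @^-1` `]-oo, x])%classic).
  by [].
rewrite gnp_probE//; congr EFin.
apply: eq_bigr => G _; congr (_ * _%:R); congr nat_of_bool.
apply/idP/idP => [/set_mem/=|Gx]; first by rewrite in_itv.
by apply/mem_set; rewrite /= in_itv.
Qed.

Section Phi_tails.
Variable R : realType.

Let idTR : measurableTypeR R -> R := idfun.

#[local] HB.instance Definition _ :=
  @isMeasurableFun.Build _ _ _ _ idTR (@measurable_id _ _ setT).

(** [Phi] is the distribution function of the identity under the normal law, so its limits at both
    infinities are the general ones. *)
Lemma Phi_tails (e : R) : 0 < e ->
  exists2 L : R, 0 <= L & Phi (- L) + (1 - Phi L) <= e.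
Proof.
move=> e0; have e2 : 0 < e / 2 by rewrite divr_gt0.
pose X : {RV (normal_prob (0 : R) 1) >-> R} := idTR.
have cdfE r : cdf X r = (Phi r)%:E by rewrite /cdf /distribution /pushforward -PhiE.
have fineE : fine \o cdf X = @Phi R by apply/funext => r; rewrite /comp cdfE.
have Phiy : (Phi r @[r --> +oo%R] --> (1 : R))%classic.
  by have /fine_cvg := @cvg_cdfy1 _ _ _ _ X; rewrite fineE.
have PhiNy : (Phi r @[r --> -oo%R] --> (0 : R))%classic.
  by have /fine_cvg := @cvg_cdfNy0 _ _ _ _ X; rewrite fineE.
move/cvgrPdist_le : Phiy => /(_ _ e2) [M1 [_ M1P]].
move/cvgrPdist_le : PhiNy => /(_ _ e2) [M2 [_ M2P]].
pose L := `|M1| + `|M2| + 1.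
have L1 : M1 < L by rewrite /L; have := ler_norm M1; have := normr_ge0 M2; lra.
have L2 : - L < M2 by rewrite /L; have := ler_norm (- M2); rewrite normrN;
  have := normr_ge0 M1; lra.
exists L; first by rewrite /L !addr_ge0.
have := M1P _ L1; have := M2P _ L2.
rewrite sub0r normrN !ler_norml => /andP[? ?] /andP[? ?]; lra.
Qed.

End Phi_tails.

Local Open Scope classical_set_scope.
Local Open Scope ring_scope.

(** The cube of the diverging quantity is the inverse of the small one; the 1 in the maximum ensures
    that cubing does not decrease it. *)
Lemma subcritical_small (R : realType) (p : nat -> R) (e : R) : 0 < e ->
  n%:R `^ (3^-1) * (1 - n%:R * p n) @[n --> \oo] --> +oo ->
  \forall n \near \oo, (0 < n)%N /\ (1 - n%:R * p n)^-1 ^+ 3 / n%:R <= e.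
Proof.
move=> e0 /cvgryPge/(_ (Num.max 1 e^-1)) hsub.
near=> n; have n0 : (0 < n)%N by near: n; exact: nbhs_infty_gt.
split=> //.
have : Num.max 1 e^-1 <= n%:R `^ (3^-1) * (1 - n%:R * p n) by near: n.
set x := _ * _; rewrite ge_max => /andP[x1 ex].
have x3 : x ^+ 3 = n%:R * (1 - n%:R * p n) ^+ 3.
  by rewrite exprMn -powR_mulrn ?powR_ge0// -powRrM mulVf// powRr1.
have x0 : 0 < x by exact: lt_le_trans x1.
rewrite -[X in X <= _]invrK invf_div -exprVn invrK -x3 -[leRHS]invrK.
rewrite lef_pV2 ?posrE ?invr_gt0 ?exprn_gt0//.
apply: (le_trans ex); rewrite exprS ler_peMr ?exprn_ege1// ltW//.
Unshelve. all: by end_near. Qed.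

Theorem theorem1p3 (R : realType) (p : nat -> R)
  (hp : forall n : nat, (0 < n)%N -> 0 <= p n < n%:R^-1)
  (hsub : n%:R `^ (3^-1) * (1 - n%:R * p n) @[n --> \oo] --> +oo) :
  (* If n ^ 2 * p n stays bounded along a subsequence, the graph is empty with
     probability bounded away from 0 and AsN fails. *)
  (n%:R ^+ 2 * p n @[n --> \oo] --> +oo ->
   AsN (fun n => susceptibility R : {RV (gnp_prob n (p n)) >-> R})
     (fun n => 1 / (1 - n%:R * p n))
     (fun n => 2 * p n / (1 - n%:R * p n) ^+ 5)) /\
  (fun n => fine 'V_(gnp_prob n (p n))[susceptibility R]%E : R^o)
    ~_\oo (fun n => 2 * p n / (1 - n%:R * p n) ^+ 5).
Proof.
(* This covers moments up to the seventh, the highest one that the cubed jumps require. *)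
have [C C1 emC] := em_le R 5.
have [K K0 phiK] := phi_bounds R.
split; last first.
  apply/eqaddoP => e e0.
  have D0 : 0 < 504 + 4000 * C by move: C1; lra.
  have m0 : 0 < Num.min 8^-1 (e / (504 + 4000 * C)).
    by rewrite lt_min invr_gt0 ltr0n divr_gt0.
  have := subcritical_small m0 hsub; apply: filterS => n [n0].
  rewrite le_min => /andP[u8 ue].
  have /andP[p0 pN] := hp _ n0.
  have est := gnp_variance_estimate n0 p0 pN u8 C1 emC.
  have k0 : 0 <= (1 - n%:R * p n)^-1 by exact: le_trans (k_ge1 n0 p0 pN).
  have vE : 2 * p n / (1 - n%:R * p n) ^+ 5 = 2 * p n * (1 - n%:R * p n)^-1 ^+ 5.
    by rewrite exprVn.
  have v0 : 0 <= 2 * p n * (1 - n%:R * p n)^-1 ^+ 5.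
    by apply: mulr_ge0; [rewrite mulr_ge0|rewrite exprn_ge0].
  rewrite /= !fctE vE; apply: (le_trans est).
  rewrite [X in _ <= _ * X]ger0_norm//; apply: ler_wpM2r => //.
  by rewrite mulrC -ler_pdivlMr.
move=> hn2p.
have p_gt0 : \forall n \near \oo, 0 < p n.
  move/cvgryPge : hn2p => /(_ 1); apply: filterS => n n2p.
  have : 0 < n%:R ^+ 2 * p n by exact: lt_le_trans n2p.
  by apply: contraTT; rewrite -!leNgt => pn; rewrite mulr_ge0_le0// sqr_ge0.
split.
  near=> n; have n0 : (0 < n)%N by near: n; exact: nbhs_infty_gt.
  have /andP[p0 pN] := hp _ n0; have pn : 0 < p n by near: n.
  apply: divr_gt0; first by rewrite mulr_gt0.
  by rewrite exprn_gt0// subr_gt0 mulrC -ltr_pdivlMr ?ltr0n// div1r.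
move=> x _; rewrite [X in _ --> X](PhiE x); apply: cvg_EFin.
  by near=> n; exact: fin_num_measure.
apply/cvgrPdist_le => e e0.
(* The choices are nested: [L] for the tails, then [delta], then [eta], then [n]. The tails, the
   smoothing and the approximation take [e / 4] each; the added 1 in [M] and [Q] keeps these
   divisors positive. *)
have e4 : 0 < e / 4 by rewrite divr_gt0.
have [L L0 tails] := Phi_tails e4.
pose M := K * (L + `|x|) + 1.
have M0 : 0 < M by rewrite ltr_wpDl// mulr_ge0// addr_ge0.
pose delta := Num.min 1 (e / 4 / M).
have d0 : 0 < delta by rewrite lt_min ltr01 !divr_gt0.
have d1 : delta <= 1 by rewrite ge_min lexx.
have dM : K * (L * delta + `|x| * delta ^+ 2) <= e / 4.
  apply: (@le_trans _ _ (delta * M)); last first.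
    by rewrite -ler_pdivlMr// ge_min lexx orbT.
  have : `|x| * delta ^+ 2 <= `|x| * delta.
    by apply: ler_wpM2l => //; rewrite expr2 ler_piMl// ltW.
  move=> /(lerD (lexx (L * delta)))/(ler_wpM2l K0); rewrite /M; lra.
pose B := K * ((3 + 3 * C) / delta + (3 + 10 * C) / delta ^+ 2 + 8 * C ^+ 2 / delta ^+ 3).
pose Q := `|12 * B + K * (2 + 252 * `|x|)| + 1.
have Q0 : 0 < Q by rewrite ltr_wpDl.
pose eta := Num.min 4^-1 (e / 4 / Q).
have eta0 : 0 < eta by rewrite lt_min invr_gt0 ltr0n !divr_gt0.
have eta4 : eta <= 4^-1 by rewrite ge_min lexx.
have etaQ : 12 * B * eta + K * ((2 + 252 * `|x|) * eta) <= e / 4.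
  apply: (@le_trans _ _ (eta * Q)); last first.
    by rewrite -ler_pdivlMr// ge_min lexx orbT.
  have := ler_wpM2l (ltW eta0) (ler_norm (12 * B + K * (2 + 252 * `|x|))).
  by rewrite /Q; lra.
have eta2 : 0 < eta ^+ 2 by rewrite exprn_gt0.
have m0 : 0 < Num.min 8^-1 (eta ^+ 2) by rewrite lt_min invr_gt0 ltr0n.
have small := subcritical_small m0 hsub.
move/cvgryPge : hn2p => /(_ (eta ^+ 2)^-1) large.
near=> n.
have [n0] : (0 < n)%N /\ (1 - n%:R * p n)^-1 ^+ 3 / n%:R <= Num.min 8^-1 (eta ^+ 2) by
  near: n.
rewrite le_min => /andP[u8 ueta].
have pn : 0 < p n by near: n.
have n2p : (eta ^+ 2)^-1 <= n%:R ^+ 2 * p n by near: n.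
have weta : (n%:R ^+ 2 * p n)^-1 <= eta ^+ 2.
  by rewrite -[leRHS]invrK lef_pV2 ?posrE ?invr_gt0// mulr_gt0// exprn_gt0 ?ltr0n.
have /andP[p0 pN] := hp _ n0.
have p01 : 0 <= p n <= 1.
  by rewrite p0 (le_trans (ltW pN))// invf_le1 ?ltr0n// ler1n.
have := gnp_clt_estimate n0 p0 pN u8 C1 emC K0 phiK x pn eta0 eta4 ueta weta L0 d0.
rewrite -/B distrC => est.
rewrite [X in `|_ - X|](_ : _ = Ex (edge_time (p n)) (fun G : {set pedge n} =>
    ((susceptibility R G - (1 - n%:R * p n)^-1) /
     Num.sqrt (2 * p n * (1 - n%:R * p n)^-1 ^+ 5) <= x)%R%:R)); last first.
  rewrite /comp gnp_cdf// /Ex (edge_timeE n0 p0 pN u8).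
  by apply: eq_bigr => G _; rewrite div1r exprVn.
apply: (le_trans est).
move: tails dM etaQ; rewrite -/B => *; lra.
Unshelve. all: by end_near. Qed.
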